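(* Let $L$ be a non-splittable link which admits a $\mathbb{Z}$-coloring $\gamma$ with exactly five colors (i.e., some diagram of $L$ carries a $\mathbb{Z}$-coloring whose image has cardinality $5$). Then $\mathrm{mincol}_{\mathbb{Z}}(L)=4$.
   Context: An arc of a regular link diagram $D$ is a maximal unbroken piece of the diagram. A $\mathbb{Z}$-coloring on $D$ is a map $\gamma:\{\text{arcs of } D\}\to\mathbb{Z}$ such that at each crossing with over arc $a$ and under arcs $b,c$ one has $2\gamma(a)=\gamma(b)+\gamma(c)$; it is trivial if all arcs get the same color. A link is $\mathbb{Z}$-colorable if some diagram of it admits a non-trivial $\mathbb{Z}$-coloring. For a $\mathbb{Z}$-colorable link $L$, $\mathrm{mincol}_{\mathbb{Z}}(L)$ is the minimum of $|\mathrm{Im}(\gamma)|$ over all non-trivial $\mathbb{Z}$-colorings $\gamma$ on all diagrams of $L$. *)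

(* Defs.v *)
(* A combinatorial model of (unoriented) link diagrams on the
   2-sphere via planar-diagram (PD) codes, Reidemeister equivalence, and
   Z-colorings. *)
From mathcomp Require Import all_boot all_order all_algebra.
From Stdlib Require Import Relations.
Set Implicit Arguments.
Unset Strict Implicit.
Unset Printing Implicit Defensive.
Import GRing.Theory Num.Theory.

(* A crossing (a,b,c,d): the four edge labels met at the crossing, listed
   counterclockwise; a and c lie on the under-strand, b and d on the
   over-strand.  (a,b,c,d) and (c,d,a,b) describe the same crossing. *)
Definition crossing := (nat * nat * nat * nat)%type.

Definition clabels (x : crossing) : seq nat :=
  let: (a, b, c, d) := x in [:: a; b; c; d].

Definition rotX (x : crossing) : crossing :=
  let: (a, b, c, d) := x in (c, d, a, b).

Definition mapX (f : nat -> nat) (x : crossing) : crossing :=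
  let: (a, b, c, d) := x in (f a, f b, f c, f d).

(* A link diagram: a list of crossings (edges = labels, each used exactly
   twice) together with a number of crossing-free circle components. *)
Record diagram := Diagram { xs : seq crossing; circ : nat }.

Definition labels (D : diagram) : seq nat := flatten (map clabels (xs D)).

Definition ncross (D : diagram) : nat := size (xs D).

Definition dart (D : diagram) := ('I_(ncross D) * 'I_4)%type.

Definition lab (D : diagram) (e : dart D) : nat :=
  nth 0 (clabels (nth (0, 0, 0, 0) (xs D) e.1)) e.2.

Definition other (D : diagram) (e : dart D) : dart D :=
  odflt e [pick e' | (e' != e) && (lab e' == lab e)].

Definition facestep (D : diagram) (e : dart D) : dart D :=
  let e' := other e in (e'.1, ordS e'.2).

Definition nfaces (D : diagram) : nat := n_comp (frel (@facestep D)) predT.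

Definition adjX (D : diagram) : rel 'I_(ncross D) :=
  fun i j => has (fun l => l \in clabels (nth (0, 0, 0, 0) (xs D) j))
                 (clabels (nth (0, 0, 0, 0) (xs D) i)).

Definition ngcomp (D : diagram) : nat := n_comp (@adjX D) predT.

(* Well-formed diagram: every edge label occurs exactly twice, and each
   connected component of the 4-valent graph with its rotation system is
   spherical (Euler: F = V + 2 * #components). *)
Definition valid (D : diagram) : Prop :=
  (forall l, count_mem l (labels D) \in [:: 0; 2]) /\
  nfaces D = ncross D + 2 * ngcomp D.

Definition subst (q p : nat) (C : seq crossing) : seq crossing :=
  map (mapX (fun l => if l == q then p else l)) C.

(* join the two loose ends p and q (at the two ends of a strand whose
   middle was removed) into one edge; if p = q the strand closes up into a
   crossing-free circle. *)
Definition merge (p q : nat) (D : diagram) : diagram :=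
  if p == q then Diagram (xs D) (circ D).+1
  else Diagram (subst q p (xs D)) (circ D).

Definition sub1 (p q : nat) (l : nat) : nat := if p == q then l else
  if l == q then p else l.

(* crossing whose 0/2 slots (ccw order o0 o1 o2 o3) carry the under strand
   iff u *)
Definition mkX (u : bool) (o0 o1 o2 o3 : nat) : crossing :=
  if u then (o0, o1, o2, o3) else (o1, o2, o3, o0).

(* elementary steps: planar isotopy / relabelling, and Reidemeister moves
   (R1, R2 in the reducing direction; R3).  Symmetry comes from closure. *)
Inductive step : diagram -> diagram -> Prop :=
  | st_perm C C' k : perm_eq C C' -> step (Diagram C k) (Diagram C' k)
  | st_rot C1 x C2 k :
      step (Diagram (C1 ++ x :: C2) k) (Diagram (C1 ++ rotX x :: C2) k)
  | st_relab (f : nat -> nat) C k : injective f ->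
      step (Diagram C k) (Diagram (map (mapX f) C) k)
  | st_R1a p l q C k :
      step (Diagram ((p, l, l, q) :: C) k) (merge p q (Diagram C k))
  | st_R1b p l q C k :
      step (Diagram ((l, l, p, q) :: C) k) (merge p q (Diagram C k))
  | st_R2 a1 a2 b1 b2 e1 e2 C k :
      step (Diagram ((a2, e1, e2, a1) :: (e2, e1, b2, b1) :: C) k)
           (merge (sub1 a1 b1 a2) (sub1 a1 b1 b2)
                  (merge a1 b1 (Diagram C k)))
  | st_R3 (t s : bool) w1 e1 s2 n2 n3 s3 i1 i2 i3 j1 j2 j3 C k :
      step (Diagram ([:: mkX (~~ t) i1 i2 w1 s2; mkX (~~ t) e1 i3 i1 s3;
                         mkX s n2 n3 i2 i3] ++ C) k)
           (Diagram ([:: mkX (~~ t) j1 n3 w1 j3; mkX (~~ t) e1 n2 j1 j2;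
                         mkX s j2 j3 s2 s3] ++ C) k).

Definition vstep (D D' : diagram) : Prop := valid D /\ valid D' /\ step D D'.

Definition link_equiv : diagram -> diagram -> Prop :=
  clos_refl_sym_trans diagram vstep.

Definition npieces (D : diagram) : nat := ngcomp D + circ D.

Definition splittable (D : diagram) : Prop :=
  exists D', link_equiv D D' /\ 2 <= npieces D'.

Definition non_splittable (D : diagram) : Prop := ~ splittable D.

(* Z-coloring: gam colors the edges, g the crossing-free circles.  Being
   constant on arcs means the two over-edges b,d of a crossing get the same
   color; the crossing condition is 2*gam(over) = gam(under1)+gam(under2). *)
Definition Zcoloring (D : diagram) (gam : nat -> int) : Prop :=
  forall x, x \in xs D ->
    let: (a, b, c, d) := x in
    gam b = gam d /\ (2%:Z * gam b = gam a + gam c)%R.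

Definition colors (D : diagram) (gam g : nat -> int) : seq int :=
  undup ([seq gam l | l <- labels D] ++ [seq g i | i <- iota 0 (circ D)]).

Definition ncolors (D : diagram) (gam g : nat -> int) : nat :=
  size (colors D gam g).

Definition nontrivial (D : diagram) (gam g : nat -> int) : Prop :=
  1 < ncolors D gam g.

Definition mincolZ_is (D0 : diagram) (m : nat) : Prop :=
  (exists D gam g, link_equiv D0 D /\ valid D /\ Zcoloring D gam /\
      nontrivial D gam g /\ ncolors D gam g = m) /\
  (forall D gam g, link_equiv D0 D -> valid D -> Zcoloring D gam ->
      nontrivial D gam g -> m <= ncolors D gam g).

(* Main.v *)
(* Upper bound.  Let B be the largest value of |over - under| in a coloring.  A
   crossing with a smaller non-zero difference is carried, through crossings
   with equal colors, next to a crossing of difference B; a Reidemeister III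
   move there decreases the number of crossings of difference B.  Hence a
   coloring with all differences 0 or 1 exists, after rescaling.  If its colors
   span [m, M] with M >= m + 4, the color M is removed: a strand of color M - 1
   is pulled over a crossing with all edges of color M, and a strand of color
   M - 2, created by a Reidemeister I move, is pulled over both ends of an edge
   of color M.  The process ends with at most four colors.

   Lower bound.  With at most three colors, an arc of the middle color never
   passes under an arc of another color.  A diagram of which one part lies
   above the rest represents a splittable link: pulling strands across the
   crossings of a part gathers these into one cluster, for each of the two
   parts, and then Euler's formula yields a bigon between the two parts, which
   a Reidemeister II move removes, until the diagram falls apart. *)
Require Import Defs.
From mathcomp Require Import all_boot all_order all_algebra all_fingroup zify.
From Stdlib Require Import Relations Classical ClassicalEpsilon.

Set Implicit Arguments.
Unset Strict Implicit.
Unset Printing Implicit Defensive.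
Import GRing.Theory Num.Theory.

Local Notation root := fingraph.root.

(** * Components of relations and the genus inequality *)

Section Components.

(** Only valid diagrams may occur along an equivalence, so every move comes with a proof that its
    result is again planar, and planarity is here a count of faces. This is why the Reidemeister
    moves need explicit correspondences between faces, and why Euler's formula is wanted as an
    inequality for arbitrary pairs of permutations. In that form it tells what happens when the
    deletion of a bigon disconnects the diagram, and it also applies to the map that remains when
    part of the crossings is forgotten, which is how a bigon is found. Non-splittability leaves a
    single piece, hence no crossing-free circle next to a non-trivial coloring. Connectedness is
    then used in one form throughout: a property of edges that no crossing separates holds for all
    edges or for none. The number four is the limit of the elimination because an edge of color M
    pulled under a strand of color M - 2 takes the color M - 4, which must not fall below m. In the
    lower bound the pure crossings of each part have to form one connected cluster; with more
    components the bound on the number of faces would be too weak to force a bigon. *)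

Lemma connect_respect (K : Type) (F : finType) (e : rel F) (h : F -> K) :
  (forall x y, e x y -> h x = h y) -> forall x y, connect e x y -> h x = h y.
Proof.
move=> he x y /connectP[p]; elim: p x => [|z p IH] x /= => [_ ->//|].
by case/andP=> /he -> /IH; apply.
Qed.

Lemma n_comp_img (T K : finType) (e : rel T) (h : T -> K) :
    connect_sym e -> (forall x y, connect e x y = (h x == h y)) ->
  n_comp e predT = #|[set h x | x : T]|.
Proof.
move=> se he; rewrite /n_comp_mem.
have -> : [set h x | x : T] = [set h x | x in [set x | roots e x]].
  apply/setP=> k; apply/imsetP/imsetP=> -[x _ ->].
    exists (root e x); first by rewrite inE roots_root.
    by apply/eqP; rewrite -he connect_root.
  by exists x.
rewrite card_in_imset => [|x y].
  by apply: eq_card => x; rewrite !inE andbT.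
rewrite !inE => /eqP rx /eqP ry hxy.
by rewrite -rx -ry; apply/fingraph.rootP => //; rewrite he hxy.
Qed.

Lemma n_comp_class (T1 T2 : finType) (e1 : rel T1) (e2 : rel T2) (f : T1 -> T2) :
    connect_sym e1 -> connect_sym e2 ->
    (forall x y, connect e1 x y = connect e2 (f x) (f y)) ->
    (forall y, exists x, connect e2 y (f x)) ->
  n_comp e1 predT = n_comp e2 predT.
Proof.
move=> s1 s2 fe fs.
rewrite (@n_comp_img _ _ _ (fun x => root e2 (f x))) //; last first.
  by move=> x y; rewrite fe root_connect.
rewrite (@n_comp_img _ _ _ (root e2)) //; last by move=> x y; rewrite root_connect.
congr #|pred_of_set _|; apply/setP=> k; apply/imsetP/imsetP=> -[x _ ->].
  by exists (f x).
by have [y /(fingraph.rootP s2) ->] := fs x; exists y.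
Qed.

Lemma n_comp_retract (T1 T2 : finType) (e1 : rel T1) (e2 : rel T2)
    (f : T1 -> T2) (g : T2 -> T1) :
    connect_sym e1 -> connect_sym e2 ->
    (forall x y, e1 x y -> connect e2 (f x) (f y)) ->
    (forall x y, e2 x y -> connect e1 (g x) (g y)) ->
    (forall x, connect e1 x (g (f x))) -> (forall y, connect e2 y (f (g y))) ->
  n_comp e1 predT = n_comp e2 predT.
Proof.
move=> s1 s2 he1 he2 gf fg.
have fC x y : connect e1 x y -> connect e2 (f x) (f y).
  move=> cxy; apply/(fingraph.rootP s2).
  by apply: (@connect_respect _ _ e1 (fun z => root e2 (f z))) cxy => u v /he1 /(fingraph.rootP s2).
have gC x y : connect e2 x y -> connect e1 (g x) (g y).
  move=> cxy; apply/(fingraph.rootP s1).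
  by apply: (@connect_respect _ _ e2 (fun z => root e1 (g z))) cxy => u v /he2 /(fingraph.rootP s1).
apply: (n_comp_class s1 s2 (f := f)) => [x y|y]; last by exists (g y).
apply/idP/idP => [/fC//|/gC h].
by apply: connect_trans (gf x) (connect_trans h _); rewrite s1.
Qed.

(** Adds an isolated point. It stands for the small face, monogon or bigon, that a Reidemeister I or
    II move creates. *)
Definition opt_rel (T : finType) (e : rel T) : rel (option T) := fun x y =>
  match x, y with Some x, Some y => e x y | None, None => true | _, _ => false end.

Lemma connect_opt (T : finType) (e : rel T) x y :
  connect (opt_rel e) x y =
  match x, y with Some x, Some y => connect e x y | None, None => true | _, _ => false end.
Proof.
apply/idP/idP.
  case/connectP=> p; elim: p x => [|z p IH] x /= => [_ ->|]; first by case: x.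
  case/andP=> exz /IH h /h {h IH}; case: x z exz => [x|] [z|] //= exz.
  by case: y => // y; apply: connect_trans; apply: connect1.
case: x y => [x|] [y|] // /connectP[p]; elim: p x => [|z p IH] x /= => [_ ->//|].
by case/andP=> exz /IH h /h; apply: connect_trans; apply: connect1.
Qed.

Lemma opt_rel_sym (T : finType) (e : rel T) : connect_sym e -> connect_sym (opt_rel e).
Proof. by move=> se [x|] [y|]; rewrite !connect_opt. Qed.

Lemma n_comp_opt (T : finType) (e : rel T) : connect_sym e ->
  n_comp (opt_rel e) predT = (n_comp e predT).+1.
Proof.
move=> se.
rewrite (@n_comp_img _ _ _ (omap (root e))); first last.
- by move=> [x|] [y|]; rewrite connect_opt //= -root_connect.
- exact: opt_rel_sym.
rewrite (@n_comp_img _ _ e (root e)) //; last by move=> x y; rewrite root_connect.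
have -> : [set omap (root e) x | x : option T] = None |: Some @: [set root e x | x : T].
  apply/setP=> -[k|]; rewrite !inE /=.
    rewrite mem_imset; last by move=> ? ? [].
    by apply/imsetP/imsetP=> [[[x|] _ //= [->]]|[x _ ->]]; [exists x|exists (Some x)].
  by apply/imsetP; exists None.
rewrite cardsU1 card_imset; last by move=> ? ? [].
by case: imsetP => // -[].
Qed.

Lemma n_comp_le_set (T : finType) (e : rel T) (A : {set T}) :
  connect_sym e -> (forall x, exists2 y, y \in A & connect e x y) -> n_comp e predT <= #|A|.
Proof.
move=> se hA; rewrite (@n_comp_img _ _ e (root e)) //; last by move=> x y; rewrite root_connect.
apply: leq_trans (leq_imset_card (root e) A); apply: subset_leq_card.
apply/subsetP=> k /imsetP[x _ ->]; have [y yA /(fingraph.rootP se) ->] := hA x.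
exact: imset_f.
Qed.

(** A value that is constant along edges separates components. Lower bounds on numbers of cycles are
    obtained below by exhibiting such a function. *)
Lemma n_comp_ge_fun (T K : finType) (e : rel T) (c : T -> K) :
  connect_sym e -> (forall x y, e x y -> c x = c y) -> #|[set c x | x : T]| <= n_comp e predT.
Proof.
move=> se he; rewrite (@n_comp_img _ _ e (root e)) //; last by move=> x y; rewrite root_connect.
apply: leq_trans (leq_imset_card c _); apply: subset_leq_card.
apply/subsetP=> k /imsetP[x _ ->]; apply/imsetP; exists (root e x); first exact: imset_f.
by apply: (@connect_respect _ _ e) => //; apply: connect_root.
Qed.

(** Once the component of [y] is identified with that of [x], the components of [e'] give a function
    that is constant along [e], and the identification has lost one value only. *)
Lemma n_comp_add_edge (T : finType) (e e' : rel T) (x y : T) :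
    connect_sym e -> connect_sym e' ->
    (forall u v, e u v -> connect e' u v \/ (u, v) \in [:: (x, y); (y, x)]) ->
  n_comp e' predT <= (n_comp e predT).+1.
Proof.
move=> se se' he.
pose c u := if connect e' u y then root e' x else root e' u.
have hc : #|[set c u | u : T]| <= n_comp e predT.
  apply: n_comp_ge_fun => // u v /he[uv|]; rewrite /c.
    by rewrite (same_connect se' uv); case: ifP => // _; apply/(fingraph.rootP se').
  by rewrite !inE => /orP[]/eqP[-> ->]; rewrite connect0; case: ifP.
apply: (@leq_trans #|[set c u | u : T]|.+1); last by rewrite ltnS.
rewrite (@n_comp_img _ _ e' (root e')) //; last by move=> u v; rewrite root_connect.
rewrite -add1n -(cards1 (root e' y)); apply: leq_trans (leq_card_setU _ _).
apply: subset_leq_card; apply/subsetP=> k /imsetP[u _ ->]; rewrite !inE.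
case: (boolP (connect e' u y)) => [/(fingraph.rootP se') ->|nuy]; first by rewrite eqxx.
by apply/orP; right; apply/imsetP; exists u => //; rewrite /c (negbTE nuy).
Qed.

End Components.

Section Genus.
Variable T : finType.
Implicit Types s a : {perm T}.

Lemma fconnect_porbit s x y : fconnect s x y = (y \in porbit s x).
Proof.
apply/idP/idP => [/iter_findex <-|/porbitP[i ->]].
  by rewrite -permX mem_porbit.
by rewrite permX fconnect_iter.
Qed.

Lemma n_comp_porbits s : n_comp (frel s) predT = #|porbits s|.
Proof.
rewrite (@n_comp_img _ _ _ (porbit s)) //; first exact: fconnect_sym (@perm_inj _ _).
by move=> x y; rewrite fconnect_porbit eq_porbit_mem porbit_sym.
Qed.

(** For a rotation [s] at the vertices and an involution [a] along the edges, the classes of this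
    relation are the connected components of the map. *)
Definition gen_rel s a : rel T := fun x y => (y == s x) || (y == a x).

Lemma gen_rel_sym s a : connect_sym (gen_rel s a).
Proof.
suff h x y : gen_rel s a x y -> connect (gen_rel s a) y x.
  have hc x' y' : connect (gen_rel s a) x' y' -> connect (gen_rel s a) y' x'.
    case/connectP=> p; elim: p x' => [|z p IH] x' /= => [_ ->//|].
    by case/andP=> /h zx /IH k /k /connect_trans; apply.
  by move=> x' y'; apply/idP/idP; apply: hc.
have it (t : {perm T}) u : (forall z, gen_rel s a z (t z)) -> connect (gen_rel s a) (t u) u.
  move=> ht; have : fconnect t (t u) u.
    by rewrite fconnect_sym ?fconnect1 //; apply: perm_inj.
  by apply: connect_sub => z w /eqP <-; apply: connect1.
case/orP=> /eqP ->; apply: it => z; rewrite /gen_rel eqxx ?orbT //.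
Qed.

(* Riemann-Hurwitz: a fixed-point-free part of [a] is peeled off one
   transposition at a time; each transposition changes the number of cycles
   of [a * s] by one, and can lower the number of components only when it
   merges two cycles. *)
Lemma genus_le s a : involutive a ->
  #|porbits s| + #|porbits a| + #|porbits (a * s)%g| <=
    #|T| + 2 * n_comp (gen_rel s a) predT.
Proof.
have [n] := ubnP #|[set x | a x != x]|; elim: n a => // n IH a ltn inva.
case: (pickP [pred x | a x != x]) => [x /= ax|a1]; last first.
  have -> : a = 1%g by apply/permP=> x; rewrite perm1; apply/eqP/negbFE/a1.
  have -> : n_comp (gen_rel s 1) predT = #|porbits s|.
    rewrite -n_comp_porbits; apply: (n_comp_class (f := id)) => //.
    - exact: gen_rel_sym.
    - exact: fconnect_sym (@perm_inj _ _).
    - move=> x y; apply/idP/idP; apply: connect_sub => u v.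
        by case/orP=> /eqP ->; rewrite ?perm1 ?connect0 ?fconnect1.
      by move/eqP <-; apply: connect1; rewrite /gen_rel eqxx.
    - by move=> y; exists y.
  have -> : #|porbits (1 : {perm T})| = #|T|.
    rewrite card_imset // => x y /eqP; rewrite eq_porbit_mem => /porbitP[i ->].
    by rewrite expg1n perm1.
  by rewrite mul1g; lia.
(* [a'] is [a] with the 2-cycle through [x] and [y] dissolved into two fixed points. *)
set y := a x in ax; pose a' : {perm T} := (tperm x y * a)%g.
have ay : a y = x by rewrite /y inva.
have a'x : a' x = x by rewrite permM tpermL.
have a'y : a' y = y by rewrite permM tpermR.
have a'o z : z != x -> z != y -> a' z = a z.
  by move=> zx zy; rewrite permM tpermD // eq_sym.
have aE : a = (tperm x y * a')%g by rewrite mulgA tperm2 mul1g.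
have inva' : involutive a'.
  move=> z; have [->|zx] := eqVneq z x; first by rewrite !a'x.
  have [->|zy] := eqVneq z y; first by rewrite !a'y.
  rewrite (a'o z) // a'o ?inva //; first by rewrite -ay inj_eq //; apply: perm_inj.
  by rewrite inj_eq //; apply: perm_inj.
have lt' : #|[set z | a' z != z]| < n.
  rewrite -ltnS; apply: leq_trans ltn; rewrite ltnS; apply: proper_card.
  apply/properP; split; last by exists x; rewrite !inE ?a'x ?eqxx.
  apply/subsetP=> z; rewrite !inE => a'z.
  have zx : z != x by apply: contraNneq a'z => ->; rewrite a'x.
  have zy : z != y by apply: contraNneq a'z => ->; rewrite a'y.
  by rewrite -a'o.
have ar (p q q' r r' t k k' : nat) : p + q' + r' <= t + 2 * k' -> r + 2 = r' + 1 ->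
  q + 2 = q' + 1 -> k' <= k.+1 -> p + q + r <= t + 2 * k by lia.
have ar2 (p q q' r r' t k : nat) : p + q' + r' <= t + 2 * k -> r + 0 = r' + 1 ->
  q + 2 = q' + 1 -> p + q + r <= t + 2 * k by lia.
have nxy : x != y by rewrite eq_sym.
have IHa := IH _ lt' inva'.
have := porbits_mul_tperm a' x y; rewrite /= -aE nxy.
have -> : x \notin porbit a' y.
  apply/negP=> /porbitP[i xE]; suff xy : x = y by rewrite xy eqxx in nxy.
  by rewrite xE permX; elim: {xE} i => //= i ->.
have := porbits_mul_tperm (a' * s)%g x y; rewrite /= mulgA -aE nxy.
have sub' u v : gen_rel s a u v ->
    connect (gen_rel s a') u v \/ (u, v) \in [:: (x, y); (y, x)].
  case/orP=> /eqP ->; first by left; apply: connect1; rewrite /gen_rel eqxx.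
  have [->|ux] := eqVneq u x; first by right; rewrite inE eqxx.
  have [->|uy] := eqVneq u y; first by right; rewrite !inE ay eqxx orbT.
  by left; apply: connect1; rewrite /gen_rel a'o // eqxx orbT.
have le1 := n_comp_add_edge (gen_rel_sym s a) (gen_rel_sym s a') sub'.
case: (boolP (x \in porbit (a' * s)%g y)) => [xy|nxy2] /=; last first.
  move=> h1 h2; apply: (ar _ _ _ _ _ _ _ _ IHa h1 h2 le1).
(* Here [x] and [y] lie on one cycle of [a' * s]. That cycle joins them in the graph of [a']
   already, so dissolving the 2-cycle loses no connection. *)
move=> h1 h2; suff E : n_comp (gen_rel s a') predT = n_comp (gen_rel s a) predT.
  by rewrite E in IHa; apply: (ar2 _ _ _ _ _ _ _ IHa h1 h2).
have cxy : connect (gen_rel s a') y x.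
  rewrite -fconnect_porbit in xy; apply: connect_sub xy => u v /eqP <-.
  rewrite permM; apply: (@connect_trans _ _ (a' u)); apply: connect1.
    by rewrite /gen_rel eqxx orbT.
  by rewrite /gen_rel eqxx.
have [sa sa'] := (gen_rel_sym s a, gen_rel_sym s a').
apply: (n_comp_class (f := id)) => // [u v|v]; last by exists v.
apply/idP/idP; apply: connect_sub => {u v}u v; last first.
  case/sub' => //; rewrite !inE => /orP[]/eqP[-> ->] //.
  by rewrite sa'.
case/orP=> /eqP ->; first by apply: connect1; rewrite /gen_rel eqxx.
have [->|ux] := eqVneq u x; first by rewrite a'x.
have [->|uy] := eqVneq u y; first by rewrite a'y.
by apply: connect1; rewrite /gen_rel a'o // eqxx orbT.
Qed.

End Genus.

(** * Diagrams as combinatorial maps *)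

Definition labs (C : seq crossing) : seq nat := flatten (map clabels C).

Definition wellformed (C : seq crossing) := forall l, count_mem l (labs C) \in [:: 0; 2].

Definition const_at (P : nat -> bool) (x : crossing) : bool :=
  let: (a, b, c, d) := x in [&& P a == P b, P b == P c & P c == P d].

(* Connectedness: a set of labels that no crossing separates is empty or full. *)
Definition connected_labels (C : seq crossing) := forall P : nat -> bool,
  all (const_at P) C -> forall l l', l \in labs C -> l' \in labs C -> P l = P l'.

Lemma cstP (P : nat -> bool) x :
  reflect (forall l l', l \in clabels x -> l' \in clabels x -> P l = P l') (const_at P x).
Proof.
case: x => [[[a b] c] d]; apply: (iffP and3P) => /= [[/eqP ab /eqP bc /eqP cd] l l'|h].
  by rewrite !inE => /or4P[]/eqP -> /or4P[]/eqP ->; rewrite ?cd ?bc ?ab ?cd ?bc ?ab.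
by split; apply/eqP; apply: h; rewrite !inE eqxx ?orbT.
Qed.

Lemma lab_mem C l : reflect (exists2 x, x \in C & l \in clabels x) (l \in labs C).
Proof.
apply: (iffP flattenP) => [[s /mapP[x xC ->] ls]|[x xC lx]]; first by exists x.
by exists (clabels x) => //; apply: map_f.
Qed.

Section Diagram.
Variable C : seq crossing.
Let D := Diagram C 0.
Implicit Types d e : dart D.

Lemma size_clabels x : size (clabels x) = 4.
Proof. by case: x => [[[]]]. Qed.

Lemma lab_in d : lab d \in clabels (nth (0, 0, 0, 0) C d.1).
Proof. by apply: mem_nth; rewrite size_clabels. Qed.

Lemma lab_labs d : lab d \in labs C.
Proof. by apply/lab_mem; exists (nth (0, 0, 0, 0) C d.1); [apply: mem_nth | apply: lab_in]. Qed.

Lemma labs_lab l : l \in labs C -> exists d, lab d = l.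
Proof.
case/lab_mem=> x xC lx.
have ix : index x C < size C by rewrite index_mem.
have il : index l (clabels x) < 4 by rewrite -(size_clabels x) index_mem.
by exists (Ordinal ix, Ordinal il); rewrite /lab /= nth_index // nth_index.
Qed.

Lemma count_darts l : count_mem l (labs C) = #|[pred d : dart D | lab d == l]|.
Proof.
rewrite /labs count_flatten sumnE !big_map (big_nth (0, 0, 0, 0)) big_mkord.
rewrite -sum1_card [RHS]big_mkcond /= [RHS](eq_bigr (fun d => (lab d == l : nat))); last first.
  by move=> d _; rewrite inE; case: (lab d == l).
rewrite -(pair_bigA _ (fun i s => (lab (i, s) == l : nat))) /=.
apply: eq_bigr => i _; rewrite /lab /=.
by case: (nth _ C i) => [[[a b] c] e]; rewrite !big_ord_recr big_ord0 /= !addn0 !addnA.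
Qed.

Hypothesis wlC : wellformed C.

Lemma lab_class d : #|[pred e : dart D | lab e == lab d]| = 2.
Proof.
have := wlC (lab d); rewrite count_darts !inE => /orP[|/eqP //].
by move/eqP/card0_eq/(_ d); rewrite !inE eqxx.
Qed.

Lemma other_spec d : other d != d /\ lab (other d) = lab d.
Proof.
rewrite /other; case: pickP => [e /= /andP[ne /eqP le]//|none].
have := lab_class d; rewrite (cardD1 d) inE eqxx eq_card0 // => e; by have := none e; rewrite !inE.

Qed.

Lemma otherE d e : e != d -> lab e = lab d -> other d = e.
Proof.
move=> ed le; have [od lo] := other_spec d; have := lab_class d.
rewrite (cardD1 d) (cardD1 e) (cardD1 (other d)) !inE eqxx ed le eqxx lo eqxx od /=.
by case: eqVneq.
Qed.

Lemma other_lab d e : lab e = lab d -> e = d \/ e = other d.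
Proof. by have [->|ed le] := eqVneq e d; [left | right; rewrite (otherE ed)]. Qed.

Lemma otherK : involutive (@other D).
Proof. by move=> d; have [nd ld] := other_spec d; apply: otherE; rewrite 1?eq_sym. Qed.

Definition turn (d : dart D) : dart D := (d.1, ordS d.2).

Lemma facestepE d e : e != d -> lab e = lab d -> facestep d = turn e.
Proof. by move=> ed le; rewrite /facestep (otherE ed le). Qed.

Lemma turn_inj : injective turn.
Proof. by move=> [i s] [j t] h; case: (h) => <- _; congr (_, _); apply: (@ordS_inj 4); exact: (congr1 snd h). Qed.

(** The cycles of [turnP], of [otherP] and of their product are the crossings, the edges and the
    faces of the diagram. *)
Definition turnP := perm turn_inj.
Definition otherP := perm (inv_inj otherK).

Lemma facestepP d : (otherP * turnP)%g d = facestep d.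
Proof. by rewrite permM !permE. Qed.

Lemma facestep_inj : injective (@facestep D).
Proof. by move=> d e; rewrite -!facestepP => /perm_inj. Qed.

Lemma facestep_sym : connect_sym (frel (@facestep D)).
Proof. exact: fconnect_sym facestep_inj. Qed.

Lemma nfaces_porbits : nfaces D = #|porbits (otherP * turnP)%g|.
Proof.
rewrite -n_comp_porbits; apply: eq_n_comp => d e.
by apply: eq_connect => x y /=; rewrite facestepP.
Qed.

Lemma turn_connect (e : rel (dart D)) d s : (forall x, connect e x (turn x)) ->
  connect e d (d.1, s).
Proof.
move=> he; have it n : connect e d (iter n turn d).
  by elim: n => //= n IH; apply: connect_trans IH (he _).
suff [n ->] : exists n, (d.1, s) = iter n turn d by [].
case: d s {it} => i s t; exists ((t + (4 - s))).
have -> : iter (t + (4 - s)) turn (i, s) = (i, iter (t + (4 - s)) (@ordS 4) s).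
  by elim: (t + (4 - s)) => //= n ->.
congr (_, _); apply/val_inj => /=.
have : forall n, iter n (@ordS 4) s = (n + s) %% 4 :> nat.
  elim=> [|n IH]; first by rewrite (modn_small (ltn_ord s)).
  by rewrite iterS /= IH; have := modnDmr 1 (n + s) 4; rewrite !add1n addSn.
by move->; rewrite -addnA subnK ?modnDr ?modn_small // ltnW.
Qed.

Lemma adjX_sym : connect_sym (@adjX D).
Proof.
apply: sym_connect_sym => i j.
by apply/hasP/hasP => -[l li lj]; exists l.
Qed.

Lemma ngcomp_gen : n_comp (gen_rel turnP otherP) predT = ngcomp D.
Proof.
have toturn x d : connect (gen_rel turnP otherP) d x -> connect (gen_rel turnP otherP) d (x.1, ord0).
  move=> h; apply: connect_trans h _; apply: turn_connect => y.
  by apply: connect1; rewrite /gen_rel permE eqxx.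
apply: (n_comp_retract (f := fun d : dart D => d.1) (g := fun i => (i, ord0))).
- exact: gen_rel_sym.
- exact: adjX_sym.
- move=> d e /orP[]/eqP ->; rewrite permE //=; apply: connect1.
  apply/hasP; exists (lab d); first exact: lab_in.
  by have [_ <-] := other_spec d; apply: lab_in.
- move=> i j /hasP[l li lj].
  have lt k : l \in clabels (nth (0, 0, 0, 0) C k) -> exists s : 'I_4, nth 0 (clabels (nth (0, 0, 0, 0) C k)) s = l.
    move=> lk; have il : index l (clabels (nth (0, 0, 0, 0) C k)) < 4.
      by rewrite -(size_clabels (nth (0, 0, 0, 0) C k)) index_mem.
    by exists (Ordinal il); rewrite nth_index.
  have [s si] := lt _ li; have [t tj] := lt _ lj.
  have : lab (j, t) = lab (i, s) by rewrite /lab /= si tj.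
  have ct : connect (gen_rel turnP otherP) (i, ord0) (i, s).
    by rewrite gen_rel_sym; apply: (toturn (i, s)); apply: connect0.
  move=> E; apply: connect_trans ct _; move: E.
  case/other_lab=> [[-> _]|E]; first exact: (toturn (i, s) (i, s) (connect0 _ _)).
  apply: (toturn (j, t)); apply: connect1.
  by rewrite /gen_rel !permE -E eqxx orbT.
- by move=> d; apply: toturn; apply: connect0.
- by move=> i; apply: connect0.
Qed.

End Diagram.

(** Each cycle has at most two elements, and a cycle with a fixed point has one, so cycle by cycle
    the size plus the number of fixed points is at most 2. *)
Lemma porbits_involutive (T : finType) (a : {perm T}) : involutive a ->
  #|T| + #|[set x | a x == x]| <= 2 * #|porbits a|.
Proof.
move=> inva; set F := [set x | a x == x].
have le2 A : A \in porbits a -> #|A| + #|A :&: F| <= 2.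
  case/imsetP=> x _ ->.
  have sub : porbit a x \subset [set x; a x].
    apply/subsetP=> y /porbitP[i ->]; rewrite permX.
    by elim: i => [|i] /=; rewrite !inE ?eqxx // => /orP[]/eqP ->; rewrite ?inva eqxx ?orbT.
  have [ax|ax] := eqVneq (a x) x.
    have le1 : #|porbit a x| <= 1 by rewrite (leq_trans (subset_leq_card sub)) // ax setUid cards1.
    by have := subset_leq_card (subsetIl (porbit a x) F); lia.
  rewrite (_ : _ :&: F = set0) ?cards0 ?addn0.
    by rewrite (leq_trans (subset_leq_card sub)) // cards2; case: (_ != _).
  apply/setP=> y; rewrite !inE; apply/negP=> /andP[/(subsetP sub)].
  rewrite !inE => /orP[]/eqP ->; first by rewrite (negbTE ax).
  by rewrite inva eq_sym (negbTE ax).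
have cov : cover (porbits a) = setT.
  apply/setP=> x; rewrite inE; apply/bigcupP; exists (porbit a x); last exact: porbit_id.
  exact: imset_f.
have cT : #|T| <= \sum_(A in porbits a) #|A|.
  by rewrite -cardsT -cov; apply: leq_card_cover.
have cF : #|F| <= \sum_(A in porbits a) #|A :&: F|.
  rewrite -[X in #|pred_of_set X| <= _]setTI -cov /cover big_distrl /=.
  apply: (big_ind2 (fun (A : {set T}) n => #|A| <= n)) => [|A m B n hA hB|A _].
  - by rewrite cards0.
  - by apply: leq_trans (leq_card_setU _ _) _; apply: leq_add.
  - exact: leqnn.
have : \sum_(A in porbits a) (#|A| + #|A :&: F|) <= \sum_(A in porbits a) 2 by apply: leq_sum.
rewrite big_split sum_nat_const /= mulnC => h; by apply: leq_trans (leq_add cT cF) _.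
Qed.

Section Euler.
Variable C : seq crossing.
Let D := Diagram C 0.
Hypothesis wlC : wellformed C.

Lemma porbits_turn : #|porbits (turnP C)| = size C.
Proof.
rewrite -n_comp_porbits (@n_comp_img _ _ _ fst); first last.
- move=> x y; apply/idP/eqP => [|E].
    by apply: connect_respect => u v /eqP <-; rewrite permE.
  case: y E => i s /= <-; apply: turn_connect => z.
  by apply: connect1; rewrite /= permE.
- exact: fconnect_sym (@perm_inj _ _).
rewrite -[RHS]card_ord -[RHS]cardsT; congr #|pred_of_set _|; apply/setP=> i; rewrite inE.
by apply/imsetP; exists (i, ord0).
Qed.

Lemma card_dart : #|{: dart D}| = 4 * size C.
Proof. by rewrite card_prod !card_ord mulnC. Qed.

(** Euler's formula for any genus: four darts per crossing, hence two edges per crossing, in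
    [genus_le]. *)
Lemma nfaces_le : nfaces D <= size C + 2 * ngcomp D.
Proof.
have ioP : involutive (otherP wlC) by move=> d; rewrite !permE otherK.
have := genus_le (turnP C) ioP; have := porbits_involutive ioP.
rewrite (ngcomp_gen wlC) -(nfaces_porbits wlC) porbits_turn card_dart -/D.
by lia.
Qed.

Lemma ngcomp_gt0 : C <> [::] -> 0 < ngcomp D.
Proof.
move=> /eqP; rewrite -size_eq0 -lt0n => C0.
apply: leq_trans (n_comp_ge_fun (c := fun=> tt) (@adjX_sym C) _) => //.
by apply/card_gt0P; exists tt; apply/imsetP; exists (Ordinal C0).
Qed.

Lemma adjX_cst (P : nat -> bool) : all (const_at P) C -> forall i j : 'I_(ncross D), connect (@adjX D) i j ->
  forall l l', l \in clabels (nth (0,0,0,0) C i) -> l' \in clabels (nth (0,0,0,0) C j) -> P l = P l'.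
Proof.
move=> /allP aP i j cij.
have cstn (k : 'I_(ncross D)) : const_at P (nth (0,0,0,0) C k) by apply/aP/mem_nth.
pose h (k : 'I_(ncross D)) := P (nth 0 (clabels (nth (0,0,0,0) C k)) 0).
have hE (k : 'I_(ncross D)) l : l \in clabels (nth (0,0,0,0) C k) -> P l = h k.
  by move=> lk; apply: (cstP _ _ (cstn k)) => //; apply: mem_nth; rewrite size_clabels.
have E : h i = h j.
  apply: (connect_respect (e := @adjX D)) cij => u v /hasP[l lu lv].
  by rewrite -(hE _ _ lu) (hE _ _ lv).
by move=> l l' li lj; rewrite (hE _ _ li) E (hE _ _ lj).
Qed.

(** [connected_labels] mentions no index of a crossing, so it passes easily through moves that
    renumber the list. This lemma ties it to the count of components in [valid]. *)
Lemma lconn_ngcomp : connected_labels C <-> ngcomp D <= 1.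
Proof.
split=> [lc|le1].
  have [C0|] := eqVneq (size C) 0.
    by rewrite /ngcomp /n_comp_mem; apply: leq_trans (max_card _) _; rewrite card_ord /ncross /= C0.
  rewrite -lt0n => C0; pose i0 : 'I_(ncross D) := Ordinal C0.
  rewrite -(cards1 i0); apply: n_comp_le_set; first exact: adjX_sym.
  move=> i; exists i0; first by rewrite inE.
  pose P l := [exists j, connect (@adjX D) i0 j && (l \in clabels (nth (0,0,0,0) C j))].
  have aP : all (const_at P) C.
    apply/allP=> y yC; apply/cstP => l l' ly ly'.
    have iy : index y C < ncross D by rewrite index_mem.
    have adj (k : 'I_(ncross D)) m : m \in clabels y -> m \in clabels (nth (0,0,0,0) C k) ->
        connect (@adjX D) k (Ordinal iy).
      by move=> my mk; apply: connect1; apply/hasP; exists m => //=; rewrite nth_index.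
    have yP m : m \in clabels y -> connect (@adjX D) i0 (Ordinal iy) -> P m.
      by move=> my c; apply/existsP; exists (Ordinal iy); rewrite c /= nth_index.
    apply/idP/idP => /existsP[k /andP[ck mk]]; apply: yP => //.
      exact: connect_trans ck (adj k l ly mk).
    exact: connect_trans ck (adj k l' ly' mk).
  have li (j : 'I_(ncross D)) : nth 0 (clabels (nth (0,0,0,0) C j)) 0 \in clabels (nth (0,0,0,0) C j).
    by apply: mem_nth; rewrite size_clabels.
  have lC (j : 'I_(ncross D)) : nth 0 (clabels (nth (0,0,0,0) C j)) 0 \in labs C.
    by apply/lab_mem; exists (nth (0,0,0,0) C j); [exact: mem_nth | exact: li].
  have : P (nth 0 (clabels (nth (0,0,0,0) C i)) 0).
    rewrite (lc P aP _ _ (lC i) (lC i0)).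
    by apply/existsP; exists i0; rewrite connect0 li.
  case/existsP=> j /andP[cj lj]; rewrite adjX_sym; apply: connect_trans cj _.
  by apply: connect1; apply/hasP; eexists; [exact: lj | exact: li].
move=> P aP l l' /lab_mem[x xC lx] /lab_mem[y yC ly].
have ix : index x C < ncross D by rewrite index_mem.
have iy : index y C < ncross D by rewrite index_mem.
apply: (adjX_cst aP (i := Ordinal ix) (j := Ordinal iy)); rewrite /= ?nth_index //.
apply/(fingraph.rootP (@adjX_sym C)); apply/eqP; move: le1; rewrite /ngcomp (@n_comp_img _ _ _ (fingraph.root (@adjX D))).
- by move/card_le1_eqP=> h; apply/eqP/h; apply: imset_f.
- exact: adjX_sym.
- by move=> u v; rewrite root_connect //; apply: adjX_sym.
Qed.

End Euler.

(* A connected spherical diagram, seen as a list of crossings.  Circles without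
   crossings never occur in the part of the argument that uses it. *)
Definition good (C : seq crossing) :=
  [/\ wellformed C, connected_labels C, C <> [::] & nfaces (Diagram C 0) = size C + 2].

Lemma good_ngcomp C k : good C -> ngcomp (Diagram C k) = 1.
Proof.
case=> _ /lconn_ngcomp le1 /ngcomp_gt0 gt0 _.
by apply/eqP; rewrite eqn_leq le1 gt0.
Qed.

Lemma good_valid C k : good C -> valid (Diagram C k).
Proof. by move=> g; case: (g) => wC _ _ nf; split=> //; rewrite (good_ngcomp k g) muln1. Qed.

Lemma valid_good C k : valid (Diagram C k) -> C <> [::] -> ngcomp (Diagram C k) <= 1 -> good C.
Proof.
case=> wC nf C0 le1; split=> //; first exact/lconn_ngcomp.
have E : ngcomp (Diagram C 0) = 1 by apply/eqP; rewrite eqn_leq le1 ngcomp_gt0.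
by change (nfaces (Diagram C 0) = size C + 2 * ngcomp (Diagram C 0)) in nf; rewrite nf E muln1.
Qed.

(** * Spherical diagrams under reordering, rotation and relabelling *)

Notation Dg C := (Diagram C 0).

(** An injection of darts that respects rotation and edges commutes with [facestep]; the comparison
    of sizes makes it a bijection. *)
Lemma nfaces_iso C C' (h : dart (Dg C) -> dart (Dg C')) :
    wellformed C -> wellformed C' -> size C' <= size C -> injective h ->
    (forall d, h (turn d) = turn (h d)) ->
    (forall d e, lab d = lab e -> lab (h d) = lab (h e)) ->
  nfaces (Dg C) = nfaces (Dg C').
Proof.
move=> wC wC' leS hi ht hl.
have hb : bijective h.
  by apply: inj_card_bij hi _; rewrite !card_dart leq_mul2l leS orbT.
have ho d : h (other d) = other (h d).
  have [nd ld] := other_spec wC d; symmetry; apply: otherE => //; last exact: hl.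
  by rewrite inj_eq.
have hf d : h (facestep d) = facestep (h d) by rewrite /facestep -ho; apply: (ht (other d)).
case: hb => g hK gK; have gf d : g (facestep d) = facestep (g d).
  by apply: hi; rewrite gK hf gK.
apply: (n_comp_retract (f := h) (g := g)).
- exact: facestep_sym.
- exact: facestep_sym.
- by move=> x y /eqP <-; apply: connect1; rewrite /= hf.
- by move=> x y /eqP <-; apply: connect1; rewrite /= gf.
- by move=> x; rewrite hK.
- by move=> x; rewrite gK.
Qed.

Lemma labs_cons x C : labs (x :: C) = clabels x ++ labs C.
Proof. by []. Qed.

Lemma wl_perm C C' : perm_eq (labs C) (labs C') -> wellformed C -> wellformed C'.
Proof. by move=> /seq.permP pC wC l; rewrite -pC. Qed.

Lemma perm_labs C C' : perm_eq C C' -> perm_eq (labs C) (labs C').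
Proof. by move=> pC; apply: perm_flatten; apply: perm_map. Qed.

Lemma lconn_perm C C' : C =i C' -> connected_labels C -> connected_labels C'.
Proof.
move=> eC lC P aP l l' /lab_mem[x xC lx] /lab_mem[y yC ly]; apply: lC.
- by rewrite (eq_all_r eC).
- by apply/lab_mem; exists x; rewrite ?eC.
- by apply/lab_mem; exists y; rewrite ?eC.
Qed.

Lemma good_perm C C' : perm_eq C C' -> good C -> good C'.
Proof.
move=> pC [wC lC C0 nf]; have wC' := wl_perm (perm_labs pC) wC.
split; [exact: wC'|exact: lconn_perm (perm_mem pC) lC| |].
  by move=> E; apply: C0; apply/perm_nilP; rewrite -E.
rewrite -(perm_size pC) -nf.
have := pC; rewrite perm_sym => /(perm_iotaP (0,0,0,0))[Is pI E].
have sI : size Is = size C' by rewrite E size_map.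
have Ilt (i : 'I_(ncross (Dg C'))) : nth 0 Is i < ncross (Dg C).
  have : nth 0 Is i \in Is by apply: mem_nth; rewrite sI.
  by rewrite (perm_mem pI) mem_iota.
have nE i : i < size C' -> nth (0,0,0,0) C' i = nth (0,0,0,0) C (nth 0 Is i).
  by move=> ilt; rewrite {1}E (nth_map 0) ?sI.
pose h (d : dart (Dg C')) : dart (Dg C) := (Ordinal (Ilt d.1), d.2).
have hl d : lab (h d) = lab d.
  by rewrite /lab /h /= -nE.
apply: (nfaces_iso (h := h)) => //.
- by rewrite (perm_size pC).
- move=> [i s] [j t] [] /eqP; rewrite nth_uniq ?sI //.
    by move/eqP/val_inj -> => ->.
  by rewrite (perm_uniq pI) iota_uniq.
- by move=> d e; rewrite !hl.
Qed.

Definition rot4 (x : crossing) : crossing := let: (a, b, c, d) := x in (b, c, d, a).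

Lemma perm_rot4 x : perm_eq (clabels (rot4 x)) (clabels x).
Proof. by case: x => [[[a b] c] d]; rewrite -[clabels _]/([:: b; c; d] ++ [:: a]) perm_catC. Qed.

(** A quarter turn exchanges the over- and the under-strand. Goodness depends on the underlying
    4-valent map alone, so it may be proved for one choice of the strand on top and transferred to
    the other, see [good_mkX]. *)
Lemma good_rot4 x C : good (x :: C) -> good (rot4 x :: C).
Proof.
case=> wC lC C0 nf.
have wC' : wellformed (rot4 x :: C).
  by apply: wl_perm wC; rewrite !labs_cons perm_cat2r perm_sym perm_rot4.
split; [exact: wC'| |by []|].
  move=> P aP l l'; rewrite !labs_cons !mem_cat !(perm_mem (perm_rot4 x)) -!mem_cat.
  apply: lC; move: aP => /= /andP[cx ->]; rewrite andbT.
  apply/cstP => m m' mixed_dart mx'; apply: (cstP _ _ cx); by rewrite (perm_mem (perm_rot4 x)).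
rewrite -[RHS]nf.
pose h (d : dart (Dg (rot4 x :: C))) : dart (Dg (x :: C)) :=
  (d.1, if d.1 == ord0 then ordS d.2 else d.2).
have hl d : lab (h d) = lab d.
  case: d => [[[|i] lt] s]; rewrite /lab /h /= //.
  case: x {h lC wC nf C0 wC' lt} => [[[a b] c] d] /=.
  by case: s => [[|[|[|[|s]]]] lt].
apply: (nfaces_iso (h := h)) => //.
- move=> [i s] [j t]; rewrite /h /= => E; have ij := congr1 fst E; rewrite /= in ij; subst j.
  by congr (_, _); have := congr1 snd E => /=; case: ifP => // _ /ordS_inj.
- by move=> [i s]; rewrite /h /turn /=; case: ifP.
- by move=> d e; rewrite !hl.
Qed.

Lemma good_relab f C : injective f -> good C -> good (map (mapX f) C).
Proof.
move=> fi [wC lC C0 nf].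
have clE x : clabels (mapX f x) = map f (clabels x) by case: x => [[[a b] c] d].
have lE : labs (map (mapX f) C) = map f (labs C).
  by rewrite /labs -map_comp map_flatten -map_comp; congr flatten; apply: eq_map.
have wC' : wellformed (map (mapX f) C).
  move=> l; rewrite lE count_map; have [l' /eqP <-|no] := pickP [pred d : dart (Dg C) | f (lab d) == l].
    by rewrite (eq_count (a2 := pred1 (lab l'))) // => m /=; rewrite inj_eq.
  rewrite (@eq_in_count _ _ pred0) ?count_pred0 // => m /labs_lab[d <-] /=.
  exact: no d.
split; first exact: wC'.
- move=> P aP l l'; rewrite lE => /mapP[m mC ->] /mapP[m' mC' ->].
  apply: (lC (fun l => P (f l))) => //; apply/allP=> x xC; apply/cstP => k k' kx kx'.
  move/allP/(_ _ (map_f _ xC))/cstP: aP; apply; rewrite clE; exact: map_f.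
- by move=> E; apply: C0; case: (C) E.
- rewrite size_map -nf.
  pose h (d : dart (Dg (map (mapX f) C))) : dart (Dg C) := (cast_ord (size_map _ _) d.1, d.2).
  have hl d : f (lab (h d)) = lab d.
    have lt : d.1 < size C by rewrite -(size_map (mapX f) C).
    by rewrite /lab /h /= (nth_map (0,0,0,0)) // clE (nth_map 0) // size_clabels.
  apply: (nfaces_iso (h := h)) => //.
  + by rewrite size_map.
  + by move=> [i s] [j t] [/val_inj -> ->].
  + by move=> d e E; apply: fi; rewrite !hl.
Qed.

Definition wls (s : seq nat) := forall l, count_mem l s \in [:: 0; 2].

(** With both ends of an inner edge of a move brought to the front, well-formedness splits into
    freshness of this edge and well-formedness of the rest. *)
Lemma wls_cons2 x s : wls (x :: x :: s) <-> x \notin s /\ wls s.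
Proof.
split=> [w|[xs w] l]; last first.
  rewrite /= -[x \notin s]/(~~ _) in xs *; have [<-|_] := eqVneq x l; last exact: w.
  by rewrite (count_memPn xs).
have c0 : count_mem x s = 0 by have := w x; rewrite /= eqxx !inE => /orP[]/eqP; lia.
split; first exact/count_memPn.
move=> l; have := w l; rewrite /=; have [<- _|//] := eqVneq x l.
by rewrite c0.
Qed.

Lemma wls_perm s t : perm_eq s t -> wls s -> wls t.
Proof. by move=> /seq.permP p w l; rewrite -p. Qed.

(** The common part of the proofs that a move respects faces. An edge with label in [Q] survives the
    move, and the step across it is transported through the dart [f' d] with the same label. Only
    the edges that the move destroys remain to be checked one at a time. *)
Lemma face_map C1 C2 (T : finType) (e : rel T) (j : dart (Dg C2) -> T)
    (f : dart (Dg C1) -> T) (f' : dart (Dg C1) -> dart (Dg C2))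
    (g' : dart (Dg C2) -> dart (Dg C1)) (Q : pred nat) :
    wellformed C1 -> wellformed C2 -> connect_sym e ->
    (forall x, connect e (j x) (j (facestep x))) ->
    (forall d, Q (lab d) -> [/\ lab (f' d) = lab d, g' (f' d) = d, connect e (f d) (j (f' d))
      & connect e (f (turn d)) (j (turn (f' d)))]) ->
    (forall d, ~~ Q (lab d) -> connect e (f d) (f (facestep d))) ->
  forall d, connect e (f d) (f (facestep d)).
Proof.
move=> w1 w2 se hj hQ hN d; have [Qd|/hN //] := boolP (Q (lab d)).
have [nd ld] := other_spec w1 d; have Qo : Q (lab (other d)) by rewrite ld.
have [l1 g1 c1 _] := hQ _ Qd; have [l2 g2 _ t2] := hQ _ Qo.
apply: connect_trans c1 _; apply: connect_trans (hj _) _.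
rewrite (facestepE w2 (e := f' (other d))) ?l1 ?l2 //; first by rewrite se; exact: t2.
by apply: contraNneq nd => E; apply/eqP; rewrite -[LHS]g2 E g1.
Qed.

Lemma facestep_conn C (w : wellformed C) (d e : dart (Dg C)) : e != d -> lab e = lab d ->
  forall x, x = turn e -> connect (frel (@facestep (Dg C))) d x.
Proof.
by move=> ed le x ->; apply: connect1; rewrite /= (facestepE w ed le).
Qed.

Ltac blia := repeat match goal with
  |- context [nat_of_bool ?b] => generalize (nat_of_bool b); intro end; lia.

Arguments turn : simpl never.

Lemma ord4_ind (P : 'I_4 -> Prop) : P (@Ordinal 4 0 isT) -> P (@Ordinal 4 1 isT) ->
  P (@Ordinal 4 2 isT) -> P (@Ordinal 4 3 isT) -> forall s, P s.
Proof.
by move=> h0 h1 h2 h3 [[|[|[|[|s]]]] lt] //; rewrite (bool_irrelevance lt isT).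
Qed.

Ltac turnE := match goal with |- context [@turn ?C (@pair ?A ?B ?i (@Ordinal ?n ?s ?h))] =>
  let s' := eval compute in (s.+1 %% 4) in
  rewrite (_ : @turn C (@pair A B i (@Ordinal n s h)) = (i, @Ordinal 4 s' isT) :> dart (Dg C));
    [|by congr (_, _); apply: val_inj]
  end.

(** * Reidemeister moves on spherical diagrams *)

Section R3.
Variables (w1 e1 s2 n2 n3 s3 i1 i2 i3 j1 j2 j3 : nat) (C : seq crossing).
Let C1 := [:: (i1, i2, w1, s2); (e1, i3, i1, s3); (n2, n3, i2, i3)] ++ C.
Let C2 := [:: (j1, n3, w1, j3); (e1, n2, j1, j2); (j2, j3, s2, s3)] ++ C.

(** The labels on the boundary of the disc in which the move takes place, and those outside it;
    [i1], [i2], [i3] and [j1], [j2], [j3] are inside. *)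
Let ports := [:: w1; s2; e1; s3; n2; n3] ++ labs C.

Lemma R3_wl : wellformed C1 ->
  [/\ i1 \notin ports, i2 \notin ports, i3 \notin ports & wls ports].
Proof.
move=> w; have /wls_cons2[h1 /wls_cons2[h2 /wls_cons2[h3 w4]]] :
    wls [:: i1, i1, i2, i2, i3, i3 & ports].
  by apply: wls_perm w; apply/seq.permP => p; rewrite /ports /C1 /labs /=; blia.
split=> //; first by apply: contra h1 => h; rewrite 4!in_cons h !orbT.
by apply: contra h2 => h; rewrite 2!in_cons h !orbT.
Qed.

Let Q : pred nat := fun l => l \in ports.
Local Notation dd i s := (@Ordinal (size C).+3 i isT, @Ordinal 4 s isT).

(** The three darts of the old triangle, [dd 0 1], [dd 1 2] and [dd 2 3], go to the dart [dd 0 0] of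
    the new triangle; the others go to darts of the corresponding outer faces. *)
Definition R3f (d : dart (Dg C1)) : dart (Dg C2) :=
  match val d.1, val d.2 with
  | 0, 0 => dd 2 3 | 0, 1 => dd 0 0 | 0, 2 => dd 0 2 | 0, _ => dd 2 2
  | 1, 0 => dd 1 0 | 1, 1 => dd 1 1 | 1, 2 => dd 0 0 | 1, _ => dd 2 3
  | 2, 0 => dd 1 1 | 2, 1 => dd 0 1 | 2, 2 => dd 0 2 | 2, _ => dd 0 0
  | _, _ => d
  end.

Definition R3g (d : dart (Dg C2)) : dart (Dg C1) :=
  match val d.1, val d.2 with
  | 0, 0 => dd 0 1 | 0, 1 => dd 2 1 | 0, 2 => dd 0 2 | 0, _ => dd 0 3
  | 1, 0 => dd 1 0 | 1, 1 => dd 2 0 | 1, 2 => dd 2 1 | 1, _ => dd 0 1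
  | 2, 0 => dd 1 0 | 2, 1 => dd 0 1 | 2, 2 => dd 0 3 | 2, _ => dd 1 3
  | _, _ => d
  end.

Hypotheses (wC1 : wellformed C1) (wC2 : wellformed C2).

Lemma R3_ports2 : [/\ j1 \notin ports, j2 \notin ports & j3 \notin ports].
Proof.
have /wls_cons2[h1 /wls_cons2[h2 /wls_cons2[h3 w4]]] :
    wls [:: j1, j1, j2, j2, j3, j3 & ports].
  by apply: wls_perm wC2; apply/seq.permP => p; rewrite /ports /C2 /labs /=; blia.
split=> //; first by apply: contra h1 => h; rewrite 4!in_cons h !orbT.
by apply: contra h2 => h; rewrite 2!in_cons h !orbT.
Qed.

Let e2 := frel (@facestep (Dg C2)).
Let e1' := frel (@facestep (Dg C1)).
Ltac vd := by congr (_, _); apply: val_inj.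
Ltac fs w x := apply: (facestep_conn w (e := x)); [by []|by []|vd].

Lemma R3_conn2 :
  [/\ connect e2 (dd 0 0) (dd 1 3), connect e2 (dd 1 3) (dd 2 1),
      connect e2 (dd 1 2) (dd 0 1), connect e2 (dd 2 0) (dd 1 0) &
      connect e2 (dd 0 3) (dd 2 2)].
Proof.
split.
- fs wC2 (dd 1 2 : dart (Dg C2)).
- fs wC2 (dd 2 0 : dart (Dg C2)).
- fs wC2 (dd 0 0 : dart (Dg C2)).
- fs wC2 (dd 1 3 : dart (Dg C2)).
- fs wC2 (dd 2 1 : dart (Dg C2)).
Qed.

Lemma R3_conn1 :
  [/\ connect e1' (dd 1 2) (dd 0 1), connect e1' (dd 0 1) (dd 2 3),
      connect e1' (dd 0 0) (dd 1 3), connect e1' (dd 2 2) (dd 0 2) &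
      connect e1' (dd 1 1) (dd 2 0)].
Proof.
split.
- fs wC1 (dd 0 0 : dart (Dg C1)).
- fs wC1 (dd 2 2 : dart (Dg C1)).
- fs wC1 (dd 1 2 : dart (Dg C1)).
- fs wC1 (dd 0 1 : dart (Dg C1)).
- fs wC1 (dd 2 3 : dart (Dg C1)).
Qed.

Lemma tail_ports C' (d : dart (Dg C')) i :
  nth (0, 0, 0, 0) C' d.1 = nth (0, 0, 0, 0) C i -> i < size C -> Q (lab d).
Proof.
move=> E lt; rewrite /Q mem_cat; apply/orP; right; apply/lab_mem.
exists (nth (0, 0, 0, 0) C i); first exact: mem_nth.
by rewrite -E; apply: lab_in.
Qed.

Lemma dart3_ind n (P : 'I_n.+3 * 'I_4 -> Prop) :
  (forall s, P (@Ordinal n.+3 0 isT, s)) -> (forall s, P (@Ordinal n.+3 1 isT, s)) ->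
  (forall s, P (@Ordinal n.+3 2 isT, s)) ->
  (forall i (lt : i.+3 < n.+3) s, P (Ordinal lt, s)) -> forall d, P d.
Proof.
move=> h0 h1 h2 h3 [[[|[|[|i]]] lt] s]; last exact: h3.
- by rewrite (bool_irrelevance lt isT).
- by rewrite (bool_irrelevance lt isT).
- by rewrite (bool_irrelevance lt isT).
Qed.

Lemma R3f_conn d : connect e2 (R3f d) (R3f (facestep d)).
Proof.
have s2' : connect_sym e2 by exact: facestep_sym.
have [c1 c2 c3 c4 c5] := R3_conn2; have [n1 n2' n3' wp] := R3_wl wC1.
have c4' : connect e2 (dd 1 0) (dd 2 0) by rewrite s2'.
have c5' : connect e2 (dd 2 2) (dd 0 3) by rewrite s2'.
have c3' : connect e2 (dd 0 1) (dd 1 2) by rewrite s2'.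
have c6 : connect e2 (dd 2 1) (dd 0 0).
  by rewrite s2'; apply: connect_trans c1 c2.
move: d; apply: (face_map (j := id) (f' := R3f) (g' := R3g) (Q := Q)) => //.
- by move=> x; apply: connect1; rewrite /=.
{ apply: dart3_ind => [s|s|s|i lt s]; last first.
    move=> _; split; try exact: connect0; try by [].
  all: elim/ord4_ind: s => Qd; try (by move: Qd; rewrite /Q /lab /= ?(negbTE n1) ?(negbTE n2') ?(negbTE n3')).
  all: split; [by [] | by [] | exact: connect0 | turnE; rewrite /R3f /=; turnE].
  all: try first [exact: connect0 | exact: c1 | exact: c2 | exact: c3 | exact: c4 | exact: c5 | exact: c4' | exact: c5'| exact: c3']. }
{ apply: dart3_ind => [s|s|s|i lt s]; last first.
    by case/negP; apply: (tail_ports (i := i)).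
  all: elim/ord4_ind: s => Qd; try (by case/negP: Qd; rewrite /Q /lab /= /ports !inE eqxx ?orbT).
  all: try (rewrite (facestepE wC1 (e := dd 0 0)) //; turnE; exact: connect0).
  all: try (rewrite (facestepE wC1 (e := dd 0 1)) //; turnE; exact: connect0).
  all: try (rewrite (facestepE wC1 (e := dd 1 1)) //; turnE; exact: connect0).
  all: try (rewrite (facestepE wC1 (e := dd 1 2)) //; turnE; exact: connect0).
  all: try (rewrite (facestepE wC1 (e := dd 2 2)) //; turnE; exact: connect0).
  all: try (rewrite (facestepE wC1 (e := dd 2 3)) //; turnE; exact: connect0). }
Qed.

Lemma R3g_conn d : connect e1' (R3g d) (R3g (facestep d)).
Proof.
have s1' : connect_sym e1' by exact: facestep_sym.
have [c1 c2 c3 c4 c5] := R3_conn1; have [n1 n2' n3'] := R3_ports2.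
have c4' : connect e1' (dd 0 2) (dd 2 2) by rewrite s1'.
have c5' : connect e1' (dd 2 0) (dd 1 1) by rewrite s1'.
have c3' : connect e1' (dd 1 3) (dd 0 0) by rewrite s1'.
move: d; apply: (face_map (j := id) (f' := R3g) (g' := R3f) (Q := Q)) => //.
- by move=> x; apply: connect1; rewrite /=.
{ apply: dart3_ind => [s|s|s|i lt s]; last first.
    by move=> _; split; try exact: connect0.
  all: elim/ord4_ind: s => Qd; try (by move: Qd; rewrite /Q /lab /= ?(negbTE n1) ?(negbTE n2') ?(negbTE n3')).
  all: split; [by [] | by [] | exact: connect0 | turnE; rewrite /R3g /=; turnE].
  all: try first [exact: connect0 | exact: c1 | exact: c2 | exact: c3 | exact: c4 | exact: c5 | exact: c4' | exact: c5'| exact: c3']. }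
{ apply: dart3_ind => [s|s|s|i lt s]; last first.
    by case/negP; apply: (tail_ports (i := i)).
  all: elim/ord4_ind: s => Qd; try (by case/negP: Qd; rewrite /Q /lab /= /ports !inE eqxx ?orbT).
  all: try (rewrite (facestepE wC2 (e := dd 0 0)) //; turnE; exact: connect0).
  all: try (rewrite (facestepE wC2 (e := dd 0 3)) //; turnE; exact: connect0).
  all: try (rewrite (facestepE wC2 (e := dd 1 2)) //; turnE; exact: connect0).
  all: try (rewrite (facestepE wC2 (e := dd 1 3)) //; turnE; exact: connect0).
  all: try (rewrite (facestepE wC2 (e := dd 2 0)) //; turnE; exact: connect0).
  all: try (rewrite (facestepE wC2 (e := dd 2 1)) //; turnE; exact: connect0). }
Qed.

Lemma R3_nfaces : nfaces (Dg C1) = nfaces (Dg C2).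
Proof.
have s1' : connect_sym e1' by exact: facestep_sym.
have s2' : connect_sym e2 by exact: facestep_sym.
have [c1 c2 c3 c4 c5] := R3_conn2; have [b1 b2 b3 b4 b5] := R3_conn1.
have b6 := connect_trans b1 b2.
have b7 : connect e1' (dd 2 3) (dd 0 1) by rewrite s1'.
have b3' : connect e1' (dd 1 3) (dd 0 0) by rewrite s1'.
have b4' : connect e1' (dd 0 2) (dd 2 2) by rewrite s1'.
have b5' : connect e1' (dd 2 0) (dd 1 1) by rewrite s1'.
have c4' : connect e2 (dd 1 0) (dd 2 0) by rewrite s2'.
have c5' : connect e2 (dd 2 2) (dd 0 3) by rewrite s2'.
have c3' : connect e2 (dd 0 1) (dd 1 2) by rewrite s2'.
have c6 : connect e2 (dd 2 1) (dd 0 0) by rewrite s2'; apply: connect_trans c1 c2.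
have c7 : connect e2 (dd 1 3) (dd 0 0) by rewrite s2'.
apply: (n_comp_retract (f := R3f) (g := R3g)) => //.
- by move=> x y /eqP <-; apply: R3f_conn.
- by move=> x y /eqP <-; apply: R3g_conn.
{ apply: dart3_ind => [s|s|s|i lt s]; last exact: connect0.
  all: elim/ord4_ind: s; rewrite /R3f /R3g /=.
  all: try first [exact: connect0 | exact: b1 | exact: b2 | exact: b3 | exact: b4 | exact: b5 | exact: b6 | exact: b7 | exact: b3'| exact: b4' | exact: b5']. }
{ apply: dart3_ind => [s|s|s|i lt s]; last exact: connect0.
  all: elim/ord4_ind: s; rewrite /R3f /R3g /=.
  all: try first [exact: connect0 | exact: c1 | exact: c2 | exact: c3 | exact: c4 | exact: c5 | exact: c6 | exact: c7 | exact: c3'| exact: c4' | exact: c5']. }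
Qed.

End R3.

Lemma all_cst_eq (P P' : nat -> bool) C : {in labs C, P =1 P'} -> all (const_at P) C = all (const_at P') C.
Proof.
move=> e; apply: eq_in_all => x xC.
have E l : l \in clabels x -> P l = P' l by move=> lx; apply: e; apply/lab_mem; exists x.
by apply/cstP/cstP => h l l' lx lx'; [rewrite -!E | rewrite !E] => //; apply: h.
Qed.

Lemma lconn_transfer C C' : connected_labels C ->
  (forall P, all (const_at P) C' -> exists2 P', all (const_at P') C &
     forall l, l \in labs C' -> exists2 l1, l1 \in labs C & P l = P' l1) -> connected_labels C'.
Proof.
move=> lC h P /h[P' aP' hP'] l l' /hP'[l1 l1C ->] /hP'[l2 l2C ->].
exact: lC.
Qed.

Lemma good_R3 w1 e1 s2 n2 n3 s3 i1 i2 i3 j1 j2 j3 C :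
  uniq [:: j1; j2; j3] ->
  (forall j, j \in [:: j1; j2; j3] -> j \notin [:: w1; s2; e1; s3; n2; n3] ++ labs C) ->
  good ([:: (i1, i2, w1, s2); (e1, i3, i1, s3); (n2, n3, i2, i3)] ++ C) ->
  good ([:: (j1, n3, w1, j3); (e1, n2, j1, j2); (j2, j3, s2, s3)] ++ C).
Proof.
move=> uj fj [wC lC C0 nf]; have [p1 p2 p3 wp] := R3_wl wC.
have wC' : wellformed ([:: (j1, n3, w1, j3); (e1, n2, j1, j2); (j2, j3, s2, s3)] ++ C).
  have : wls [:: j1, j1, j2, j2, j3, j3 & [:: w1; s2; e1; s3; n2; n3] ++ labs C].
    have [j12 j13 j23] : [/\ j1 != j2, j1 != j3 & j2 != j3].
      by move: uj; rewrite /= !inE negb_or andbT => /andP[/andP[-> ->] ->].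
    apply/wls_cons2; split.
      by rewrite 4!in_cons 4!negb_or j12 j13 fj // inE eqxx.
    apply/wls_cons2; split; first by rewrite 2!in_cons 2!negb_or j23 fj // !inE eqxx ?orbT.
    by apply/wls_cons2; split=> //; apply: fj; rewrite !inE eqxx ?orbT.
  by apply: wls_perm; apply/seq.permP => p; rewrite /labs /=; blia.
split; [exact: wC' | | by [] | by rewrite -[RHS]nf; symmetry; exact: R3_nfaces].
apply: lconn_transfer lC _ => P aP.
(* All six boundary labels of the disc carry the value [P w1], which the old inner edges therefore
   receive. *)
pose P' l := if l \in [:: i1; i2; i3] then P w1 else P l.
have P'p l : l \in [:: w1; s2; e1; s3; n2; n3] ++ labs C -> P' l = P l.
  move=> lp; rewrite /P' ifN // !inE !negb_or.
  by apply/and3P; split; apply: contraTneq lp => ->.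
move: aP; rewrite /= => /and4P[/and3P[/eqP E1 /eqP E2 /eqP E3] /and3P[/eqP E4 /eqP E5 /eqP E6] /and3P[/eqP E7 /eqP E8 /eqP E9] aC].
have Pp l : l \in [:: w1; s2; e1; s3; n2; n3] -> P l = P w1.
  rewrite !inE => /or4P[|||/or3P[]] /eqP -> //; congruence.
exists P'.
- have Pi l : l \in [:: i1; i2; i3] -> P' l = P w1 by rewrite /P' => ->.
  have Pq l : l \in [:: w1; s2; e1; s3; n2; n3] -> P' l = P w1.
    by move=> lp; rewrite P'p ?Pp // mem_cat lp.
  rewrite /= !(Pi i1) ?(Pi i2) ?(Pi i3) ?(Pq w1) ?(Pq s2) ?(Pq e1) ?(Pq s3) ?(Pq n2) ?(Pq n3) ?inE ?eqxx ?orbT //=.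
  by rewrite (@all_cst_eq _ P) // => l lC'; apply: P'p; rewrite mem_cat lC' orbT.
- move=> l lC'; have [lj|lj] := boolP (l \in [:: j1; j2; j3]).
    exists w1; first by rewrite !inE eqxx ?orbT.
    rewrite P'p ?inE ?eqxx //; move: lj; rewrite !inE => /or3P[]/eqP ->; congruence.
  have lp : l \in [:: w1; s2; e1; s3; n2; n3] ++ labs C.
    move: lj lC'; rewrite /labs /= !inE !negb_or => /and3P[/negbTE -> /negbTE -> /negbTE ->].
    by do ![case: eqP => //= _].
  exists l; last by rewrite P'p.
  move: lp; rewrite /labs /= !inE; by do ![case: eqP => //= _]; rewrite ?orbT.
Qed.

Section R1.
Variables (q0 q l b c d : nat) (C : seq crossing).
Let C2 := (q0, b, c, d) :: C.
Let C1 := [:: (q, l, l, q0), (q, b, c, d) & C].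
Hypotheses (ql : q != l) (qC : q \notin labs C2) (lC : l \notin labs C2) (wC2 : wellformed C2).

Lemma R1_wl : wellformed C1.
Proof.
have : wls [:: q, q, l, l & labs C2].
  apply/wls_cons2; rewrite 2!in_cons 2!negb_or ql qC; split=> //.
  by apply/wls_cons2.
by apply: wls_perm; apply/seq.permP => p; rewrite /C1 /C2 /labs /=; blia.
Qed.

Local Notation d1 i s := (@Ordinal (size C).+2 i isT, @Ordinal 4 s isT).
Local Notation d2 i s := (@Ordinal (size C).+1 i isT, @Ordinal 4 s isT).

(** [None] is the monogon of the kink; slot 2 of the new crossing is its only dart. *)
Definition R1f (x : dart (Dg C1)) : option (dart (Dg C2)) :=
  match x with
  | (Ordinal 0 _, s) => match val s with
    | 0 => Some (d2 0 1) | 1 => Some (d2 0 0) | 2 => None | _ => Some (d2 0 0) end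
  | (Ordinal i.+1 lt, s) => Some (@Ordinal (size C).+1 i lt, s)
  end.

Definition R1f' (x : dart (Dg C1)) : dart (Dg C2) :=
  match x with
  | (Ordinal 0 _, s) => d2 0 0
  | (Ordinal i.+1 lt, s) => (@Ordinal (size C).+1 i lt, s)
  end.

Definition R1g (x : dart (Dg C2)) : dart (Dg C1) :=
  match x with (Ordinal i lt, s) => (@Ordinal (size C).+2 i.+1 lt, s) end.

Definition R1g' (x : dart (Dg C2)) : dart (Dg C1) :=
  match x with (Ordinal i lt, s) =>
    if (i == 0) && (val s == 0) then d1 0 3 else (@Ordinal (size C).+2 i.+1 lt, s) end.

Let e1 := frel (@facestep (Dg C1)).
Let e2 := frel (@facestep (Dg C2)).
Let w1 := R1_wl.

Ltac fs w x := apply: (facestep_conn w (e := x)); [by []|by []|by congr (_, _); apply: val_inj].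

Lemma R1_conn : [/\ connect e1 (d1 0 0) (d1 1 1), connect e1 (d1 0 1) (d1 0 3) &
  connect e1 (d1 1 0) (d1 0 1)].
Proof.
split.
- fs w1 (d1 1 0 : dart (Dg C1)).
- fs w1 (d1 0 2 : dart (Dg C1)).
- fs w1 (d1 0 0 : dart (Dg C1)).
Qed.

Let Q : pred nat := fun x => x \in labs C2.

Lemma Q_tail C' (x : dart (Dg C')) i :
  nth (0, 0, 0, 0) C' x.1 = nth (0, 0, 0, 0) C i -> i < size C -> Q (lab x).
Proof.
move=> E lt; apply/lab_mem; exists (nth (0, 0, 0, 0) C i).
  by rewrite in_cons mem_nth ?orbT.
by rewrite -E; apply: lab_in.
Qed.

Lemma dart1_ind n (P : 'I_n.+1 * 'I_4 -> Prop) :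
  (forall s, P (@Ordinal n.+1 0 isT, s)) ->
  (forall i (lt : i.+1 < n.+1) s, P (Ordinal lt, s)) -> forall d, P d.
Proof.
by move=> h0 h1 [[[|i] lt] s]; [rewrite (bool_irrelevance lt isT) | exact: h1].
Qed.

Lemma dart2_ind n (P : 'I_n.+2 * 'I_4 -> Prop) :
  (forall s, P (@Ordinal n.+2 0 isT, s)) -> (forall s, P (@Ordinal n.+2 1 isT, s)) ->
  (forall i (lt : i.+2 < n.+2) s, P (Ordinal lt, s)) -> forall d, P d.
Proof.
move=> h0 h1 h2 [[[|[|i]] lt] s]; last exact: h2.
- by rewrite (bool_irrelevance lt isT).
- by rewrite (bool_irrelevance lt isT).
Qed.

Lemma R1_nfaces : nfaces (Dg C1) = (nfaces (Dg C2)).+1.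
Proof.
have s1 : connect_sym e1 by exact: facestep_sym w1.
have s2 : connect_sym e2 by exact: facestep_sym.
have [c1 c2 c3] := R1_conn; have c4 := connect_trans c3 c2.
have c1' : connect e1 (d1 1 1) (d1 0 0) by rewrite s1.
have c3' : connect e1 (d1 0 1) (d1 1 0) by rewrite s1.
have c4' : connect e1 (d1 0 3) (d1 1 0) by rewrite s1.
have fC x : connect (opt_rel e2) (R1f x) (R1f (facestep x)).
  move: x; apply: (face_map (j := Some) (f' := R1f') (g' := R1g') (Q := Q)) => //.
  - exact: opt_rel_sym.
  - by move=> x; rewrite connect_opt; apply: connect1 => /=.
  { apply: dart2_ind => [s|s|i lt s]; last first.
      by move=> _; split=> //; apply: connect0.
    all: elim/ord4_ind: s => Qd; try (by move: Qd; rewrite /Q /lab /= ?(negbTE qC) ?(negbTE lC)).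
    all: split; [by [] | by [] | exact: connect0 | turnE; rewrite /R1f /R1f' /=; turnE; exact: connect0]. }
  { apply: dart2_ind => [s|s|i lt s]; last first.
      by case/negP; apply: (Q_tail (i := i)).
    all: elim/ord4_ind: s => Qd; try (by case/negP: Qd; rewrite /Q /lab /= !inE eqxx ?orbT).
    + rewrite (facestepE w1 (e := d1 0 0)) //; turnE; rewrite /R1f /=; exact: connect0.
    + rewrite (facestepE w1 (e := d1 1 0)) //; turnE; rewrite /R1f /=; exact: connect0.
    + rewrite (facestepE w1 (e := d1 0 2)) //; turnE; rewrite /R1f /=; exact: connect0.
    + rewrite (facestepE w1 (e := d1 0 1)) //; turnE; rewrite /R1f /=; exact: connect0. }
have gC x : connect e1 (R1g x) (R1g (facestep x)).
  move: x; apply: (face_map (j := id) (f' := R1g') (g' := R1f') (Q := predT)) => //.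
  - by move=> x; apply: connect1 => /=.
  apply: dart1_ind => [s|i lt s]; last by move=> _; split=> //; apply: connect0.
  elim/ord4_ind: s => _; split; try by [].
  all: try (by turnE; rewrite /R1g /R1g' /=; turnE; exact: connect0).
  by turnE; rewrite /R1g /R1g' /=; turnE; exact: c1'.
rewrite -(n_comp_opt s2).
apply: (n_comp_retract (f := R1f) (g := fun o => if o is Some x then R1g x else d1 0 2)) => //.
- exact: opt_rel_sym.
- by move=> x y /eqP <-.
- by move=> [x|] [y|] //= /eqP <-.
{ apply: dart2_ind => [s|s|i lt s]; last exact: connect0.
  all: elim/ord4_ind: s; rewrite /R1f /R1g /=.
  all: try first [exact: connect0 | exact: c1 | exact: c3' | exact: c4']. }
- by move=> [[[i] lt] s|]; exact: connect0.
Qed.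

Lemma good_R1 : good C2 -> good C1.
Proof.
case=> wC lcC C0 nf; split; [exact: w1 | | by [] | by rewrite R1_nfaces nf].
apply: lconn_transfer lcC _ => P aP; exists P.
  move: aP; rewrite /= => /and3P[/and3P[/eqP E1 /eqP E2 /eqP E3] /and3P[/eqP E4 /eqP E5 /eqP E6] ->].
  have -> : P q0 = P b by congruence.
  by rewrite E5 E6 !eqxx.
move=> m mC; have [mq|mq] := boolP (m \in [:: q; l]).
  exists q0; first by rewrite /labs /= inE eqxx.
  move: aP mq; rewrite /= !inE => /and3P[/and3P[/eqP E1 /eqP E2 /eqP E3] _ _] /orP[]/eqP ->; congruence.
exists m => //; move: mq mC; rewrite /labs /= !inE negb_or => /andP[/negbTE -> /negbTE ->] /=.
by do ![case: eqP => //= _]; rewrite ?orbT.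
Qed.

End R1.

Section R2.
Variables (a1 a2 b1 b2 e1 e2 : nat) (C0 : seq crossing).
(** The combined effect of the two merges of [st_R2] when the four outer labels are distinct. *)
Definition R2sub (l : nat) : nat := if l == b1 then a1 else if l == b2 then a2 else l.
Let C1 := [:: (a2, e1, e2, a1), (e2, e1, b2, b1) & C0].
Let C2 := map (mapX R2sub) C0.
Hypotheses (wC1 : wellformed C1) (uab : uniq [:: a1; a2; b1; b2]).

Lemma R2_ports : [/\ e1 \notin [:: a1; a2; b1; b2] ++ labs C0,
  e2 \notin [:: a1; a2; b1; b2] ++ labs C0, e1 != e2 & wls ([:: a1; a2; b1; b2] ++ labs C0)].
Proof.
have /wls_cons2[h1 /wls_cons2[h2 w]] : wls [:: e1, e1, e2, e2 & [:: a1; a2; b1; b2] ++ labs C0].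
  by apply: wls_perm wC1; apply/seq.permP => p; rewrite /C1 /labs /=; blia.
move: h1; rewrite 2!in_cons 2!negb_or => /and3P[e12 _ h1]; split; [exact: h1|exact: h2|exact: e12|exact: w].
Qed.

Lemma clabels_mapX f x : clabels (mapX f x) = map f (clabels x).
Proof. by case: x => [[[a b] c] d]. Qed.

Lemma labs_mapX f C : labs (map (mapX f) C) = map f (labs C).
Proof. by elim: C => //= x C IH; rewrite !labs_cons map_cat IH clabels_mapX. Qed.

Lemma uabE : [/\ a1 != a2, a1 != b1, a1 != b2, a2 != b1 & a2 != b2] /\ b1 != b2.
Proof. by move: uab; rewrite /= !inE !negb_or => /and4P[/and3P[-> -> ->] /andP[-> ->] -> _]. Qed.

Lemma R2sub_ab : [/\ R2sub a1 = a1, R2sub a2 = a2, R2sub b1 = a1 & R2sub b2 = a2].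
Proof.
have [[h1 h2 h3 h4 h5] h6] := uabE; rewrite /R2sub !eqxx.
by rewrite (negbTE h2) (negbTE h3) (negbTE h4) (negbTE h5) eq_sym (negbTE h6).
Qed.

Lemma R2sub_o l : l \notin [:: b1; b2] -> R2sub l = l.
Proof. by rewrite /R2sub !inE negb_or => /andP[/negbTE -> /negbTE ->]. Qed.

Lemma count0_ab l : l \in [:: a1; a2; b1; b2] -> count_mem l (labs C0) = 1.
Proof.
have [_ _ _ w] := R2_ports; have [[h1 h2 h3 h4 h5] h6] := uabE => lab.
have := w l; rewrite count_cat (count_uniq_mem _ uab) lab !inE.
by case: (count_mem l (labs C0)) => [|[|]].
Qed.

Lemma wl_R2 : wellformed C2.
Proof.
have [_ _ _ w] := R2_ports; have [[h1 h2 h3 h4 h5] h6] := uabE.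
have [r1 r2 r3 r4] := R2sub_ab.
have cnt l p q : p != q -> (forall m, (R2sub m == l) = (m == p) || (m == q)) ->
    count_mem l (map R2sub (labs C0)) = count_mem p (labs C0) + count_mem q (labs C0).
  move=> pq h; rewrite count_map -count_predUI [X in _ = _ + X](_ : _ = 0) ?addn0.
    by apply: eq_count => m; rewrite /= h.
  by rewrite (@eq_count _ _ pred0) ?count_pred0 // => m /=; case: eqP => //= ->; apply: negbTE.
move=> l; rewrite -/(labs C2) labs_mapX.
have [->|la1] := eqVneq l a1.
  rewrite (cnt a1 a1 b1) ?count0_ab ?inE ?eqxx ?orbT // => m; rewrite /R2sub.
  case: (eqVneq m b1) => [->|_]; first by rewrite eqxx orbT.
  rewrite orbF; case: (eqVneq m b2) => [->|//].
  by rewrite eq_sym (negbTE h1) eq_sym (negbTE h3).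
have [->|la2] := eqVneq l a2.
  rewrite (cnt a2 a2 b2) ?count0_ab ?inE ?eqxx ?orbT // => m; rewrite /R2sub.
  case: (eqVneq m b1) => [->|_].
    by rewrite (negbTE h1) eq_sym (negbTE h4) (negbTE h6).
  by case: (eqVneq m b2) => [->|_]; rewrite ?eqxx ?orbT ?orbF.
rewrite count_map; have [lb|lb] := boolP (l \in [:: b1; b2]).
  rewrite (@eq_count _ _ pred0) ?count_pred0 // => m /=; apply/negbTE; rewrite /R2sub.
  case: (eqVneq m b1) => [_|mb1]; first by rewrite eq_sym.
  case: (eqVneq m b2) => [_|mb2]; first by rewrite eq_sym.
  by move: lb; rewrite !inE => /orP[] /eqP ->.
have := w l; rewrite count_cat (count_uniq_mem _ uab).
move: (lb); rewrite !inE negb_or => /andP[lb1 lb2].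
rewrite (negbTE la1) (negbTE la2) (negbTE lb1) (negbTE lb2) /= add0n.
congr (is_true (_ || _)); congr (_ == _); apply: eq_count => m /=; rewrite /R2sub.
- case: (eqVneq m b1) => [->|_]; first by rewrite !(eq_sym _ l) (negbTE lb1) (negbTE la1).
  by case: (eqVneq m b2) => [->|//]; rewrite !(eq_sym _ l) (negbTE lb2) (negbTE la2).
- case: (eqVneq m b1) => [->|_]; first by rewrite !(eq_sym _ l) (negbTE lb1) (negbTE la1).
  by case: (eqVneq m b2) => [->|//]; rewrite !(eq_sym _ l) (negbTE lb2) (negbTE la2).
Qed.

Definition R2up (d : dart (Dg C2)) : dart (Dg C1) :=
  (@Ordinal (size C0).+2 (cast_ord (size_map (mapX R2sub) C0) d.1).+2 (ltn_ord _), d.2).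

Definition R2dn i (lt : i < size C0) (s : 'I_4) : dart (Dg C2) :=
  (cast_ord (esym (size_map (mapX R2sub) C0)) (Ordinal lt), s).

Lemma R2up_dn i (lt : i < size C0) s : R2up (R2dn lt s) = (@Ordinal (size C0).+2 i.+2 lt, s).
Proof. by congr (_, _); apply: val_inj. Qed.


Lemma R2up_lab d : lab d = R2sub (lab (R2up d)).
Proof.
have lt : d.1 < size C0 by rewrite -(size_map (mapX R2sub) C0).
by rewrite /lab /R2up /= (nth_map (0, 0, 0, 0)) // clabels_mapX (nth_map 0) // size_clabels.
Qed.

Lemma R2up_raw d : lab (R2up d) \in labs C0.
Proof.
have lt : d.1 < size C0 by rewrite -(size_map (mapX R2sub) C0).
apply/lab_mem; exists (nth (0, 0, 0, 0) C0 d.1); first exact: mem_nth.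
exact: (lab_in (R2up d)).
Qed.

Lemma R2_dart l : l \in labs C0 -> exists d, lab (R2up d) = l.
Proof.
case/labs_lab=> [[[i lt] s]] <-; exists (R2dn lt s).
by rewrite R2up_dn.
Qed.

(** In the reduced diagram [A1] and [B1] are the two ends of one edge, and so are [A2] and [B2].
    They are named after the labels that these ends bear while the bigon is present. *)
Variables A1 A2 B1 B2 : dart (Dg C2).
Hypotheses (hA1 : lab (R2up A1) = a1) (hA2 : lab (R2up A2) = a2)
  (hB1 : lab (R2up B1) = b1) (hB2 : lab (R2up B2) = b2).

Let wC2 := wl_R2.
Let p2 := (otherP wC2 * turnP C2)%g.
(** The face permutation of the diagram with the bigon, with the two extra crossings skipped. It
    differs from that of the reduced diagram by a transposition, so the numbers of faces compare
    according to whether [A1] and [B2] lie on one face. *)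
Let pC := (tperm A1 B2 * p2)%g.
Local Notation d1 i s := (@Ordinal (size C0).+2 i isT, @Ordinal 4 s isT).
Let r1 := frel (@facestep (Dg C1)).
Let r2 := frel pC.

(** A dart at a crossing of the bigon goes to the first old dart after it on its face; [None] is the
    bigon itself, which meets no old dart. *)
Definition R2f (x : dart (Dg C1)) : option (dart (Dg C2)) :=
  match x with
  | (Ordinal 0 _, s) => match val s with
    | 0 => Some (turn A2) | 1 => Some (turn B2) | 2 => None | _ => Some (turn A1) end
  | (Ordinal 1 _, s) => match val s with
    | 0 => Some (turn A1) | 1 => None | 2 => Some (turn B2) | _ => Some (turn B1) end
  | (Ordinal i.+2 lt, s) => Some (R2dn (i := i) lt s)
  end.

Definition R2g (o : option (dart (Dg C2))) : dart (Dg C1) :=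
  if o is Some x then R2up x else d1 0 2.

Lemma R2f_up x : R2f (R2up x) = Some x.
Proof. by case: x => i s; congr (Some (_, _)); apply: val_inj. Qed.

Lemma R2up_turn x : turn (R2up x) = R2up (turn x).
Proof. by []. Qed.

Lemma R2_dist : [/\ A1 != A2, A1 != B1, A1 != B2, A2 != B1 & A2 != B2] /\ B1 != B2.
Proof.
have [[h1 h2 h3 h4 h5] h6] := uabE.
by do !split; apply: (contraNneq (b := false)) => // E; [case/eqP: h1|case/eqP: h2|
  case/eqP: h3|case/eqP: h4|case/eqP: h5|case/eqP: h6]; rewrite -?hA1 -?hA2 -?hB1 -?hB2 E.
Qed.

Lemma R2_other2 : [/\ other A1 = B1, other A2 = B2, other B1 = A1 & other B2 = A2].
Proof.
have [[h1 h2 h3 h4 h5] h6] := R2_dist; have [q1 q2 q3 q4] := R2sub_ab.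
split; apply: otherE => //; rewrite 1?eq_sym ?R2up_lab ?hA1 ?hA2 ?hB1 ?hB2 ?q1 ?q2 ?q3 ?q4 //.
Qed.

Lemma R2_pC : [/\ pC A1 = turn A2, pC A2 = turn B2, pC B1 = turn A1 & pC B2 = turn B1].
Proof.
have [[h1 h2 h3 h4 h5] h6] := R2_dist; have [o1 o2 o3 o4] := R2_other2.
have pE x : p2 x = turn (other x) by rewrite /p2 permM !permE.
rewrite /pC; split; rewrite permM ?tpermL ?tpermR ?(tpermD h1) ?(tpermD h2) ?pE ?o1 ?o2 ?o3 ?o4 //.
- by rewrite eq_sym.
- by rewrite eq_sym.
Qed.

Lemma R2_pCo x : x \notin [:: A1; A2; B1; B2] ->
  pC x = turn (other x) /\ facestep (R2up x) = R2up (turn (other x)).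
Proof.
rewrite !inE !negb_or => /and4P[n1 n2 n3 n4].
rewrite /pC permM tpermD 1?eq_sym // permM !permE; split=> //.
have [no lo] := other_spec wC2 x.
have raw y z : lab (R2up y) = lab (R2up z) -> lab z = lab y by move=> E; rewrite !R2up_lab E.
have nraw y z : y != z -> lab (R2up z) \in [:: a1; a2; b1; b2] -> lab (R2up y) != lab (R2up z).
  move=> yz; apply: contraTneq => E.
  have : lab (R2up z) \notin [:: a1; a2; b1; b2].
    apply/negP=> lz; have := count0_ab lz.
    rewrite count_darts; move/eqP; rewrite eqn_leq => /andP[+ _].
    move/card_le1_eqP => h; case/eqP: yz.
    pose lw (u : dart (Dg C2)) : dart (Dg C0) := (cast_ord (size_map (mapX R2sub) C0) u.1, u.2).
    have hl u : lab (lw u) = lab (R2up u) by [].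
    have : lw y = lw z by apply: h; rewrite inE hl ?E.
    by case: (y) (z) => [? ?] [? ?] [/val_inj -> ->].
  by [].
have n1' : lab (R2up x) != a1 by rewrite -hA1; apply: nraw; rewrite ?hA1 ?inE ?eqxx ?orbT.
have n2' : lab (R2up x) != a2 by rewrite -hA2; apply: nraw; rewrite ?hA2 ?inE ?eqxx ?orbT.
have n3' : lab (R2up x) != b1 by rewrite -hB1; apply: nraw; rewrite ?hB1 ?inE ?eqxx ?orbT.
have n4' : lab (R2up x) != b2 by rewrite -hB2; apply: nraw; rewrite ?hB2 ?inE ?eqxx ?orbT.
rewrite -R2up_turn; apply: facestepE => //.
move: lo; rewrite !R2up_lab (@R2sub_o (lab (R2up x))) ?inE ?negb_or ?n3' //.
rewrite {1}/R2sub; case: eqP => [_ E|_]; first by rewrite E eqxx in n1'.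
by case: eqP => [_ E|_ //]; rewrite E eqxx in n2'.
Qed.

Lemma R2_step (x y z : dart (Dg C1)) : y != x -> lab y = lab x -> z = turn y ->
  facestep x = z.
Proof. by move=> yx l ->; apply: facestepE. Qed.

Ltac face_connect y := apply: (R2_step (y := y)); [by []|by rewrite ?hA1 ?hA2 ?hB1 ?hB2|
  by rewrite ?R2up_turn //; congr (_, _); apply: val_inj].

Lemma R2_new : [/\ facestep (d1 0 0 : dart (Dg C1)) = R2up (turn A2),
  facestep (d1 0 1 : dart (Dg C1)) = d1 1 2, facestep (d1 0 2 : dart (Dg C1)) = d1 1 1 &
  facestep (d1 0 3 : dart (Dg C1)) = R2up (turn A1)] /\
  [/\ facestep (d1 1 0 : dart (Dg C1)) = d1 0 3, facestep (d1 1 1 : dart (Dg C1)) = d1 0 2,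
  facestep (d1 1 2 : dart (Dg C1)) = R2up (turn B2) &
  facestep (d1 1 3 : dart (Dg C1)) = R2up (turn B1)].
Proof.
do !split.
- face_connect (R2up A2). 
- face_connect (d1 1 1 : dart (Dg C1)).
- face_connect (d1 1 0 : dart (Dg C1)).
- face_connect (R2up A1).
- face_connect (d1 0 2 : dart (Dg C1)).
- face_connect (d1 0 1 : dart (Dg C1)).
- face_connect (R2up B2).
- face_connect (R2up B1).
Qed.

Lemma R2_old : [/\ facestep (R2up A1) = d1 0 0, facestep (R2up A2) = d1 0 1,
  facestep (R2up B1) = d1 1 0 & facestep (R2up B2) = d1 1 3].
Proof.
split.
- face_connect (d1 0 3 : dart (Dg C1)).
- face_connect (d1 0 0 : dart (Dg C1)).
- face_connect (d1 1 3 : dart (Dg C1)).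
- face_connect (d1 1 2 : dart (Dg C1)).
Qed.

Lemma R2_nfaces : nfaces (Dg C1) = #|porbits pC|.+1.
Proof.
have s1 : connect_sym r1 by exact: facestep_sym.
have s2 : connect_sym r2 by exact: fconnect_sym (@perm_inj _ _).
have [[f0 f1 f2 f3] [f4 f5 f6 f7]] := R2_new; have [g1 g2 g3 g4] := R2_old.
have [q1 q2 q3 q4] := R2_pC.
have up x : [\/ x = A1, x = A2, x = B1 | x = B2] \/ x \notin [:: A1; A2; B1; B2].
  case: (boolP (x \in _)) => [|h]; last by right.
  by rewrite !inE => /or4P[]/eqP ->; left; constructor.
have c1 x y : facestep x = y -> connect r1 x y by move=> <-; apply: fconnect1.
have cup x : connect r1 (R2up x) (R2up (pC x)).
  case: (up x) => [[]->|/R2_pCo[-> h]]; last by apply: c1.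
  - by rewrite q1; apply: connect_trans (c1 _ _ g1) (c1 _ _ f0).
  - by rewrite q2; apply: connect_trans (c1 _ _ g2) _; apply: connect_trans (c1 _ _ f1) (c1 _ _ f6).
  - by rewrite q3; apply: connect_trans (c1 _ _ g3) _; apply: connect_trans (c1 _ _ f4) (c1 _ _ f3).
  - by rewrite q4; apply: connect_trans (c1 _ _ g4) (c1 _ _ f7).
rewrite -n_comp_porbits -(n_comp_opt s2).
apply: (n_comp_retract (f := R2f) (g := R2g)) => //.
- exact: opt_rel_sym.
{ move=> x y /eqP <-; move: x; apply: dart2_ind => [s|s|i lt s].
  + elim/ord4_ind: s; rewrite ?f0 ?f1 ?f2 ?f3 ?R2f_up; exact: connect0.
  + elim/ord4_ind: s; rewrite ?f4 ?f5 ?f6 ?f7 ?R2f_up; exact: connect0.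
  + rewrite -R2up_dn R2f_up.
    case: (up (R2dn lt s)) => [[]->|/R2_pCo[E ->]].
    * by rewrite g1 connect_opt /= -q1; apply: fconnect1.
    * by rewrite g2 connect_opt /= -q2; apply: fconnect1.
    * by rewrite g3 connect_opt /= -q3; apply: fconnect1.
    * by rewrite g4 connect_opt /= -q4; apply: fconnect1.
    * by rewrite R2f_up -E connect_opt; apply: fconnect1. }
- by move=> [x|] [y|] //= /eqP <-.
{ apply: dart2_ind => [s|s|i lt s]; last by rewrite -R2up_dn R2f_up.
  all: elim/ord4_ind: s; rewrite /R2f /R2g /=.
  + exact: c1 f0.
  + exact: connect_trans (c1 _ _ f1) (c1 _ _ f6).
  + exact: connect0.
  + exact: c1 f3.
  + exact: connect_trans (c1 _ _ f4) (c1 _ _ f3).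
  + exact: c1 f5.
  + exact: c1 f6.
  + exact: c1 f7. }
- by case=> [x|]; rewrite /R2g ?R2f_up; apply: connect0.
Qed.

(** The transposition cuts the common face in two, and the bigon is one more face. *)
Lemma R2_nfaces_merge : connect (frel (@facestep (Dg C2))) A1 B2 ->
  nfaces (Dg C1) = (nfaces (Dg C2)).+2.
Proof.
move=> c; have [[h1 h2 h3 h4 h5] h6] := R2_dist.
have := porbits_mul_tperm p2 A1 B2; rewrite /= -/pC h3.
have -> : A1 \in porbit p2 B2.
  rewrite porbit_sym -fconnect_porbit; apply: connect_sub c => x y /eqP <-.
  by rewrite -(facestepP wC2); apply: fconnect1.
by rewrite R2_nfaces (nfaces_porbits wC2) addn0 addn1 => ->.
Qed.

(** The transposition joins two faces into one, and the bigon makes up for the loss. *)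
Lemma R2_nfaces_split : ~~ connect (frel (@facestep (Dg C2))) A1 B2 ->
  nfaces (Dg C1) = nfaces (Dg C2).
Proof.
move=> c; have [[h1 h2 h3 h4 h5] h6] := R2_dist.
have := porbits_mul_tperm p2 A1 B2; rewrite /= -/pC h3.
have -> : A1 \notin porbit p2 B2.
  apply: contra c; rewrite porbit_sym -fconnect_porbit; apply: connect_sub => x y /eqP <-.
  by rewrite (facestepP wC2); apply: fconnect1.
by rewrite R2_nfaces (nfaces_porbits wC2) addn1 addn2 => -[<-].
Qed.

Lemma R2_cst (P : nat -> bool) : P a1 = P b1 -> P a2 = P b2 ->
  all (const_at P) C0 = all (const_at P) C2.
Proof.
move=> E1 E2; rewrite all_map; apply: eq_all => x /=.
have E l : P (R2sub l) = P l.
  by rewrite /R2sub; case: eqP => [->|_] //; case: eqP => [->|].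
by case: x => [[[a b] c] d] /=; rewrite !E.
Qed.

Lemma R2_labs l : l \in labs C0 -> R2sub l \in labs C2.
Proof. by rewrite labs_mapX; apply: map_f. Qed.

Lemma good_R2_add : good C2 -> connect (frel (@facestep (Dg C2))) A1 B2 -> good C1.
Proof.
case=> _ lC C0n nf c; split; [exact: wC1 | | by [] | by rewrite (R2_nfaces_merge c) nf size_map].
apply: lconn_transfer lC _ => P aP.
move: aP; rewrite /= => /and3P[/and3P[/eqP E1 /eqP E2 /eqP E3] /and3P[/eqP E4 /eqP E5 /eqP E6] aC].
exists P; first by rewrite -R2_cst //; congruence.
have ab l : l \in [:: a1; a2; b1; b2; e1; e2] -> P l = P a1.
  by rewrite !inE => /or4P[|||/or3P[]] /eqP ->; congruence.
move=> l lC1; have [lab|nlab] := boolP (l \in [:: a1; a2; b1; b2; e1; e2]).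
  exists a1; last exact: ab.
  by have := lab_labs A1; rewrite R2up_lab hA1; case: R2sub_ab => ->.
exists l => //; move: nlab lC1; rewrite !labs_cons !mem_cat /= !inE !negb_or.
case/and5P=> /negbTE n1 /negbTE n2 /negbTE n3 /negbTE n4 /andP[/negbTE n5 /negbTE n6].
rewrite n1 n2 n3 n4 n5 n6 /= => /R2_labs.
by rewrite R2sub_o // !inE n3 n4.
Qed.

(** If [A1] and [B2] lie on different faces, two crossings disappear and no face does, so Euler's
    inequality forces at least two components. There are no more than two, since every component
    contains the crossing of [A1] or that of [A2]; hence each of them is spherical. *)
Lemma good_R2_del : good C1 ->
  good C2 \/ forall k, valid (Diagram C2 k) /\ ngcomp (Diagram C2 k) = 2.
Proof.
case=> _ lC _ nf; have [h1 h2 h3 h4] := R2sub_ab; have [p1 p2' e12 _] := R2_ports.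
have C0n : C2 <> [::] by move=> E; have [[i lt] s] := A1; move: lt; rewrite E.
have [c|nc] := boolP (connect (frel (@facestep (Dg C2))) A1 B2).
  left; split; [exact: wC2| |exact: C0n|]; last first.
    by move: nf; rewrite (R2_nfaces_merge c) /= size_map => -[->].
  apply: lconn_transfer lC _ => P aP.
  (* Consecutive darts of a face meet at a crossing, so a predicate that no crossing separates is
     constant along faces. The common face links [a1] to [a2], as the removed crossings did. *)
  have Pf (x : dart (Dg C2)) : P (lab (facestep x)) = P (lab x).
    have [_ lo] := other_spec wC2 x; rewrite -lo.
    have /allP/(_ (nth (0,0,0,0) C2 (other x).1)) := aP; rewrite mem_nth // => /(_ isT)/cstP; apply.
      exact: (lab_in (facestep x)).
    exact: (lab_in (other x)).
  have E12 : P a1 = P a2.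
    have := connect_respect (h := fun x : dart (Dg C2) => P (lab x)) _ c.
    rewrite !R2up_lab hA1 hB2 h1 h4; apply => x y /eqP <-; exact/esym/Pf.
  pose P' l := if l \in [:: e1; e2] then P a1 else P (R2sub l).
  have P'o l : l \in [:: a1; a2; b1; b2] ++ labs C0 -> P' l = P (R2sub l).
    move=> lp; rewrite /P' ifN // !inE negb_or.
    by apply/andP; split; apply: contraTneq lp => ->.
  have P'e l : l \in [:: e1; e2] -> P' l = P a1 by rewrite /P' => ->.
  exists P'.
    rewrite /= !(P'e e1) ?(P'e e2) ?P'o ?inE ?eqxx ?orbT // h1 h2 h3 h4 -E12 eqxx /=.
    rewrite (@all_cst_eq _ (fun l => P (R2sub l))).
      move: aP; rewrite all_map; apply: sub_all => x /=.
      by case: x => [[[a b] c'] d].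
    by move=> l lC0; apply: P'o; rewrite mem_cat lC0 orbT.
  move=> l; rewrite labs_mapX => /mapP[m mC ->]; exists m.
    by rewrite !labs_cons !mem_cat mC !orbT.
  by rewrite P'o // mem_cat mC orbT.
right=> k; have le : nfaces (Dg C2) <= size C2 + 2 * ngcomp (Dg C2) by exact: nfaces_le.
suff le2 : ngcomp (Dg C2) <= 2.
  have nfE : nfaces (Dg C2) = size C2 + 4.
    by move: nf; rewrite (R2_nfaces_split nc) /= size_map => ->; rewrite addSnnS addSnnS.
  have E : ngcomp (Dg C2) = 2.
    apply/eqP; rewrite eqn_leq le2; move: le; rewrite nfE leq_add2l.
    by case: ngcomp le2 => [|[|[|]]].
  split; last exact: E.
  split; first exact: wC2.
  by change (nfaces (Dg C2) = size C2 + 2 * ngcomp (Dg C2)); rewrite nfE E.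
apply: (@leq_trans #|[set A1.1; A2.1]|); last by rewrite cards2; case: (_ != _).
apply: n_comp_le_set; first exact: adjX_sym.
move=> i; have [c|nc1] := boolP (connect (@adjX (Dg C2)) i A1.1).
  by exists A1.1; rewrite ?inE ?eqxx.
have [c|nc2] := boolP (connect (@adjX (Dg C2)) i A2.1).
  by exists A2.1; rewrite ?inE ?eqxx ?orbT.
(* The labels of a component that avoids the crossings of [A1] and [A2]. Extended by false to [e1]
   and [e2], this set would separate the connected diagram with the bigon. *)
pose P l := [exists j, connect (@adjX (Dg C2)) i j && (l \in clabels (nth (0,0,0,0) C2 j))].
have PN (x : dart (Dg C2)) : ~~ connect (@adjX (Dg C2)) i x.1 -> P (lab x) = false.
  move=> nx; apply: contraNF nx => /existsP[j /andP[cj lj]].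
  apply: connect_trans cj (connect1 _); apply/hasP; exists (lab x) => //; exact: lab_in.
have PT (x : dart (Dg C2)) : connect (@adjX (Dg C2)) i x.1 -> P (lab x).
  by move=> cx; apply/existsP; exists x.1; rewrite cx; exact: lab_in.
pose P' l := if l \in [:: e1; e2] then false else P (R2sub l).
have P'o l : l \in [:: a1; a2; b1; b2] ++ labs C0 -> P' l = P (R2sub l).
  move=> lp; rewrite /P' ifN // !inE negb_or.
  by apply/andP; split; apply: contraTneq lp => ->.
have P'e l : l \in [:: e1; e2] -> P' l = false by rewrite /P' => ->.
have Pa1 : P a1 = false by have := PN _ nc1; rewrite R2up_lab hA1 h1.
have Pa2 : P a2 = false by have := PN _ nc2; rewrite R2up_lab hA2 h2.
have aP' : all (const_at P') C1.
  rewrite /= !(P'e e1) ?(P'e e2) ?P'o ?inE ?eqxx ?orbT // h1 h2 h3 h4 Pa1 Pa2 eqxx /=.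
  rewrite (@all_cst_eq _ (fun l => P (R2sub l))); last first.
    by move=> l lC0; apply: P'o; rewrite mem_cat lC0 orbT.
  suff aP : all (const_at P) C2.
    by move: aP; rewrite all_map; apply: sub_all => x /=; case: x => [[[a b] c'] d].
  apply/allP=> y yC; have iy : index y C2 < ncross (Dg C2) by rewrite index_mem.
  have yE : nth (0,0,0,0) C2 (Ordinal iy) = y by rewrite /= nth_index.
  have [cy|ncy] := boolP (connect (@adjX (Dg C2)) i (Ordinal iy)).
    have yP l : l \in clabels y -> P l by move=> ly; apply/existsP; exists (Ordinal iy); rewrite cy yE.
    by apply/cstP => l l' /yP -> /yP ->.
  have yP l : l \in clabels y -> P l = false.
    move=> ly; apply: contraNF ncy => /existsP[j /andP[cj lj]].
    by apply: connect_trans cj (connect1 _); apply/hasP; exists l => //; rewrite yE.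
  by apply/cstP => l l' /yP -> /yP ->.
have l1 : lab (R2up (i, ord0)) \in labs C1 by rewrite !labs_cons !mem_cat R2up_raw !orbT.
have l2 : e1 \in labs C1 by rewrite labs_cons mem_cat /= !inE eqxx ?orbT.
have := lC P' aP' _ _ l1 l2; rewrite (P'e e1) ?inE ?eqxx // P'o; last first.
  by rewrite mem_cat R2up_raw orbT.
by rewrite -R2up_lab (PT (i, ord0)).
Qed.

End R2.

(** * Composite moves *)

Definition lequiv C C' := link_equiv (Dg C) (Dg C').

Lemma lequiv_refl C : lequiv C C. Proof. exact: rst_refl. Qed.
Lemma lequiv_sym C C' : lequiv C C' -> lequiv C' C. Proof. exact: rst_sym. Qed.
Lemma lequiv_trans C C' C'' : lequiv C C' -> lequiv C' C'' -> lequiv C C''.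
Proof. exact: rst_trans. Qed.

Lemma lequiv_step C C' : good C -> good C' -> step (Dg C) (Dg C') -> lequiv C C'.
Proof. by move=> g g' bounded_coloring; apply: rst_step; split; [exact: good_valid|split; [exact: good_valid|]]. Qed.

Definition iso C C' := good C -> good C' /\ lequiv C C'.

Lemma iso_trans C C' C'' : iso C C' -> iso C' C'' -> iso C C''.
Proof.
move=> h h' g; have [g' e] := h g; have [g'' e'] := h' g'; split=> //.
exact: lequiv_trans e e'.
Qed.

Lemma iso_refl C : iso C C. Proof. by move=> g; split=> //; exact: lequiv_refl. Qed.

Lemma iso_perm C C' : perm_eq C C' -> iso C C'.
Proof.
move=> p g; have g' := good_perm p g; split=> //.
by apply: lequiv_step => //; apply: st_perm.
Qed.

Lemma good_rotX x C : good (x :: C) -> good (rotX x :: C).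
Proof. by case: x => [[[a b] c] d] g; apply: (@good_rot4 (b, c, d, a)); apply: (@good_rot4 (a, b, c, d)). Qed.

Lemma perm_mid (A : seq crossing) x C : perm_eq (A ++ x :: C) (x :: A ++ C).
Proof. by rewrite -cat1s perm_catCA. Qed.

Lemma perm_swap (x y : crossing) C : perm_eq [:: x, y & C] [:: y, x & C].
Proof. by rewrite (perm_catCA [:: x] [:: y] C). Qed.

Lemma iso_rotX A x C : iso (A ++ x :: C) (A ++ rotX x :: C).
Proof.
move=> g; have g' : good (A ++ rotX x :: C).
  apply: good_perm (good_rotX (good_perm (perm_mid A x C) g)).
  by rewrite perm_sym perm_mid.
by split=> //; apply: lequiv_step => //; apply: st_rot.
Qed.

Lemma good_mid_rot4 A x C : good (A ++ x :: C) -> good (A ++ rot4 x :: C).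
Proof.
move=> g; apply: good_perm (good_rot4 (good_perm (perm_mid A x C) g)).
by rewrite perm_sym perm_mid.
Qed.

Lemma good_mkX A u o0 o1 o2 o3 C :
  good (A ++ mkX u o0 o1 o2 o3 :: C) <-> good (A ++ (o0, o1, o2, o3) :: C).
Proof.
case: u => //=; split=> [/good_mid_rot4/good_mid_rot4/good_mid_rot4 //|].
exact: (@good_mid_rot4 A (o0, o1, o2, o3)).
Qed.

Lemma iso_relab f C : injective f -> iso C (map (mapX f) C).
Proof.
move=> fi g; have g' := good_relab fi g; split=> //.
by apply: lequiv_step => //; apply: st_relab.
Qed.

Definition swap_labels (p q l : nat) : nat := if l == p then q else if l == q then p else l.

Lemma swK p q : involutive (swap_labels p q).
Proof.
move=> l; rewrite /swap_labels; case: (eqVneq l p) => [->|lp]; first by rewrite eqxx; case: eqVneq.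
by case: (eqVneq l q) => [->|lq]; rewrite ?eqxx // (negbTE lp) (negbTE lq).
Qed.

Lemma eq_in_mapX f f' C : {in labs C, f =1 f'} -> map (mapX f) C = map (mapX f') C.
Proof.
move=> e; apply/eq_in_map => x xC.
have {}e : {in clabels x, f =1 f'} by move=> l lx; apply: e; apply/lab_mem; exists x.
by case: x e {xC} => [[[a b] c] d] e; rewrite /= !e ?inE ?eqxx ?orbT.
Qed.

Lemma mapX_id C : map (mapX id) C = C.
Proof. by rewrite -[RHS]map_id; apply: eq_map => -[[[]]]. Qed.

Lemma mkX_map f u o0 o1 o2 o3 : mapX f (mkX u o0 o1 o2 o3) = mkX u (f o0) (f o1) (f o2) (f o3).
Proof. by case: u. Qed.

Lemma R2_lequiv a1 a2 b1 b2 e1 e2 C0 : uniq [:: a1; a2; b1; b2] ->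
  good [:: (a2, e1, e2, a1), (e2, e1, b2, b1) & C0] ->
  good (map (mapX (R2sub a1 a2 b1 b2)) C0) ->
  lequiv (map (mapX (R2sub a1 a2 b1 b2)) C0) [:: (a2, e1, e2, a1), (e2, e1, b2, b1) & C0].
Proof.
move=> u g1 g2; apply: lequiv_sym; apply: lequiv_step => //.
have := st_R2 a1 a2 b1 b2 e1 e2 C0 0.
have [[h1 h2 h3 h4 h5] h6] := uabE u.
have s1 : sub1 a1 b1 a2 = a2 by rewrite /sub1 (negbTE h2) (negbTE h4).
have s2 : sub1 a1 b1 b2 = b2 by rewrite /sub1 (negbTE h2) eq_sym (negbTE h6).
rewrite s1 s2 /Defs.merge (negbTE h2) (negbTE h5) /= /subst -map_comp.
rewrite (@eq_map _ _ _ (mapX (R2sub a1 a2 b1 b2))) // => -[[[a b] c] d] /=.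
have E l : (if (if l == b1 then a1 else l) == b2 then a2 else if l == b1 then a1 else l) = R2sub a1 a2 b1 b2 l.
  by rewrite /R2sub; case: (eqVneq l b1) => _ //; rewrite (negbTE h3).
by rewrite !E.
Qed.

Definition fresh N C := all (fun l => l < N) (labs C).

Lemma fresh_notin N k C : fresh N C -> N + k \notin labs C.
Proof. by move/allP=> h; apply/negP=> /h; lia. Qed.

(** * Creating a bigon along an edge or in a corner *)

Section Near.
Variables (N f x1 x2 g h y1 y2 : nat) (C : seq crossing).
Let g0 := N.
Let h0 := N + 1.
Let ge := N + 2.
Let he := N + 3.
Let D := [:: (f, x1, x2, g), (f, h, y1, y2) & C].
Hypotheses (gh : g != h) (fN : fresh N D).
Let C0 := [:: (f, x1, x2, g0), (f, h0, y1, y2) & C].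

Lemma near_lt : [/\ [/\ f < N, x1 < N, x2 < N & g < N], [/\ h < N, y1 < N & y2 < N] &
  {in labs C, forall l, l < N}].
Proof.
move/allP: fN => h'; split; first by split; apply: h'; rewrite /labs /= !inE eqxx ?orbT.
  by split; apply: h'; rewrite /labs /= !inE eqxx ?orbT.
by move=> l lC; apply: h'; rewrite !labs_cons !mem_cat lC !orbT.
Qed.

Lemma near_uniq : uniq [:: g; h; g0; h0].
Proof.
have [[_ _ _ gN] [hN _ _] _] := near_lt.
by rewrite /= !inE !negb_or gh /g0 /h0 /=; lia.
Qed.

Lemma near_wl : wellformed D -> wellformed [:: (h, ge, he, g), (he, ge, h0, g0) & C0].
Proof.
move=> w; have : wls [:: g0, g0, h0, h0, ge, ge, he, he & labs D].
  have k l : N <= l -> l \notin labs D by move=> Nl; apply/negP => /(allP fN); lia.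
  apply/wls_cons2; rewrite 6!in_cons 6!negb_or k /g0 /h0 /ge /he; last lia.
  split; first lia.
  apply/wls_cons2; rewrite 4!in_cons 4!negb_or k; last lia.
  split; first lia.
  apply/wls_cons2; rewrite 2!in_cons 2!negb_or k; last lia.
  split; first lia.
  by apply/wls_cons2; rewrite k; last lia.
apply: wls_perm; apply/seq.permP => p; rewrite /D /C0 /labs /=; blia.
Qed.

Lemma near_sub : map (mapX (R2sub g h g0 h0)) C0 = D.
Proof.
have [[fN' x1N x2N gN] [hN y1N y2N] CN] := near_lt.
have s l : l < N -> R2sub g h g0 h0 l = l.
  by move=> lN; apply: R2sub_o; rewrite !inE negb_or /g0 /h0; lia.
have [_ _ s3 s4] := R2sub_ab near_uniq.
rewrite /= (s f) // (s x1) // (s x2) // (s y1) // (s y2) // s3 s4 /D; congr [:: _, _ & _].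
by rewrite -[RHS]mapX_id; apply: eq_in_mapX => l /CN/s.
Qed.

(** The edges [g] and [h] leave the two ends of [f] on the same side, so they border a common face,
    inside which the bigon can be created. *)
Lemma good_near : good D -> good [:: (h, ge, he, g), (he, ge, h0, g0) & C0].
Proof.
move=> gD; have u := near_uniq; have sE := near_sub.
have w : wellformed [:: (h, ge, he, g), (he, ge, h0, g0) & C0] by apply: near_wl; case: gD.
have lin l : l \in [:: g; h; g0; h0] -> exists d, lab (R2up (a1 := g) (a2 := h) (b1 := g0) (b2 := h0) ge he (C0 := C0) d) = l.
  by move=> lu; apply: R2_dart; have := count0_ab w u lu; rewrite -has_pred1 has_count => ->.
have [A1 hA1] : exists d, lab (R2up (a1 := g) (a2 := h) (b1 := g0) (b2 := h0) ge he (C0 := C0) d) = g.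
  by apply: lin; rewrite !inE eqxx ?orbT.
have [A2 hA2] : exists d, lab (R2up (a1 := g) (a2 := h) (b1 := g0) (b2 := h0) ge he (C0 := C0) d) = h.
  by apply: lin; rewrite !inE eqxx ?orbT.
pose B1 : dart (Dg (map (mapX (R2sub g h g0 h0)) C0)) := (@Ordinal (size _).+2 0 isT, @Ordinal 4 3 isT).
pose B2 : dart (Dg (map (mapX (R2sub g h g0 h0)) C0)) := (@Ordinal (size _).+2 1 isT, @Ordinal 4 1 isT).
apply: (@good_R2_add g h g0 h0 ge he C0 w u A1 A2 B1 B2) => //; first by rewrite sE.
have w2 : wellformed (map (mapX (R2sub g h g0 h0)) C0) by rewrite sE; case: gD.
have [oA1 _ _ _] := R2_other2 w u hA1 hA2 (B1 := B1) (B2 := B2) (erefl _) (erefl _).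
have : connect (frel (@facestep (Dg (map (mapX (R2sub g h g0 h0)) C0)))) A1 (turn B1).
  by apply: connect1; rewrite /= /facestep oA1.
move/connect_trans; apply; rewrite /B1; turnE.
by apply: (facestep_conn w2 (e := (@Ordinal (size _).+2 1 isT, @Ordinal 4 0 isT))) => //;
  congr (_, _); apply: val_inj.
Qed.

End Near.

(** With the other strand on top, [st_R2] has to be read with the inner ends in the place of the
    outer ones, and then it keeps the names of the inner ends. The two results differ by an exchange
    of names. *)
Lemma R2_flip g h g0 h0 C0 : uniq [:: g; h; g0; h0] ->
  map (mapX (R2sub h0 g0 h g)) C0 =
  map (mapX (swap_labels g g0 \o swap_labels h h0)) (map (mapX (R2sub g h g0 h0)) C0).
Proof.
rewrite /= !inE !negb_or => /and4P[/and3P[n1 n2 n3] /andP[n4 n5] n6 _].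
rewrite -map_comp; apply: eq_map => -[[[a b] c] d] /=.
have E l : R2sub h0 g0 h g l = swap_labels g g0 (swap_labels h h0 (R2sub g h g0 h0 l)).
  rewrite /R2sub /swap_labels; case: (eqVneq l g0) => [->|lg0].
    rewrite (eq_sym g0) (negbTE n4) (eq_sym g0) (negbTE n2) (negbTE n1) (negbTE n3).
    by rewrite eqxx.
  case: (eqVneq l h0) => [->|lh0].
    rewrite (eq_sym h0) (negbTE n5) (eq_sym h0) (negbTE n3) eqxx.
    by rewrite (eq_sym h0) (negbTE n3) (eq_sym h0) (negbTE n6).
  case: (eqVneq l h) => [_|lh].
    by rewrite (eq_sym h0) (negbTE n3) (eq_sym h0) (negbTE n6).
  by rewrite (negbTE lh0); case: eqP => //; rewrite (negbTE lg0).
by rewrite !E.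
Qed.

(** [t] tells whether the strand of [g] passes over that of [h]. The constructor [st_R2] has a fixed
    strand on top, so the two values of [t] use it in two positions. *)
Lemma R2_both t g h g0 h0 ge he C0 : uniq [:: g; h; g0; h0] ->
  good [:: (h, ge, he, g), (he, ge, h0, g0) & C0] ->
  iso (map (mapX (R2sub g h g0 h0)) C0)
    [:: mkX (~~ t) ge h0 g0 he, mkX (~~ t) ge he g h & C0].
Proof.
move=> u gL gD.
have gT : good [:: mkX (~~ t) ge h0 g0 he, mkX (~~ t) ge he g h & C0].
  apply/(good_mkX [::])/(good_mkX [:: _]).
  apply: (@good_mid_rot4 [:: _] (h, ge, he, g)).
  apply: (@good_perm [:: (h, ge, he, g), (ge, h0, g0, he) & C0]).
    exact: perm_swap.
  exact: (@good_mid_rot4 [:: _] (he, ge, h0, g0)).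
split=> //; case: t gT => /= gT.
  apply: lequiv_trans (R2_lequiv u gL gD) _.
  apply: lequiv_trans (iso_rotX (A := [::]) gL).2 _.
  have g2 := (iso_rotX (A := [::]) gL).1.
  apply: lequiv_trans (iso_rotX (A := [:: _]) g2).2 _.
  have g3 := (iso_rotX (A := [:: _]) g2).1.
  apply: (iso_perm _ g3).2.
  exact: perm_swap.
have fi : injective (swap_labels g g0 \o swap_labels h h0).
  by apply: inj_comp; apply: inv_inj; apply: swK.
have [g1 e1] := iso_relab fi gD; apply: lequiv_trans e1 _.
rewrite -R2_flip // in g1 *.
have u' : uniq [:: h0; g0; h; g].
  by rewrite -rev_uniq.
have gA : good [:: (g0, he, ge, h0), (ge, he, g, h) & C0].
  exact: (iso_rotX (A := [::]) gT).1.
apply: lequiv_trans (R2_lequiv u' gA g1) _.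
apply: lequiv_sym; exact: (iso_rotX (A := [::]) gT).2.
Qed.

Lemma labs_mkX u o0 o1 o2 o3 C :
  perm_eq (labs (mkX u o0 o1 o2 o3 :: C)) ([:: o0; o1; o2; o3] ++ labs C).
Proof.
rewrite labs_cons perm_cat2r; case: u => //=.
by rewrite -[X in perm_eq X]/([:: o1; o2; o3] ++ [:: o0]) perm_catC.
Qed.

Lemma fresh_perm N C C' : perm_eq (labs C) (labs C') -> fresh N C = fresh N C'.
Proof. by move=> p; apply: perm_all. Qed.

Lemma fresh_mkX N u o0 o1 o2 o3 C :
  fresh N (mkX u o0 o1 o2 o3 :: C) = [&& o0 < N, o1 < N, o2 < N, o3 < N & fresh N C].
Proof. by rewrite /fresh (perm_all _ (labs_mkX u o0 o1 o2 o3 C)). Qed.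

Lemma iso_near t u1 u2 N f x1 x2 g h y1 y2 C :
  g != h -> fresh N [:: mkX u1 f x1 x2 g, mkX u2 f h y1 y2 & C] ->
  iso [:: mkX u1 f x1 x2 g, mkX u2 f h y1 y2 & C]
    [:: mkX (~~ t) (N + 2) (N + 1) N (N + 3), mkX (~~ t) (N + 2) (N + 3) g h,
        mkX u1 f x1 x2 N, mkX u2 f (N + 1) y1 y2 & C].
Proof.
move=> gh fN gD.
have fN' : fresh N [:: (f, x1, x2, g), (f, h, y1, y2) & C].
  by move: fN; rewrite fresh_mkX (fresh_mkX _ _ f) -(fresh_mkX N true f h) -(fresh_mkX N true f).
have gD' : good [:: (f, x1, x2, g), (f, h, y1, y2) & C].
  by apply/(good_mkX [:: _] u2)/(good_mkX [::] u1).
have gL := good_near gh fN' gD'.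
have [[fl x1l x2l gl] [hl y1l y2l] CN] := near_lt fN'.
have u : uniq [:: g; h; N; N + 1] by apply: near_uniq gh fN'.
have := R2_both t (ge := N + 2) (he := N + 3)
  (C0 := [:: mkX u1 f x1 x2 N, mkX u2 f (N + 1) y1 y2 & C]) u _.
have s l : l < N -> R2sub g h N (N + 1) l = l.
  by move=> lN; apply: R2sub_o; rewrite !inE negb_or; lia.
have [_ _ s3 s4] := R2sub_ab u.
have -> : map (mapX (R2sub g h N (N + 1))) [:: mkX u1 f x1 x2 N, mkX u2 f (N + 1) y1 y2 & C] =
    [:: mkX u1 f x1 x2 g, mkX u2 f h y1 y2 & C].
  rewrite /= !mkX_map (s f) // (s x1) // (s x2) // (s y1) // (s y2) // s3 s4; congr [:: _, _ & _].
  by rewrite -[RHS]mapX_id; apply: eq_in_mapX => l /CN/s.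
move=> H; apply: H; last exact: gD.
by apply/(good_mkX [:: _; _] u1)/(good_mkX [:: _; _; _] u2).
Qed.

Section Corner.
Variables (N f x1 x2 g : nat) (C : seq crossing).
Let g0 := N.
Let f0 := N + 1.
Let ge := N + 2.
Let fe := N + 3.
Let D := (f, x1, x2, g) :: C.
Hypotheses (gf : g != f) (fN : fresh N D).
Let C0 := (f0, x1, x2, g0) :: C.

Lemma corner_lt : [/\ f < N, x1 < N, x2 < N & g < N] /\ {in labs C, forall l, l < N}.
Proof.
move/allP: fN => h'; split; first by split; apply: h'; rewrite /labs /= !inE eqxx ?orbT.
by move=> l lC; apply: h'; rewrite !labs_cons !mem_cat lC !orbT.
Qed.

Lemma corner_uniq : uniq [:: g; f; g0; f0].
Proof.
have [[fN' _ _ gN] _] := corner_lt.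
by rewrite /= !inE !negb_or gf /g0 /f0 /=; lia.
Qed.

Lemma corner_wl : wellformed D -> wellformed [:: (f, ge, fe, g), (fe, ge, f0, g0) & C0].
Proof.
move=> w; have : wls [:: g0, g0, f0, f0, ge, ge, fe, fe & labs D].
  have k l : N <= l -> l \notin labs D by move=> Nl; apply/negP => /(allP fN); lia.
  apply/wls_cons2; rewrite 6!in_cons 6!negb_or k /g0 /f0 /ge /fe; last lia.
  split; first lia.
  apply/wls_cons2; rewrite 4!in_cons 4!negb_or k; last lia.
  split; first lia.
  apply/wls_cons2; rewrite 2!in_cons 2!negb_or k; last lia.
  split; first lia.
  by apply/wls_cons2; rewrite k; last lia.
apply: wls_perm; apply/seq.permP => p; rewrite /D /C0 /labs /=; blia.
Qed.

Lemma corner_sub : map (mapX (R2sub g f g0 f0)) C0 = D.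
Proof.
have [[fN' x1N x2N gN] CN] := corner_lt.
have s l : l < N -> R2sub g f g0 f0 l = l.
  by move=> lN; apply: R2sub_o; rewrite !inE negb_or /g0 /f0; lia.
have [_ _ s3 s4] := R2sub_ab corner_uniq.
rewrite /= (s x1) // (s x2) // s3 s4 /D; congr (_ :: _).
by rewrite -[RHS]mapX_id; apply: eq_in_mapX => l /CN/s.
Qed.

(** Consecutive slots of a crossing border a common face, so the bigon fits into the corner between
    them. *)
Lemma good_corner : good D -> good [:: (f, ge, fe, g), (fe, ge, f0, g0) & C0].
Proof.
move=> gD; have u := corner_uniq; have sE := corner_sub.
have w : wellformed [:: (f, ge, fe, g), (fe, ge, f0, g0) & C0] by apply: corner_wl; case: gD.
have lin l : l \in [:: g; f; g0; f0] -> exists d, lab (R2up (a1 := g) (a2 := f) (b1 := g0) (b2 := f0) ge fe (C0 := C0) d) = l.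
  by move=> lu; apply: R2_dart; have := count0_ab w u lu; rewrite -has_pred1 has_count => ->.
have [A1 hA1] : exists d, lab (R2up (a1 := g) (a2 := f) (b1 := g0) (b2 := f0) ge fe (C0 := C0) d) = g.
  by apply: lin; rewrite !inE eqxx ?orbT.
have [A2 hA2] : exists d, lab (R2up (a1 := g) (a2 := f) (b1 := g0) (b2 := f0) ge fe (C0 := C0) d) = f.
  by apply: lin; rewrite !inE eqxx ?orbT.
pose B1 : dart (Dg (map (mapX (R2sub g f g0 f0)) C0)) := (@Ordinal (size _).+1 0 isT, @Ordinal 4 3 isT).
pose B2 : dart (Dg (map (mapX (R2sub g f g0 f0)) C0)) := (@Ordinal (size _).+1 0 isT, @Ordinal 4 0 isT).
apply: (@good_R2_add g f g0 f0 ge fe C0 w u A1 A2 B1 B2) => //; first by rewrite sE.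
have [oA1 _ _ _] := R2_other2 w u hA1 hA2 (B1 := B1) (B2 := B2) (erefl _) (erefl _).
have -> : B2 = turn B1 by congr (_, _); apply: val_inj.
by apply: connect1; rewrite /= /facestep oA1.
Qed.

End Corner.

Lemma iso_corner t u N f x1 x2 g C :
  g != f -> fresh N (mkX u f x1 x2 g :: C) ->
  iso (mkX u f x1 x2 g :: C)
    [:: mkX (~~ t) (N + 2) (N + 1) N (N + 3), mkX (~~ t) (N + 2) (N + 3) g f,
        mkX u (N + 1) x1 x2 N & C].
Proof.
move=> gf fN gD.
have fN' : fresh N ((f, x1, x2, g) :: C) by move: fN; rewrite fresh_mkX -(fresh_mkX N true f).
have gD' : good ((f, x1, x2, g) :: C) by apply/(good_mkX [::] u).
have gL := good_corner gf fN' gD'.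
have [[fl x1l x2l gl] CN] := corner_lt fN'.
have un : uniq [:: g; f; N; N + 1] by apply: corner_uniq gf fN'.
have := R2_both t (ge := N + 2) (he := N + 3) (C0 := mkX u (N + 1) x1 x2 N :: C) un _.
have s l : l < N -> R2sub g f N (N + 1) l = l.
  by move=> lN; apply: R2sub_o; rewrite !inE negb_or; lia.
have [_ _ s3 s4] := R2sub_ab un.
have -> : map (mapX (R2sub g f N (N + 1))) (mkX u (N + 1) x1 x2 N :: C) = mkX u f x1 x2 g :: C.
  rewrite /= !mkX_map (s x1) // (s x2) // s3 s4; congr (_ :: _).
  by rewrite -[RHS]mapX_id; apply: eq_in_mapX => l /CN/s.
move=> H; apply: H; last exact: gD.
by apply/(good_mkX [:: _; _] u).
Qed.

Lemma iso_kink u N q0 b c d C : fresh N (mkX u q0 b c d :: C) ->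
  iso (mkX u q0 b c d :: C) [:: (N, N + 1, N + 1, q0), mkX u N b c d & C].
Proof.
move=> fN gD; have gD' : good ((q0, b, c, d) :: C) by apply/(good_mkX [::] u).
have fN' : fresh N ((q0, b, c, d) :: C) by move: fN; rewrite fresh_mkX -(fresh_mkX N true q0).
have gT : good [:: (N, N + 1, N + 1, q0), mkX u N b c d & C].
  apply/(good_mkX [:: _] u); apply: good_R1 => //; first lia.
  - by have := fresh_notin 0 fN'; rewrite addn0.
  - exact: fresh_notin.
  - by case: gD'.
split=> //.
(* [st_R1a] gives the merged edge the new name [N], hence the preliminary exchange of [N] and
   [q0]. *)
have fi : injective (swap_labels N q0) by apply/inv_inj/swK.
have [g1 e1] := iso_relab fi gD; apply: lequiv_trans e1 _.
apply/lequiv_sym/lequiv_step => //.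
have qN : q0 < N by move: fN'; rewrite (fresh_mkX N true) => /and5P[].
suff E : Defs.subst q0 N (mkX u N b c d :: C) = [seq mapX (swap_labels N q0) i | i <- mkX u q0 b c d :: C].
  have := st_R1a N (N + 1) q0 (mkX u N b c d :: C) 0.
  by rewrite /Defs.merge gtn_eqF // [xs _]/= E.
have s l : l < N -> (if l == q0 then N else l) = swap_labels N q0 l.
  by move=> lN; rewrite /swap_labels (ltn_eqF lN).
move: fN; rewrite fresh_mkX => /and5P[_ bN cN dN CN].
rewrite /Defs.subst /= !mkX_map /= -!s //; congr (mkX _ _ _ _ _ :: _).
  by rewrite eqxx gtn_eqF.
by apply: eq_in_mapX => l /(allP CN)/s.
Qed.

Lemma rotX_mkX u o0 o1 o2 o3 : rotX (mkX u o0 o1 o2 o3) = mkX u o2 o3 o0 o1.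
Proof. by case: u. Qed.

Lemma iso_mkX_rot A u o0 o1 o2 o3 C :
  iso (A ++ mkX u o0 o1 o2 o3 :: C) (A ++ mkX u o2 o3 o0 o1 :: C).
Proof. by have := @iso_rotX A (mkX u o0 o1 o2 o3) C; rewrite rotX_mkX. Qed.

Lemma iso_mkX_neg A u o0 o1 o2 o3 C :
  iso (A ++ mkX u o0 o1 o2 o3 :: C) (A ++ mkX (~~ u) o3 o0 o1 o2 :: C).
Proof.
case: u; first exact: iso_refl.
exact: (@iso_rotX A (mkX false o0 o1 o2 o3)).
Qed.

(* The strand s1 - s2, crossing edge [a] of the vertex (a, b, c, d), is pushed
   across that vertex and crosses the other three edges afterwards. *)
Lemma iso_slide t u N a s1 a' s2 b c d C : s2 != b ->
  fresh N [:: mkX t a s1 a' s2, mkX u a b c d & C] ->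
  iso [:: mkX t a s1 a' s2, mkX u a b c d & C]
    [:: mkX (~~ t) N d s1 (N + 4), mkX (~~ t) (N + 2) c N (N + 1),
        mkX u (N + 1) (N + 4) a' (N + 3), mkX (~~ t) (N + 2) (N + 3) s2 b & C].
Proof.
move=> s2b fN; apply: iso_trans (iso_near t s2b fN) _.
set Yt := mkX _ _ (N + 1) N _; set Yb := mkX _ _ (N + 3) s2 b.
apply: iso_trans (@iso_mkX_neg [:: Yt; Yb] t a s1 a' N (mkX u a (N + 1) c d :: C)) _; rewrite /=.
set x := mkX (~~ t) N a s1 a'.
apply: iso_trans (@iso_mkX_rot [:: Yt; Yb; x] u a (N + 1) c d C) _; rewrite /=.
set w := mkX u c d a _.
(* The crossings [x], [Yt] and [w] now bound a triangle with sides [N], [N + 1] and [a], on which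
   Reidemeister III acts. *)
apply: (@iso_trans _ ([:: x; Yt; w] ++ Yb :: C)).
  apply: iso_perm; rewrite -[X in perm_eq X]/([:: Yt] ++ [:: Yb] ++ [:: x; w] ++ C).
  rewrite -[X in perm_eq _ X]/([:: x] ++ [:: Yt] ++ [:: w] ++ [:: Yb] ++ C).
  by apply/seq.permP => p; rewrite !count_cat /=; blia.
move=> gM.
have gM' : good ([:: (N, a, s1, a'); (N + 2, N + 1, N, N + 3); (c, d, a, N + 1)] ++ (N + 2, N + 3, s2, b) :: C).
  apply/(good_mkX [::] (~~ t))/(good_mkX [:: _] (~~ t))/(good_mkX [:: _; _] u).
  exact/(good_mkX [:: _; _; _] (~~ t)).
have := @good_R3 s1 (N + 2) a' c d (N + 3) N a (N + 1) N (N + 1) (N + 4) ((N + 2, N + 3, s2, b) :: C) _ _ gM'.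
move: fN; rewrite fresh_mkX fresh_mkX => /and5P[aN s1N a'N s2N /and5P[_ bN cN dN CN]].
have gT (h : good ([:: (N, d, s1, N + 4); (N + 2, c, N, N + 1); (N + 1, N + 4, a', N + 3)] ++ (N + 2, N + 3, s2, b) :: C)) :
    good [:: mkX (~~ t) N d s1 (N + 4), mkX (~~ t) (N + 2) c N (N + 1),
        mkX u (N + 1) (N + 4) a' (N + 3), mkX (~~ t) (N + 2) (N + 3) s2 b & C].
  apply/(good_mkX [::] (~~ t))/(good_mkX [:: _] (~~ t))/(good_mkX [:: _; _] u).
  exact/(good_mkX [:: _; _; _] (~~ t)).
move=> H; have g' : good [:: mkX (~~ t) N d s1 (N + 4), mkX (~~ t) (N + 2) c N (N + 1),
        mkX u (N + 1) (N + 4) a' (N + 3), mkX (~~ t) (N + 2) (N + 3) s2 b & C].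
  apply: gT; apply: H; first by rewrite /= !inE; lia.
  move=> j jN; have {}jN : (N <= j) /\ (j != N + 2) /\ (j != N + 3).
    by move: jN; rewrite !inE => /or3P[]/eqP ->; lia.
  have jC : j \notin labs C by apply/negP=> /(allP CN); lia.
  by rewrite /labs /= !inE -/(labs C) (negbTE jC) orbF; lia.
split=> //; apply: lequiv_step => //.
exact: (@st_R3 t u s1 (N + 2) a' c d (N + 3) N a (N + 1) N (N + 1) (N + 4) (Yb :: C) 0).
Qed.

(** * Colorings *)

Definition zcolored (gam : nat -> int) (x : crossing) : bool :=
  let: (a, b, c, d) := x in (gam b == gam d) && (gam b + gam b == gam a + gam c)%R.

(* Twice the difference between over and under colors: invariant under rotX. *)
Definition spread (gam : nat -> int) (x : crossing) : nat :=
  let: (a, b, c, d) := x in `|(gam a - gam c)%R|%N.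

Lemma ZcoloringP C k gam : Zcoloring (Diagram C k) gam <-> all (zcolored gam) C.
Proof.
split=> [h|/allP h [[[a b] c] d] /h /= /andP[/eqP -> /eqP E]].
  apply/allP=> -[[[a b] c] d] /h /= [-> E]; rewrite eqxx /=; lia.
by split=> //; lia.
Qed.

Definition rotinv (Q : pred crossing) := forall x, Q (rotX x) = Q x.

Lemma zc_rot gam : rotinv (zcolored gam).
Proof. by move=> [[[a b] c] d] /=; lia. Qed.

Lemma df_rot gam x : spread gam (rotX x) = spread gam x.
Proof. by case: x => [[[a b] c] d] /=; lia. Qed.

(** Each crossing has two representatives. Counting rotation-invariant properties avoids a choice
    between them and is enough for every later use. *)
Definition same_up_to_rot (C C' : seq crossing) := forall Q, rotinv Q -> count Q C = count Q C'.

Lemma eqv_trans C C' C'' : same_up_to_rot C C' -> same_up_to_rot C' C'' -> same_up_to_rot C C''.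
Proof. by move=> h h' Q r; rewrite h ?h'. Qed.

Lemma eqv_perm C C' : perm_eq C C' -> same_up_to_rot C C'.
Proof. by move=> /seq.permP h Q _. Qed.

Lemma eqv_rot A x C : same_up_to_rot (A ++ x :: C) (A ++ rotX x :: C).
Proof. by move=> Q r; rewrite !count_cat /= r. Qed.

Lemma eqv_all C C' Q : rotinv Q -> same_up_to_rot C C' -> all Q C = all Q C'.
Proof. by move=> r h; rewrite !all_count h // -!(count_predT) (h predT). Qed.

Lemma eqv_has C C' Q : rotinv Q -> same_up_to_rot C C' -> has Q C = has Q C'.
Proof. by move=> r h; rewrite !has_count h. Qed.

Lemma labs_mem_eqv C C' l : same_up_to_rot C C' -> (l \in labs C) = (l \in labs C').
Proof.
move=> h; have r : rotinv (fun x => l \in clabels x).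
  by move=> [[[a b] c] d]; rewrite /= !inE; lia.
have E := eqv_has r h.
by apply/idP/idP => /lab_mem/hasP; [rewrite E|rewrite -E] => /hasP/lab_mem.
Qed.

Definition like C D := iso C D /\ same_up_to_rot C D.

Lemma like_trans C C' C'' : like C C' -> like C' C'' -> like C C''.
Proof. by move=> [h1 h2] [h3 h4]; split; [exact: iso_trans h1 h3|exact: eqv_trans h2 h4]. Qed.
Lemma like_perm C C' : perm_eq C C' -> like C C'.
Proof. by move=> p; split; [exact: iso_perm | exact: eqv_perm]. Qed.
Lemma like_rot A x C : like (A ++ x :: C) (A ++ rotX x :: C).
Proof. by split; [exact: iso_rotX | exact: eqv_rot]. Qed.

(** Any edge of a crossing can be put into the first slot of [mkX], whose flag records whether it is
    an under-edge. This reduces the later case distinctions to the values of the flags. *)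
Lemma orient x f : f \in clabels x -> exists u o1 o2 o3,
  mkX u f o1 o2 o3 = x \/ mkX u f o1 o2 o3 = rotX x.
Proof.
case: x => [[[a b] c] d]; rewrite !inE => /or4P[]/eqP ->.
- by exists true, b, c, d; left.
- by exists false, c, d, a; right.
- by exists true, d, a, b; right.
- by exists false, a, b, c; left.
Qed.

Lemma pull1 C x f C1 : perm_eq C (x :: C1) -> f \in clabels x -> exists u o1 o2 o3,
  like C (mkX u f o1 o2 o3 :: C1) /\ (forall Q, rotinv Q -> Q (mkX u f o1 o2 o3) = Q x).
Proof.
move=> p /orient[u [o1 [o2 [o3 h]]]]; exists u, o1, o2, o3; case: h => ->.
  by split=> //; exact: like_perm.
split; last by move=> Q r; exact: r.
exact: like_trans (like_perm p) (like_rot [::] _ _).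
Qed.

Lemma pull2 C x y f C1 : perm_eq C [:: x, y & C1] -> f \in clabels x -> f \in clabels y ->
  exists u1 x1 x2 g u2 h y1 y2,
  [/\ like C [:: mkX u1 f x1 x2 g, mkX u2 f h y1 y2 & C1],
      forall Q, rotinv Q -> Q (mkX u1 f x1 x2 g) = Q x &
      forall Q, rotinv Q -> Q (mkX u2 f h y1 y2) = Q y].
Proof.
move=> p fx fy; have [u1 [x1 [x2 [g [l1 q1]]]]] := pull1 p fx.
exists u1, x1, x2, g; have [u2 [h [y1 [y2 E]]]] := orient fy.
exists u2, h, y1, y2; case: E => ->; split=> //.
exact: like_trans l1 (like_rot [:: _] _ _).
Qed.

(** New edges are numbered from a bound [N] above all old labels, so their colors can be given as a
    list. *)
Definition ext N (gam : nat -> int) (cs : seq int) (l : nat) : int :=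
  if l < N then gam l else nth 0%R cs (l - N).

Lemma ext_lt N gam cs l : l < N -> ext N gam cs l = gam l.
Proof. by rewrite /ext => ->. Qed.

Lemma ext_ge N gam cs k : ext N gam cs (N + k) = nth 0%R cs k.
Proof. by rewrite /ext ltnNge leq_addr /= addKn. Qed.

Lemma ext_ge0 N gam cs : ext N gam cs N = nth 0%R cs 0.
Proof. by have := ext_ge N gam cs 0; rewrite addn0. Qed.

Lemma zc_eq gam gam' x : {in clabels x, gam =1 gam'} -> zcolored gam x = zcolored gam' x.
Proof. by case: x => [[[a b] c] d] h; rewrite /= !h ?inE ?eqxx ?orbT. Qed.

Lemma df_eq gam gam' x : {in clabels x, gam =1 gam'} -> spread gam x = spread gam' x.
Proof. by case: x => [[[a b] c] d] h; rewrite /= !h ?inE ?eqxx ?orbT. Qed.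

Lemma fresh_cl N C x l : fresh N C -> x \in C -> l \in clabels x -> l < N.
Proof. by move=> /allP h xC lx; apply: h; apply/lab_mem; exists x. Qed.



Lemma exists_fresh C : exists N, fresh N C.
Proof.
exists (\max_(l <- labs C) l).+1; apply/allP => l lC; rewrite ltnS.
exact: leq_bigmax_seq.
Qed.

Lemma zc_mkX gam u o0 o1 o2 o3 : zcolored gam (mkX u o0 o1 o2 o3) =
  if u then (gam o1 == gam o3) && (gam o1 + gam o1 == gam o0 + gam o2)%R
  else (gam o0 == gam o2) && (gam o0 + gam o0 == gam o1 + gam o3)%R.
Proof. by case: u => //=; lia. Qed.

Lemma df_mkX gam u o0 o1 o2 o3 : spread gam (mkX u o0 o1 o2 o3) =
  if u then `|(gam o0 - gam o2)%R|%N else `|(gam o1 - gam o3)%R|%N.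
Proof. by case: u. Qed.

Definition pbool (P : Prop) : bool := if excluded_middle_informative P then true else false.

Lemma pboolP (P : Prop) : reflect P (pbool P).
Proof. by rewrite /pbool; case: excluded_middle_informative => h; constructor. Qed.

Definition agree N (gam gam' : nat -> int) := forall l, l < N -> gam' l = gam l.

Lemma agree_ext N gam cs : agree N gam (ext N gam cs).
Proof. by move=> l; apply: ext_lt. Qed.

Lemma zc_agree N gam gam' C : agree N gam gam' -> fresh N C -> all (zcolored gam') C = all (zcolored gam) C.
Proof.
move=> ag fN; apply: eq_in_all => x xC; apply: zc_eq => l lx.
exact: ag (fresh_cl fN xC lx).
Qed.

Lemma df_agree N gam gam' C (Q : pred nat) : agree N gam gam' -> fresh N C ->
  count (fun x => Q (spread gam' x)) C = count (fun x => Q (spread gam x)) C.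
Proof.
move=> ag fN; apply: eq_in_count => x xC; congr (Q _); apply: df_eq => l lx.
exact: ag (fresh_cl fN xC lx).
Qed.

Lemma fresh_le N N' C : N <= N' -> fresh N C -> fresh N' C.
Proof. by move=> le; apply: sub_all => l lN; apply: leq_trans lN le. Qed.

(** The colors of the new edges are forced: the strand on top keeps its color, and the middle edge
    of the other strand gets the reflection of its color in that one. That [g] and [h] differ in
    color makes them distinct edges, as the bigon requires. *)
Lemma col_near t u1 u2 N gam f x1 x2 g h y1 y2 C :
  let D := [:: mkX u1 f x1 x2 g, mkX u2 f h y1 y2 & C] in
  let D' := [:: mkX (~~ t) (N + 2) (N + 1) N (N + 3), mkX (~~ t) (N + 2) (N + 3) g h,
        mkX u1 f x1 x2 N, mkX u2 f (N + 1) y1 y2 & C] in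
  gam g != gam h -> fresh N D -> good D -> all (zcolored gam) D ->
  exists gam', [/\ [/\ good D', lequiv D D', all (zcolored gam') D' & fresh (N + 4) D'], agree N gam gam' &
    [/\ gam' N = gam g, gam' (N + 1) = gam h,
      gam' (N + 2) = if t then gam g else (gam h + gam h - gam g)%R &
      gam' (N + 3) = if t then (gam g + gam g - gam h)%R else gam h]].
Proof.
move=> D D' gh fN gD zD.
have gh' : g != h by apply: contraNneq gh => ->.
have [gD' eD'] := iso_near t gh' fN gD.
exists (ext N gam [:: gam g; gam h; if t then gam g else (gam h + gam h - gam g)%R;
  if t then (gam g + gam g - gam h)%R else gam h]).
have e0 := ext_ge0 N gam [:: gam g; gam h; if t then gam g else (gam h + gam h - gam g)%R;
  if t then (gam g + gam g - gam h)%R else gam h].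
have e1 := ext_ge N gam [:: gam g; gam h; if t then gam g else (gam h + gam h - gam g)%R;
  if t then (gam g + gam g - gam h)%R else gam h].
have ag := @agree_ext N gam [:: gam g; gam h; if t then gam g else (gam h + gam h - gam g)%R;
  if t then (gam g + gam g - gam h)%R else gam h].
move: (ext _ _ _) e0 e1 ag => gam' e0 e1 ag.
have := fN; rewrite /D fresh_mkX fresh_mkX => /and5P[lf lx1 lx2 lg /and5P[_ lh ly1 ly2 fC]].
split=> //.
have fD' : fresh (N + 4) D'.
  by rewrite /D' !fresh_mkX (fresh_le _ fC) ?leq_addr //; lia.
split=> //; move: zD; rewrite /D /D' /= !zc_mkX !e0 !e1 !ag //= (zc_agree ag fC).
by case: t u1 u2 {D D' fN gD gD' eD' fD' e0 e1} => -[] [] /=; lia.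
Qed.

Lemma col_corner t u N gam f x1 x2 g C :
  let D := mkX u f x1 x2 g :: C in
  let D' := [:: mkX (~~ t) (N + 2) (N + 1) N (N + 3), mkX (~~ t) (N + 2) (N + 3) g f,
        mkX u (N + 1) x1 x2 N & C] in
  gam g != gam f -> fresh N D -> good D -> all (zcolored gam) D ->
  exists gam', [/\ [/\ good D', lequiv D D', all (zcolored gam') D' & fresh (N + 4) D'], agree N gam gam' &
    [/\ gam' N = gam g, gam' (N + 1) = gam f,
      gam' (N + 2) = if t then gam g else (gam f + gam f - gam g)%R &
      gam' (N + 3) = if t then (gam g + gam g - gam f)%R else gam f]].
Proof.
move=> D D' gf fN gD zD.
have gf' : g != f by apply: contraNneq gf => ->.
have [gD' eD'] := iso_corner t gf' fN gD.
exists (ext N gam [:: gam g; gam f; if t then gam g else (gam f + gam f - gam g)%R;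
  if t then (gam g + gam g - gam f)%R else gam f]).
have e0 := ext_ge0 N gam [:: gam g; gam f; if t then gam g else (gam f + gam f - gam g)%R;
  if t then (gam g + gam g - gam f)%R else gam f].
have e1 := ext_ge N gam [:: gam g; gam f; if t then gam g else (gam f + gam f - gam g)%R;
  if t then (gam g + gam g - gam f)%R else gam f].
have ag := @agree_ext N gam [:: gam g; gam f; if t then gam g else (gam f + gam f - gam g)%R;
  if t then (gam g + gam g - gam f)%R else gam f].
move: (ext _ _ _) e0 e1 ag => gam' e0 e1 ag.
have := fN; rewrite /D fresh_mkX => /and5P[lf lx1 lx2 lg fC].
split=> //.
have fD' : fresh (N + 4) D'.
  by rewrite /D' !fresh_mkX (fresh_le _ fC) ?leq_addr //; lia.
split=> //; move: zD; rewrite /D /D' /= !zc_mkX !e0 !e1 !ag //= (zc_agree ag fC).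
by case: t u {D D' fN gD gD' eD' fD' e0 e1} => -[] /=; lia.
Qed.

Lemma col_slide u N gam a s1 a' s2 b c d C :
  let D := [:: mkX true a s1 a' s2, mkX u a b c d & C] in
  let D' := [:: mkX false N d s1 (N + 4), mkX false (N + 2) c N (N + 1),
        mkX u (N + 1) (N + 4) a' (N + 3), mkX false (N + 2) (N + 3) s2 b & C] in
  s2 != b -> fresh N D -> good D -> all (zcolored gam) D ->
  exists gam', [/\ [/\ good D', lequiv D D', all (zcolored gam') D' & fresh (N + 5) D'], agree N gam gam' &
    [/\ gam' N = gam s1, gam' (N + 1) = (gam s1 + gam s1 - gam c)%R, gam' (N + 2) = gam s1,
      gam' (N + 3) = (gam s1 + gam s1 - gam b)%R & gam' (N + 4) = (gam s1 + gam s1 - gam d)%R]].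
Proof.
move=> D D' sb fN gD zD.
have [gD' eD'] := iso_slide sb fN gD.
pose cs := [:: gam s1; (gam s1 + gam s1 - gam c)%R; gam s1; (gam s1 + gam s1 - gam b)%R;
  (gam s1 + gam s1 - gam d)%R].
exists (ext N gam cs).
have e0 := ext_ge0 N gam cs; have e1 := ext_ge N gam cs; have ag := @agree_ext N gam cs.
move: (ext _ _ _) e0 e1 ag => gam' e0 e1 ag.
have := fN; rewrite /D fresh_mkX fresh_mkX => /and5P[la ls1 la' ls2 /and5P[_ lb lc ld fC]].
split=> //.
have fD' : fresh (N + 5) D'.
  by rewrite /D' !fresh_mkX (fresh_le _ fC) ?leq_addr //; lia.
split=> //; move: zD; rewrite /D /D' /= !zc_mkX !e0 !e1 !ag //= (zc_agree ag fC).
by case: u {D D' fN gD gD' eD' fD' e0 e1} => /=; lia.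
Qed.

Arguments mkX : simpl never.
Arguments zcolored : simpl never.
Arguments spread : simpl never.

Ltac clear_all := repeat match goal with H : _ |- _ => clear H end.

(** * Making the differences equal *)

Definition bounded B gam C := count (fun x => B < spread gam x) C = 0.
Definition extremal_count B gam C := count (fun x => spread gam x == B) C.

(** The last clause keeps the coloring non-trivial, so that reductions can be repeated. *)
Definition reduces B gam C := exists C' gam',
  [/\ good C', lequiv C C', all (zcolored gam') C' &
  [/\ bounded B gam' C', extremal_count B gam' C' < extremal_count B gam C & has (fun x => 0 < spread gam' x) C']].

Lemma reduces_via B gam C gam' C' : lequiv C C' -> extremal_count B gam' C' <= extremal_count B gam C ->
  reduces B gam' C' -> reduces B gam C.
Proof.
move=> e le [C2 [gam2 [g2 e2 z2 [b2 c2 h2]]]]; exists C2, gam2; split=> //.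
  exact: lequiv_trans e e2.
by split=> //; apply: leq_trans c2 le.
Qed.

Lemma rotinv_df gam (Q : pred nat) : rotinv (fun x => Q (spread gam x)).
Proof. by move=> x; rewrite df_rot. Qed.

Lemma bounded_eqv B gam C C' : same_up_to_rot C C' -> bounded B gam C -> bounded B gam C'.
Proof. by move=> h; rewrite /bounded -(h _ (rotinv_df gam (fun n => B < n))). Qed.

Lemma cntB_eqv B gam C C' : same_up_to_rot C C' -> extremal_count B gam C = extremal_count B gam C'.
Proof. by move=> h; rewrite /extremal_count (h _ (rotinv_df gam (pred1 B))). Qed.

Lemma count0_lt B gam (A : seq crossing) : all (fun x => spread gam x < B) A ->
  bounded B gam A /\ extremal_count B gam A = 0.
Proof.
rewrite /bounded /extremal_count => /allP h; split; apply/eqP; rewrite -leqn0 leqNgt -has_count;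
  apply/negP=> /hasP[x /h]; lia.
Qed.

Lemma reduces_intro B N gam gam' A C A' :
  fresh N C -> agree N gam gam' -> good (A' ++ C) -> lequiv (A ++ C) (A' ++ C) ->
  all (zcolored gam') (A' ++ C) -> bounded B gam (A ++ C) -> has (fun x => spread gam x == B) A ->
  all (fun x => spread gam' x < B) A' -> has (fun x => 0 < spread gam' x) A' ->
  reduces B gam (A ++ C).
Proof.
move=> fC ag g e z; rewrite /bounded count_cat => b hB /count0_lt[b' c'] h.
have t1 := df_agree (fun n => B < n) ag fC; have t2 := df_agree (fun n => n == B) ag fC.
exists (A' ++ C), gam'; split=> //; split.
- by rewrite /bounded count_cat t1; move: b b'; rewrite /bounded; lia.
- rewrite /extremal_count !count_cat t2 -/(extremal_count B gam' A') c' -[X in X < _]add0n ltn_add2r.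
  by rewrite -has_count.
- by rewrite has_cat h.
Qed.

Definition sgn_same (x y : int) := ((0 < x) && (0 < y) || (x < 0) && (y < 0))%R.

(** Take the color of [f] as origin, with [g] at s and [h] at b, where 0 < s < b up to a common
    sign. After [g] is pushed over [h] and the over-strand of the extremal crossing is slid across a
    crossing so created, only the differences s, b - s and |b - 2 s| occur, all smaller than b. With
    opposite signs the first push would produce b + s. *)
Lemma reduce_over_next B N gam f x1 x2 g h y1 y2 C :
  let D := [:: mkX true f x1 x2 g, mkX false f h y1 y2 & C] in
  fresh N D -> good D -> all (zcolored gam) D -> bounded B gam D ->
  0 < spread gam (mkX true f x1 x2 g) < B -> spread gam (mkX false f h y1 y2) = B ->
  sgn_same (gam g - gam f)%R (gam h - gam f)%R -> reduces B gam D.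
Proof.
move=> D fN gD zD bD.
rewrite !df_mkX /sgn_same => dS dB sg.
have := zD; rewrite /= !zc_mkX => /and3P[zx zy zC].
have gh : gam g != gam h by lia.
have [gam1 [[g1 e1 z1 f1] ag1 [c0 c1 c2 c3]]] := col_near true gh fN gD zD.
rewrite /= in c2 c3.
set Yt := mkX (~~ true) (N + 2) (N + 1) N (N + 3) in g1 e1 z1 f1.
set Yb := mkX (~~ true) (N + 2) (N + 3) g h in g1 e1 z1 f1.
set x' := mkX true f x1 x2 N in g1 e1 z1 f1.
set D2 := [:: mkX true (N + 1) y1 y2 f, mkX true (N + 1) N (N + 3) (N + 2), Yb, x' & C].
have p : perm_eq [:: Yt, Yb, x', mkX false f (N + 1) y1 y2 & C] D2.
  by apply/seq.permP => q; rewrite /D2 /Yt /Yb /x' /mkX /=; blia.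
have [g2 e2] := iso_perm p g1.
have f2 : fresh (N + 4) D2 by rewrite -(fresh_perm _ (perm_labs p)).
have z2 : all (zcolored gam1) D2 by rewrite -(perm_all _ p).
have := fN; rewrite /D fresh_mkX fresh_mkX => /and5P[lf lx1 lx2 lg /and5P[_ lh ly1 ly2 fC]].
have fn : f != N by rewrite ltn_eqF.
have [gam2 [[g3 e3 z3 f3] ag2 [d0 d1 d2 d3 d4]]] := col_slide fn f2 g2 z2.
have ag l : l < N -> gam2 l = gam l by move=> lN; rewrite ag2 ?ag1 // ltn_addr.
have k0 : gam2 N = gam g by rewrite ag2 // -addn1 leq_add2l.
have k1 : gam2 (N + 1) = gam h by rewrite ag2 ?ltn_add2l.
have k2 : gam2 (N + 2) = gam g by rewrite ag2 ?ltn_add2l.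
have k3 : gam2 (N + 3) = (gam g + gam g - gam h)%R by rewrite ag2 ?ltn_add2l.
rewrite !(ag1 y1) // ?c0 ?c2 ?c3 in d0 d1 d2 d3 d4.
apply: (reduces_intro (A := [:: _; _]) (A' := [:: _; _; _; _; _; _]) fC ag g3 _ z3 bD).
- exact: lequiv_trans e1 (lequiv_trans e2 e3).
- by rewrite /= !df_mkX dB eqxx orbT.
{ rewrite /Yb /x' /= !df_mkX ?d0 ?d1 ?d2 ?d3 ?d4 ?k0 ?k1 ?k2 ?k3 !ag //.
  move: zx zy dS dB sg; clear_all => zx zy dS dB sg; repeat (apply/andP; split); try lia. }
{ rewrite /Yb /x' /= !df_mkX ?d0 ?d1 ?d2 ?d3 ?d4 ?k0 ?k1 ?k2 ?k3 !ag //.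
  by case/andP: dS => -> _; rewrite !orbT. }
Qed.

(** The mirror case. The other under-edge [y2] of the extremal crossing takes the role of [h], and
    its strand is pushed under the over-strand of the small crossing. *)
Lemma reduce_over_prev B N gam f x1 x2 g h y1 y2 C :
  let D := [:: mkX false f h y1 y2, mkX true f x1 x2 g & C] in
  fresh N D -> good D -> all (zcolored gam) D -> bounded B gam D ->
  0 < spread gam (mkX true f x1 x2 g) < B -> spread gam (mkX false f h y1 y2) = B ->
  sgn_same (gam g - gam f)%R (gam y2 - gam f)%R -> reduces B gam D.
Proof.
move=> D fN gD zD bD.
rewrite !df_mkX /sgn_same => dS dB sg.
have := zD; rewrite /= !zc_mkX => /and3P[zy zx zC].
have gh : gam y2 != gam x1 by move: zx zy dS dB sg; clear_all; lia.
have [gam1 [[g1 e1 z1 f1] ag1 [c0 c1 c2 c3]]] := col_near false gh fN gD zD.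
rewrite /= in c2 c3.
set Yt := mkX (~~ false) (N + 2) (N + 1) N (N + 3) in g1 e1 z1 f1.
set Yb := mkX (~~ false) (N + 2) (N + 3) y2 x1 in g1 e1 z1 f1.
set x' := mkX true f (N + 1) x2 g in g1 e1 z1 f1.
set D2 := [:: mkX true N f h y1, mkX true N (N + 3) (N + 2) (N + 1), Yb, x' & C].
have p : perm_eq [:: Yt, Yb, mkX false f h y1 N, x' & C] [:: mkX false f h y1 N, Yt, Yb, x' & C].
  by apply/seq.permP => q; rewrite /Yt /Yb /x' /mkX /=; blia.
have lk : like [:: Yt, Yb, mkX false f h y1 N, x' & C] D2.
  apply: like_trans (like_perm p) _.
  apply: like_trans (like_rot [::] (mkX false f h y1 N) _) _.
  exact: (like_rot [:: mkX true N f h y1] Yt).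
have [i2 v2] := lk; have [g2 e2] := i2 g1.
have f2 : fresh (N + 4) D2.
  by apply/allP => l; rewrite -(labs_mem_eqv _ v2) => /(allP f1).
have z2 : all (zcolored gam1) D2 by rewrite -(eqv_all (zc_rot gam1) v2).
have := fN; rewrite /D fresh_mkX fresh_mkX => /and5P[lf lh ly1 ly2 /and5P[_ lx1 lx2 lg fC]].
have fn : y1 != N + 3 by rewrite ltn_eqF // ltn_addr.
have [gam2 [[g3 e3 z3 f3] ag2 [d0 d1 d2 d3 d4]]] := col_slide fn f2 g2 z2.
have ag l : l < N -> gam2 l = gam l by move=> lN; rewrite ag2 ?ag1 // ltn_addr.
have k0 : gam2 N = gam y2 by rewrite ag2 // -addn1 leq_add2l.
have k1 : gam2 (N + 1) = gam x1 by rewrite ag2 ?ltn_add2l.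
have k2 : gam2 (N + 2) = (gam x1 + gam x1 - gam y2)%R by rewrite ag2 ?ltn_add2l.
have k3 : gam2 (N + 3) = gam x1 by rewrite ag2 ?ltn_add2l.
rewrite !(ag1 f) // ?c1 ?c2 ?c3 in d0 d1 d2 d3 d4.
apply: (reduces_intro (A := [:: _; _]) (A' := [:: _; _; _; _; _; _]) fC ag g3 _ z3 bD).
- exact: lequiv_trans e1 (lequiv_trans e2 e3).
- by rewrite /= !df_mkX dB eqxx.
{ rewrite /Yb /x' /= !df_mkX ?d0 ?d1 ?d2 ?d3 ?d4 ?k0 ?k1 ?k2 ?k3 !ag //.
  move: zx zy dS dB sg; clear_all => zx zy dS dB sg; repeat (apply/andP; split); try lia. }
{ rewrite /Yb /x' /= !df_mkX ?d0 ?d1 ?d2 ?d3 ?d4 ?k0 ?k1 ?k2 ?k3 !ag //.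
  by case/andP: dS => -> _; rewrite !orbT. }
Qed.

(** Here [f] passes under at both crossings. With [f] at 0 and the over-strands at s and b, the
    strand at b is slid across the other crossing, and the differences become s, b - s and |b - 2
    s|. *)
Lemma reduce_under B N gam f x1 x2 g h y1 y2 C :
  let D := [:: mkX true f h y1 y2, mkX true f x1 x2 g & C] in
  fresh N D -> good D -> all (zcolored gam) D -> bounded B gam D ->
  0 < spread gam (mkX true f x1 x2 g) < B -> spread gam (mkX true f h y1 y2) = B ->
  sgn_same (gam g - gam f)%R (gam h - gam f)%R -> reduces B gam D.
Proof.
move=> D fN gD zD bD.
rewrite !df_mkX /sgn_same => dS dB sg.
have := zD; rewrite /= !zc_mkX => /and3P[zy zx zC].
have fn : y2 != x1.
  by apply/eqP => E; rewrite -E in zx; move: zx zy dS dB; clear_all; lia.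
have := fN; rewrite /D fresh_mkX fresh_mkX => /and5P[lf lh ly1 ly2 /and5P[_ lx1 lx2 lg fC]].
have [gam2 [[g3 e3 z3 f3] ag [d0 d1 d2 d3 d4]]] := col_slide fn fN gD zD.
apply: (reduces_intro (A := [:: _; _]) (A' := [:: _; _; _; _]) fC ag g3 _ z3 bD).
- exact: e3.
- by rewrite /= !df_mkX dB eqxx.
{ rewrite /= !df_mkX ?d0 ?d1 ?d2 ?d3 ?d4 !ag //.
  move: zx zy dS dB sg; clear_all => zx zy dS dB sg; repeat (apply/andP; split); try lia. }
{ rewrite /= !df_mkX ?d0 ?d1 ?d2 ?d3 ?d4 !ag //.
  move: zx zy dS dB sg; clear_all => zx zy dS dB sg.
  by apply/orP; left; lia. }
Qed.

(* The over-strand [f] of a crossing is pushed by one of its under-strands, so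
   that [f] becomes the under-strand of a new adjacent crossing. *)
Lemma over_to_under B N gam f x1 x2 g y C (side : bool) :
  let D := [:: mkX false f x1 x2 g, y & C] in
  fresh N D -> good D -> all (zcolored gam) D -> bounded B gam D ->
  0 < spread gam (mkX false f x1 x2 g) < B ->
  exists gam' C' o1 o2 o3, let D' := [:: mkX true f o1 o2 o3, y & C'] in
  [/\ [/\ good D', lequiv D D', all (zcolored gam') D' & fresh (N + 4) D'],
      bounded B gam' D' /\ extremal_count B gam' D' <= extremal_count B gam D, agree N gam gam',
      gam' o3 = if side then gam g else gam x1 &
      spread gam' (mkX true f o1 o2 o3) = spread gam (mkX false f x1 x2 g)].
Proof.
move=> D fN gD zD bD; rewrite df_mkX => dS.
have := zD; rewrite /= zc_mkX => /and3P[zx zy zC].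
have := fN; rewrite /D fresh_mkX => /and5P[lf lx1 lx2 lg fyC].
have ygam gam1 : agree N gam gam1 -> spread gam1 y = spread gam y /\ (bounded B gam1 C <-> bounded B gam C) /\
    extremal_count B gam1 C = extremal_count B gam C.
  move=> ag; have [fy fC] : fresh N [:: y] /\ fresh N C.
    by move: fyC; rewrite /fresh /labs /= cats0 all_cat => /andP[].
  split; first by apply: df_eq => l ly; apply: ag; apply: (fresh_cl fyC) ly; rewrite mem_head.
  rewrite /bounded /extremal_count (df_agree (fun n => B < n) ag fC); split=> //.
  exact: (df_agree (fun n => n == B) ag fC).
have fin gam1 (v1 v2 v3 : crossing) : agree N gam gam1 ->
    spread gam1 v1 < B -> spread gam1 v2 < B -> spread gam1 v3 < B ->
    bounded B gam1 [:: v2, y, v1, v3 & C] /\ extremal_count B gam1 [:: v2, y, v1, v3 & C] <= extremal_count B gam D.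
  move=> /ygam[E1 [E2 E3]] h1 h2 h3; move: bD; rewrite /D.
  have cnt2 gm z C1 : (bounded B gm (z :: C1) <-> (spread gm z <= B) /\ bounded B gm C1) /\
     extremal_count B gm (z :: C1) = (spread gm z == B) + extremal_count B gm C1.
    by rewrite /bounded /extremal_count /=; lia.
  move=> /(cnt2 _ _ _).1[_ /(cnt2 _ _ _).1[by_ bC]].
  rewrite !(cnt2 _ _ _).2 E3 E1; split.
    by do 4! (apply/(cnt2 _ _ _).1; split; [by rewrite ?E1 // ltnW|]); apply/E2.
  by rewrite (ltn_eqF h1) (ltn_eqF h2) (ltn_eqF h3) !add0n leq_addl.
have go gam1 v1 v2 v3 : [/\ good [:: v1, v2, v3, y & C], lequiv D [:: v1, v2, v3, y & C],
    all (zcolored gam1) [:: v1, v2, v3, y & C] & fresh (N + 4) [:: v1, v2, v3, y & C]] ->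
    let D1 := [:: rotX v2, y, v1, v3 & C] in
    [/\ good D1, lequiv D D1, all (zcolored gam1) D1 & fresh (N + 4) D1].
  move=> [g1 e1 z1 f1].
  have p : perm_eq [:: v1, v2, v3, y & C] [:: v2, y, v1, v3 & C].
    by clear; apply/seq.permP => q /=; blia.
  have [i2 v] : like [:: v1, v2, v3, y & C] [:: rotX v2, y, v1, v3 & C].
    exact: like_trans (like_perm p) (like_rot [::] _ _).
  have [g2 e2] := i2 g1; split=> //; first exact: lequiv_trans e1 e2.
    by rewrite -(eqv_all (zc_rot gam1) v).
  by apply/allP => l; rewrite -(labs_mem_eqv _ v) => /(allP f1).
case: side.
  have gf : gam g != gam f by move: zx dS; clear_all; lia.
  have [gam1 [H ag [c0 c1 c2 c3]]] := col_corner true gf fN gD zD.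
  rewrite /= in c2 c3.
  exists gam1, [:: mkX false (N + 2) (N + 1) N (N + 3), mkX false (N + 1) x1 x2 N & C], (N + 2), (N + 3), g.
  split=> //; first exact: go H.
  - apply: fin => //; rewrite ?df_rot df_mkX ?c0 ?c1 ?c2 ?c3 ?ag //; move: zx dS; clear_all; lia.
  - exact: ag.
  - by rewrite df_mkX c3 ag //; move: zx dS; clear_all; lia.
have gf : gam f != gam x1 by move: zx dS; clear_all; lia.
have [gam1 [H ag [c0 c1 c2 c3]]] := @col_corner false true N gam x1 x2 g f (y :: C) gf fN gD zD.
rewrite /= in c2 c3.
exists gam1, [:: mkX true (N + 2) (N + 1) N (N + 3), mkX true (N + 1) x2 g N & C], x1, (N + 2), (N + 3).
split=> //; first exact: go H.
- apply: fin => //; rewrite ?df_rot df_mkX ?c0 ?c1 ?c2 ?c3 ?ag //; move: zx dS; clear_all; lia.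
- by rewrite df_mkX c2 ag //; move: zx dS; clear_all; lia.
Qed.

Definition bounded_coloring B gam C := [/\ good C, all (zcolored gam) C & bounded B gam C].
Definition advances B gam C gam' C' :=
  [/\ lequiv C C', bounded_coloring B gam' C' & extremal_count B gam' C' <= extremal_count B gam C].

Lemma adv_trans B gam C gam' C' gam'' C'' :
  advances B gam C gam' C' -> advances B gam' C' gam'' C'' -> advances B gam C gam'' C''.
Proof.
by move=> [e1 _ l1] [e2 s2 l2]; split; [exact: lequiv_trans e1 e2| |exact: leq_trans l2 l1].
Qed.

Lemma adv_reduces B gam C gam' C' : advances B gam C gam' C' -> reduces B gam' C' -> reduces B gam C.
Proof. by move=> [e _ l]; apply: reduces_via. Qed.

Lemma adv_like B gam C C' : bounded_coloring B gam C -> like C C' -> advances B gam C gam C'.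
Proof.
move=> [g z b] [i v]; have [g' e'] := i g; split=> //; last by rewrite (cntB_eqv _ _ v).
by split; [|rewrite -(eqv_all (zc_rot gam) v)|exact: bounded_eqv v b].
Qed.


Lemma bounded_cat B gam A C : bounded B gam (A ++ C) <-> bounded B gam A /\ bounded B gam C.
Proof. by rewrite /bounded count_cat; lia. Qed.

Lemma adv_local B N gam gam' A A' C : fresh N C -> agree N gam gam' -> bounded_coloring B gam (A ++ C) ->
  good (A' ++ C) -> lequiv (A ++ C) (A' ++ C) -> all (zcolored gam') (A' ++ C) ->
  all (fun x => spread gam' x < B) A' -> advances B gam (A ++ C) gam' (A' ++ C).
Proof.
move=> fC ag [g z /bounded_cat[b1 b2]] g' e z' /count0_lt[b' c']; split=> //.
  split=> //; apply/bounded_cat; split=> //.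
  by rewrite /bounded (df_agree (fun n => B < n) ag fC).
by rewrite /extremal_count !count_cat (df_agree (fun n => n == B) ag fC) -/(extremal_count B gam' A') c' leq_addl.
Qed.

Lemma like_mkX A u a b c d C : like (A ++ mkX u a b c d :: C) (A ++ mkX (~~ u) b c d a :: C).
Proof.
case: u; last exact: like_perm.
apply: like_trans (like_rot A _ _) _; exact: like_perm.
Qed.

Lemma like_mkX2 A u a b c d C : like (A ++ mkX u a b c d :: C) (A ++ mkX u c d a b :: C).
Proof. by have := like_rot A (mkX u a b c d) C; rewrite rotX_mkX. Qed.


Lemma reduce_under_under B gam f x1 x2 g h y1 y2 C :
  let D := [:: mkX true f x1 x2 g, mkX true f h y1 y2 & C] in
  bounded_coloring B gam D -> 0 < spread gam (mkX true f x1 x2 g) < B -> spread gam (mkX true f h y1 y2) = B ->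
  sgn_same (gam g - gam f)%R (gam h - gam f)%R -> reduces B gam D.
Proof.
move=> D s dS dB sg.
have lk : like D [:: mkX true f h y1 y2, mkX true f x1 x2 g & C].
  by apply: like_perm; apply/seq.permP => q; rewrite /D /=; blia.
have a := adv_like s lk; apply: (adv_reduces a); case: a => _ [g1 z1 b1] _.
have [N fN] := exists_fresh [:: mkX true f h y1 y2, mkX true f x1 x2 g & C].
exact: reduce_under fN g1 z1 b1 dS dB sg.
Qed.

Lemma reduce_over_under B gam f x1 x2 g h y1 y2 C :
  let D := [:: mkX false f x1 x2 g, mkX true f h y1 y2 & C] in
  bounded_coloring B gam D -> 0 < spread gam (mkX false f x1 x2 g) < B -> spread gam (mkX true f h y1 y2) = B ->
  reduces B gam D.
Proof.
move=> D s; have [gD zD bD] := s => dS dB; have [N fN] := exists_fresh D.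
(* The under-edges [x1] and [g] have colors symmetric about that of [f], so one of the two lies on
   the same side as [h]. *)
pose side := sgn_same (gam g - gam f)%R (gam h - gam f)%R.
have [gam' [C' [o1 [o2 [o3]]]]] := over_to_under side fN gD zD bD dS.
set D' := (_ :: _); move=> [[g' e' z' f'] [b' c'] ag E3 Ed].
have := fN; rewrite /D fresh_mkX fresh_mkX => /and5P[lf lx1 lx2 lg /and5P[_ lh ly1 ly2 fC]].
apply: (reduces_via e' c'); apply: reduce_under_under => //.
- by rewrite Ed.
- by move: dB; rewrite !df_mkX !ag.
rewrite (ag f) // (ag h) // E3; move: dS dB zD; rewrite /D /= !df_mkX !zc_mkX => dS dB /and3P[zx zy _].
have E : side = sgn_same (gam g - gam f)%R (gam h - gam f)%R by [].
by move: (side) E zx zy dS dB; rewrite /sgn_same; clear_all; case=> [|]; lia.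
Qed.

Lemma reduce_from_under B gam u f x1 x2 g h y1 y2 C :
  let D := [:: mkX true f x1 x2 g, mkX u f h y1 y2 & C] in
  bounded_coloring B gam D -> 0 < spread gam (mkX true f x1 x2 g) < B -> spread gam (mkX u f h y1 y2) = B ->
  reduces B gam D.
Proof.
move=> D s; have [gD zD bD] := s => dS dB; have [N fN] := exists_fresh D.
have := fN; rewrite /D fresh_mkX fresh_mkX => /and5P[lf lx1 lx2 lg /and5P[_ lh ly1 ly2 fC]].
have gf : gam g != gam f.
  by move: dS dB zD; rewrite /D /= !df_mkX !zc_mkX => dS dB /andP[zx _]; move: zx dS; clear_all; lia.
have hf : gam h != gam f.
  move: dS dB zD; rewrite /D /= !df_mkX !zc_mkX => dS dB /and3P[_ zy _].
  by move: zy dS dB; clear; case: u; lia.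
case: u @D s gD zD bD dB fN => D s gD zD bD dB fN; last first.
  (* [h] and [y2] are the under-edges of the extremal crossing, with colors on opposite sides of
     that of [f]; one of the two mirror cases applies. *)
  case sg : (sgn_same (gam g - gam f)%R (gam h - gam f)%R).
    exact: reduce_over_next fN gD zD bD dS dB sg.
  have lk : like D [:: mkX false f h y1 y2, mkX true f x1 x2 g & C].
    by apply: like_perm; apply/seq.permP => q; rewrite /D /=; blia.
  have a := adv_like s lk; apply: (adv_reduces a); case: a => _ [g1 z1 b1] _.
  have [N1 fN1] := exists_fresh [:: mkX false f h y1 y2, mkX true f x1 x2 g & C].
  apply: (reduce_over_prev fN1 g1 z1 b1 dS dB).
  move: z1 sg; rewrite /= !zc_mkX /sgn_same => /and3P[zy _ _]; move: gf hf zy; clear_all; lia.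
case sg : (sgn_same (gam g - gam f)%R (gam h - gam f)%R).
  exact: reduce_under_under s dS dB sg.
(* The two over-strands lie on opposite sides of [f] in color. Pushing [g] under [f] in the corner
   puts a crossing with [f] on top next to the extremal one, and in that situation the side can be
   chosen. *)
have [gam1 [[g1 e1 z1 f1] ag [c0 c1 c2 c3]]] := col_corner false gf fN gD zD.
rewrite /= in c2 c3.
have fcC : fresh N (mkX true f h y1 y2 :: C) by rewrite fresh_mkX lf lh ly1 ly2 fC.
have a : advances B gam D gam1 [:: mkX (~~ false) (N + 2) (N + 1) N (N + 3), mkX (~~ false) (N + 2) (N + 3) g f,
        mkX true (N + 1) x1 x2 N, mkX true f h y1 y2 & C].
  apply: (adv_local (A := [:: _]) (A' := [:: _; _; _]) fcC ag s g1 e1 z1).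
  have {}zD : zcolored gam (mkX true f x1 x2 g) by case/andP: zD.
  rewrite /= !df_mkX ?c0 ?c1 ?c2 ?c3 !ag //; move: zD dS; rewrite zc_mkX df_mkX; clear_all => zD dS.
  by repeat (apply/andP; split); lia.
apply: (adv_reduces a); have [_ s1 _] := a.
set Yt := mkX (~~ false) (N + 2) (N + 1) N (N + 3) in s1 *.
set X' := mkX true (N + 1) x1 x2 N in s1 *.
have lk : like [:: Yt, mkX (~~ false) (N + 2) (N + 3) g f, X', mkX true f h y1 y2 & C]
    [:: mkX false f (N + 2) (N + 3) g, mkX true f h y1 y2, Yt, X' & C].
  by apply: like_perm; apply/seq.permP => q; rewrite /mkX /=; blia.
have a2 := adv_like s1 lk; apply: (adv_reduces a2); have [_ s2 _] := a2.
apply: (reduce_over_under s2); last by move: dB; rewrite !df_mkX !ag.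
move: dS zD; rewrite /D /= !df_mkX !zc_mkX c2 ag // => dS /andP[zx _].
by move: zx dS; clear_all; lia.
Qed.

Lemma reduce_adjacent B gam u1 u2 f x1 x2 g h y1 y2 C :
  let D := [:: mkX u1 f x1 x2 g, mkX u2 f h y1 y2 & C] in
  bounded_coloring B gam D -> 0 < spread gam (mkX u1 f x1 x2 g) < B -> spread gam (mkX u2 f h y1 y2) = B ->
  reduces B gam D.
Proof.
case: u1; first exact: reduce_from_under.
move=> D s; have [gD zD bD] := s => dS dB; have [N fN] := exists_fresh D.
have [gam' [C' [o1 [o2 [o3]]]]] := over_to_under true fN gD zD bD dS.
set D' := (_ :: _); move=> [[g' e' z' f'] [b' c'] ag E3 Ed].
have := fN; rewrite /D fresh_mkX fresh_mkX => /and5P[lf lx1 lx2 lg /and5P[_ lh ly1 ly2 fC]].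
apply: (reduces_via e' c'); apply: reduce_from_under => //; first by rewrite Ed.
by move: dB; rewrite !df_mkX !ag.
Qed.

Lemma mem_mkX l u a b c d : (l \in clabels (mkX u a b c d)) = (l \in [:: a; b; c; d]).
Proof. by case: u; rewrite /mkX !inE //; do !case: eqP. Qed.

(** The second crossing has a single color, so [h] has the color of [f]. Pushing [g] over [h]
    therefore creates a crossing of the same spread that sits on the edge [h]. *)
Lemma transfer_next B N gam u1 u2 f x1 x2 g h y1 y2 C :
  let D := [:: mkX u1 f x1 x2 g, mkX u2 f h y1 y2 & C] in
  fresh N D -> bounded_coloring B gam D -> 0 < spread gam (mkX u1 f x1 x2 g) < B -> spread gam (mkX u2 f h y1 y2) = 0 ->
  exists gam', let D' := [:: mkX true (N + 1) N (N + 3) (N + 2), mkX true h (N + 2) (N + 3) g,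
      mkX u1 f x1 x2 N, mkX u2 f (N + 1) y1 y2 & C] in
  [/\ advances B gam D gam' D', fresh (N + 4) D', agree N gam gam' &
   [/\ spread gam' (mkX true (N + 1) N (N + 3) (N + 2)) = spread gam (mkX u1 f x1 x2 g),
       spread gam' (mkX true h (N + 2) (N + 3) g) = spread gam (mkX u1 f x1 x2 g) &
       spread gam' (mkX u2 f (N + 1) y1 y2) = 0]].
Proof.
move=> D fN s; have [gD zD bD] := s => dS dB.
have := fN; rewrite /D fresh_mkX fresh_mkX => /and5P[lf lx1 lx2 lg /and5P[_ lh ly1 ly2 fC]].
have := zD; rewrite /D /= !zc_mkX => /and3P[zx zy _].
have dS' := dS; have dB' := dB; rewrite !df_mkX in dS' dB'.
have [gh hf] : gam g != gam h /\ gam h = gam f.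
  by move: zx zy dS' dB'; clear; case: u1; case: u2; split; lia.
have [gam' [[g1 e1 z1 f1] ag [c0 c1 c2 c3]]] := col_near true gh fN gD zD.
rewrite /= in c2 c3; set Yt := mkX _ _ _ _ _ in g1 e1 z1 f1.
set Yb := mkX _ _ _ _ _ in g1 e1 z1 f1.
exists gam'.
have dYt : spread gam' Yt = spread gam (mkX u1 f x1 x2 g).
  by rewrite !df_mkX c1 c3; move: hf zx zy dS' dB'; clear; case: u1; case: u2 => /=; lia.
have dYb : spread gam' Yb = spread gam (mkX u1 f x1 x2 g).
  by rewrite !df_mkX c3 (ag h) //; move: hf zx zy dS' dB'; clear; case: u1; case: u2 => /=; lia.
have dx' : spread gam' (mkX u1 f x1 x2 N) = spread gam (mkX u1 f x1 x2 g).
  by rewrite !df_mkX c0 !ag.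
have dy' : spread gam' (mkX u2 f (N + 1) y1 y2) = 0.
  by move: dB; rewrite !df_mkX c1 !ag.
have a1 : advances B gam D gam' [:: Yt, Yb, mkX u1 f x1 x2 N, mkX u2 f (N + 1) y1 y2 & C].
  apply: (adv_local (A := [:: _; _]) (A' := [:: _; _; _; _]) fC ag s g1 e1 z1).
  rewrite /= dYt dYb dx' dy'; move: dS; clear; lia.
have l2 : like [:: Yt, Yb, mkX u1 f x1 x2 N, mkX u2 f (N + 1) y1 y2 & C]
   [:: Yt, mkX true h (N + 2) (N + 3) g, mkX u1 f x1 x2 N, mkX u2 f (N + 1) y1 y2 & C].
  exact: (like_rot [:: Yt] Yb).
have [_ s1 _] := a1.
split; last first.
- by split=> //; rewrite -dYb -(df_rot _ Yb).
- exact: ag.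
- by apply/allP => l; rewrite -(labs_mem_eqv _ l2.2) => /(allP f1).
exact: adv_trans a1 (adv_like s1 l2).
Qed.

Lemma transfer_prev B N gam u1 u2 f x1 x2 g h y1 y2 C :
  let D := [:: mkX u1 f x1 x2 g, mkX u2 f h y1 y2 & C] in
  fresh N D -> bounded_coloring B gam D -> spread gam (mkX u1 f x1 x2 g) = 0 -> 0 < spread gam (mkX u2 f h y1 y2) < B ->
  exists gam' A, let z := mkX true (N + 2) (N + 3) g h in
  [/\ advances B gam D gam' (z :: A ++ C), agree N gam gam' & spread gam' z = spread gam (mkX u2 f h y1 y2)].
Proof.
move=> D fN s; have [gD zD bD] := s => dB dS.
have := fN; rewrite /D fresh_mkX fresh_mkX => /and5P[lf lx1 lx2 lg /and5P[_ lh ly1 ly2 fC]].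
have := zD; rewrite /D /= !zc_mkX => /and3P[zx zy _].
have dS' := dS; have dB' := dB; rewrite !df_mkX in dS' dB'.
have [gh hf] : gam g != gam h /\ gam g = gam f.
  by move: zx zy dS' dB'; clear; case: u1; case: u2; split; lia.
have [gam' [[g1 e1 z1 f1] ag [c0 c1 c2 c3]]] := col_near false gh fN gD zD.
rewrite /= in c2 c3; set Yt := mkX _ _ _ _ _ in g1 e1 z1 f1.
set Yb := mkX _ _ _ _ _ in g1 e1 z1 f1.
have dYt : spread gam' Yt = spread gam (mkX u2 f h y1 y2).
  by rewrite !df_mkX c0 c2; move: hf zx zy dS' dB'; clear; case: u1; case: u2 => /=; lia.
have dYb : spread gam' Yb = spread gam (mkX u2 f h y1 y2).
  by rewrite !df_mkX c2 (ag g) //; move: hf zx zy dS' dB'; clear; case: u1; case: u2 => /=; lia.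
have dx' : spread gam' (mkX u1 f x1 x2 N) = 0.
  by move: dB; rewrite !df_mkX c0 !ag.
have dy' : spread gam' (mkX u2 f (N + 1) y1 y2) = spread gam (mkX u2 f h y1 y2).
  by rewrite !df_mkX c1 !ag.
have a1 : advances B gam D gam' [:: Yt, Yb, mkX u1 f x1 x2 N, mkX u2 f (N + 1) y1 y2 & C].
  apply: (adv_local (A := [:: _; _]) (A' := [:: _; _; _; _]) fC ag s g1 e1 z1).
  rewrite /= dYt dYb dx' dy'; move: dS; clear; lia.
have l2 : like [:: Yt, Yb, mkX u1 f x1 x2 N, mkX u2 f (N + 1) y1 y2 & C]
   [:: Yb, Yt, mkX u1 f x1 x2 N, mkX u2 f (N + 1) y1 y2 & C].
  by apply: like_perm; apply/seq.permP => q; rewrite /=; blia.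
have [_ s1 _] := a1.
exists gam', [:: Yt; mkX u1 f x1 x2 N; mkX u2 f (N + 1) y1 y2]; split; [|exact: ag|exact: dYb].
exact: adv_trans a1 (adv_like s1 l2).
Qed.

Lemma agree_trans N N' gam gam' gam'' : N <= N' -> agree N gam gam' -> agree N' gam' gam'' ->
  agree N gam gam''.
Proof. by move=> le a a' l lN; rewrite a' ?a //; apply: leq_trans lN le. Qed.

(** From [f], the three other edges of the one-colored crossing are reached by one step forward, by
    two steps forward, or by one step backward. *)
Lemma transfer_across B gam x y f f' C : bounded_coloring B gam [:: x, y & C] -> 0 < spread gam x < B -> spread gam y = 0 ->
  f \in clabels x -> f \in clabels y -> f' \in clabels y -> f' != f ->
  exists gam' z A, [/\ advances B gam [:: x, y & C] gam' (z :: A ++ C), f' \in clabels z,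
    spread gam' z = spread gam x & {in C, spread gam' =1 spread gam}].
Proof.
move=> s dx dy fx fy f'y ff'.
have [u1 [x1 [x2 [g [u2 [h [y1 [y2 [lk Ex Ey]]]]]]]]] := @pull2 [:: x, y & C] x y f C (perm_refl _) fx fy.
have {}Ex : spread gam (mkX u1 f x1 x2 g) = spread gam x.
  by have := Ex _ (rotinv_df gam (pred1 (spread gam x))); rewrite /= eqxx => /eqP.
have dy' : spread gam (mkX u2 f h y1 y2) = 0.
  by have := Ey _ (rotinv_df gam (pred1 0)); rewrite /= dy => /eqP.
have : f' \in [:: f; h; y1; y2].
  rewrite -(mem_mkX _ u2) (Ey (fun x => f' \in clabels x)) //.
  by case=> [[[a b] c] d]; rewrite /= !inE; lia.
have a0 := adv_like s lk; have [_ s0 _] := a0.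
have [N fN] := exists_fresh [:: mkX u1 f x1 x2 g, mkX u2 f h y1 y2 & C].
rewrite -Ex in dx *.
have fC : fresh N C by move: fN; rewrite !fresh_mkX => /and5P[_ _ _ _ /and5P[_ _ _ _ ]].
have agC gam' : agree N gam gam' -> {in C, spread gam' =1 spread gam}.
  move=> ag y0 yC; apply: df_eq => l ly; apply: ag; exact: fresh_cl fC yC ly.
rewrite !inE (negPf ff') /= => /or3P[]/eqP ->.
- have [gam' [a1 f1 ag [d1 d2 d3]]] := transfer_next fN s0 dx dy'.
  set z := mkX true h _ _ _ in a1 d2.
  exists gam', z, [:: mkX true (N + 1) N (N + 3) (N + 2); mkX u1 f x1 x2 N; mkX u2 f (N + 1) y1 y2].
  split; [| by rewrite mem_mkX mem_head | exact: d2 | exact: agC].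
  have [_ s1 _] := a1; apply: adv_trans (adv_trans a0 a1) (adv_like s1 _).
  by apply: like_perm; apply/seq.permP => q; rewrite /=; blia.
- have [gam1 [a1 f1 ag [d1 d2 d3]]] := transfer_next fN s0 dx dy'.
  set D1 := (_ :: _) in f1; rewrite /= -/D1 in a1.
  set Yt := mkX true (N + 1) _ _ _ in d1; set X' := mkX u1 f x1 x2 N in D1 a1 f1 *.
  set Yb := mkX true h _ _ _ in D1 a1 f1.
  set D2 := [:: Yt, mkX (~~ u2) (N + 1) y1 y2 f, Yb, X' & C].
  have l2 : like D1 D2.
    apply: (like_trans (C' := [:: Yt, mkX u2 f (N + 1) y1 y2, Yb, X' & C])).
      by apply: like_perm; apply/seq.permP => q; rewrite /D1 /Yt /Yb /X' /=; blia.
    exact: (like_mkX [:: Yt]).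
  have [_ s1 _] := a1; have a2 := adv_like s1 l2; have [_ s2 _] := a2.
  have f2 : fresh (N + 4) D2.
    by apply/allP => l; rewrite -(labs_mem_eqv _ l2.2) => /(allP f1).
  have dy2 : spread gam1 (mkX (~~ u2) (N + 1) y1 y2 f) = 0.
    move: d3; have [_ zz _] := s2; move: zz; rewrite /= !zc_mkX !df_mkX => /and3P[_ zz _].
    by move: zz; clear; case: u2 => /=; lia.
  rewrite -d1 in dx.
  have [gam2 [a3 f3 ag2 [_ d5 _]]] := transfer_next f2 s2 dx dy2.
  set z := mkX true y1 _ _ _ in a3 d5; pose w1 := mkX true (N + 4 + 1) (N + 4) (N + 4 + 3) (N + 4 + 2).
  pose w2 := mkX true (N + 1) N (N + 3) (N + 4); pose w3 := mkX (~~ u2) (N + 1) (N + 4 + 1) y2 f.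
  have ag3 := agree_trans (leq_addr 4 N) ag ag2.
  exists gam2, z, [:: w1; w2; w3; Yb; X'];
    split; [| by rewrite mem_mkX mem_head | by rewrite d5 | exact: agC].
    have [_ s3 _] := a3; apply: adv_trans (adv_trans a0 (adv_trans a1 (adv_trans a2 a3))) (adv_like s3 _).
  by apply: like_perm; apply/seq.permP => q; rewrite /w1 /w2 /w3 /=; blia.
- have l2 : like [:: mkX u1 f x1 x2 g, mkX u2 f h y1 y2 & C] [:: mkX u2 f h y1 y2, mkX u1 f x1 x2 g & C].
    by apply: like_perm; apply/seq.permP => q; rewrite /=; blia.
  have a2 := adv_like s0 l2; have [_ s2 _] := a2.
  have f2 : fresh N [:: mkX u2 f h y1 y2, mkX u1 f x1 x2 g & C].
    by apply/allP => l; rewrite -(labs_mem_eqv _ l2.2) => /(allP fN).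
  have [gam' [A [a3 ag d3]]] := transfer_prev f2 s2 dy' dx.
  exists gam', (mkX true (N + 2) (N + 3) y2 x1), A; split; [|by rewrite mem_mkX !inE eqxx !orbT|exact: d3|exact: agC].
  exact: adv_trans a0 (adv_trans a2 a3).
Qed.

Definition share_label (x y : crossing) := has (mem (clabels y)) (clabels x).

Lemma shP x y : reflect (exists2 l, l \in clabels x & l \in clabels y) (share_label x y).
Proof. exact: hasP. Qed.

Lemma reduces_final B gam x c f C : bounded_coloring B gam [:: x, c & C] -> 0 < spread gam x < B -> spread gam c = B ->
  f \in clabels x -> f \in clabels c -> reduces B gam [:: x, c & C].
Proof.
move=> s dx dc fx fc.
have [u1 [x1 [x2 [g [u2 [h [y1 [y2 [lk Ex Ey]]]]]]]]] := @pull2 [:: x, c & C] x c f C (perm_refl _) fx fc.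
have {}Ex : spread gam (mkX u1 f x1 x2 g) = spread gam x.
  by have := Ex _ (rotinv_df gam (pred1 (spread gam x))); rewrite /= eqxx => /eqP.
have {}Ey : spread gam (mkX u2 f h y1 y2) = spread gam c.
  by have := Ey _ (rotinv_df gam (pred1 (spread gam c))); rewrite /= eqxx => /eqP.
have a := adv_like s lk; apply: (adv_reduces a); have [_ s1 _] := a.
by apply: (reduce_adjacent s1); rewrite ?Ex ?Ey.
Qed.

(** Each transfer moves the small crossing one place along the path. If the path leaves a crossing
    by the edge through which it came, that crossing is skipped. *)
Lemma propagate B p : forall gam x C c, bounded_coloring B gam (x :: C) -> 0 < spread gam x < B ->
  path share_label x (rcons p c) -> uniq (rcons p c) -> {subset rcons p c <= C} ->
  all (fun y => spread gam y == 0) p -> spread gam c = B -> reduces B gam (x :: C).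
Proof.
elim: p => [|y p IH] gam x C c s dx.
  rewrite /= andbT => /shP[f fx fc] _ sub _ dc.
  have cC : c \in C by apply: sub; rewrite mem_head.
  have lk : like (x :: C) [:: x, c & rem c C].
    by apply: like_perm; rewrite perm_cons perm_to_rem.
  have a := adv_like s lk; apply: (adv_reduces a); have [_ s1 _] := a.
  exact: reduces_final s1 dx dc fx fc.
rewrite rcons_cons => /= /andP[/shP[f fx fy] pth] /andP[yp up] sub /andP[/eqP dy dp] dc.
have yC : y \in C by apply: sub; rewrite mem_head.
have sub' : {subset rcons p c <= rem y C}.
  move=> z zp; have zC : z \in C by apply: sub; rewrite inE zp orbT.
  by have := zC; rewrite (perm_mem (perm_to_rem yC)) inE => /orP[/eqP zy|//]; rewrite -zy zp in yp.
have lk : like (x :: C) [:: x, y & rem y C].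
  by apply: like_perm; rewrite perm_cons perm_to_rem.
have a := adv_like s lk; have [_ s1 _] := a.
case E : (rcons p c) pth up sub sub' => [|z q] pth up sub sub'; first by case: (p) E.
move: pth => /= /andP[/shP[f' f'y f'z] pth].
have [ff'|ff'] := eqVneq f' f.
  apply: (IH gam x C c) => //; rewrite E //.
    by rewrite /= pth andbT; apply/shP; exists f => //; rewrite -ff'.
  by move=> w wq; apply: sub; rewrite inE wq orbT.
have [gam' [w [A [a1 f'w dw dC]]]] := transfer_across s1 dx dy fx fy f'y ff'.
apply: (adv_reduces (adv_trans a a1)); have [_ s2 _] := a1.
apply: (IH gam' w (A ++ rem y C) c) => //; rewrite ?dw ?E //.
- by rewrite /= pth andbT; apply/shP; exists f'.
- by move=> v vq; rewrite mem_cat sub' ?orbT.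
- apply/allP=> v vp; rewrite dC; first exact: (allP dp).
  by apply: sub'; rewrite -E mem_rcons inE vp orbT.
- by rewrite dC // sub' // -E mem_rcons mem_head.
Qed.

Lemma reduces_exists B gam C : bounded_coloring B gam C -> has (fun x => 0 < spread gam x < B) C ->
  has (fun x => spread gam x == B) C -> reduces B gam C.
Proof.
move=> s /hasP[s0 s0C ds0] /hasP[c cC /eqP dc].
(* [T] holds of the edges that a small crossing can reach through one-colored crossings. In the
   absence of a reduction no crossing separates [T], so by connectedness it also holds at the
   extremal crossing [c], where a reduction exists after all. *)
pose T l := exists x p, [/\ x \in C, 0 < spread gam x < B, path share_label x p &
  [/\ {subset p <= C}, all (fun y => spread gam y == 0) p & l \in clabels (last x p)]].
case: (excluded_middle_informative (reduces B gam C)) => // nr.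
have key y l : y \in C -> l \in clabels y -> T l ->
    spread gam y != B /\ forall l', l' \in clabels y -> T l'.
  move=> yC ly [x [p [xC dx pth [sub mono lp]]]].
  have shy : share_label (last x p) y by apply/shP; exists l.
  case dy0 : (spread gam y == 0).
    split=> [|l' l'y]; first by apply: contraTneq dx => B0; move: dy0; rewrite B0; case: (B) => //; lia.
    exists x, (rcons p y); split=> //; first by rewrite rcons_path pth.
    split; last by rewrite last_rcons.
      by move=> z; rewrite mem_rcons inE => /orP[/eqP ->|/sub].
    by rewrite all_rcons dy0.
  have [_ _ bC] := s.
  have dyB : spread gam y <= B.
    rewrite leqNgt; apply/negP=> lt; have : has (fun x => B < spread gam x) C by apply/hasP; exists y.
    by rewrite has_count bC.
  have [dyE|dyE] := eqVneq (spread gam y) B; last first.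
    split=> // l' l'y; exists y, [::].
    by split=> //; rewrite lt0n dy0 ltn_neqAle dyE.
  case: nr; have yx : y != x by apply: contraTneq dx => <-; rewrite dyE ltnn andbF.
  have pth2 : path share_label x (rcons p y) by rewrite rcons_path pth.
  have : last x (rcons p y) = y by rewrite last_rcons.
  case/shortenP: pth2 => q pq uq sq; case/lastP: q pq uq sq => [|q z] pq uq sq.
    by move=> /= E; rewrite E eqxx in yx.
  rewrite last_rcons => zy; rewrite {z}zy in pq uq sq.
  have lk : like C (x :: rem x C) by apply: like_perm; exact: perm_to_rem.
  have a := adv_like s lk; apply: (adv_reduces a); have [_ s1 _] := a.
  move: uq => /= /andP[xq uq].
  apply: (propagate s1 dx pq uq _ _ dyE).
    move=> z zq; have : z \in C.
      by have := sq z zq; rewrite mem_rcons inE => /orP[/eqP ->|/sub].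
    rewrite (perm_mem (perm_to_rem xC)) inE => /orP[/eqP zx|//].
    by rewrite -zx zq in xq.
  apply/allP => z zq; have : z \in rcons p y by apply: sq; rewrite mem_rcons inE zq orbT.
  rewrite mem_rcons inE => /orP[/eqP zy|]; last exact: (allP mono).
  by move: uq; rewrite rcons_uniq -zy zq.
have [gC _ _] := s; have [_ lc _ _] := gC.
have cs : all (const_at (fun l => pbool (T l))) C.
  apply/allP => y yC; apply/cstP => l l' ly l'y.
  by apply/pboolP/pboolP => h; [apply: (key y l yC ly h).2|apply: (key y l' yC l'y h).2].
have cl0 (x : crossing) : exists l, l \in clabels x.
  by case: x => [[[a b] d] e]; exists a; rewrite mem_head.
have [l0 l0s] := cl0 s0; have [l1 l1c] := cl0 c.
have T0 : T l0 by exists s0, [::]; split.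
have : pbool (T l1).
  rewrite -(lc _ cs l0 l1); [by apply/pboolP | by apply/lab_mem; exists s0 | by apply/lab_mem; exists c].
move/pboolP => T1.
by have [] := key c l1 cC l1c T1; rewrite dc eqxx.
Qed.

(** Lexicographic induction on the bound [B] and on the number of crossings that attain it. It stops
    when every spread is 0 or equal to an attained bound. *)
Lemma simple_coloring B : forall gam C, bounded_coloring B gam C -> has (fun x => 0 < spread gam x) C ->
  exists gam' C' d, [/\ lequiv C C', good C', all (zcolored gam') C',
    all (fun x => (spread gam' x == 0) || (spread gam' x == d)) C' &
    0 < d /\ has (fun x => 0 < spread gam' x) C'].
Proof.
elim: B => [|B IHB] gam C.
  move=> [_ _ /eqP]; rewrite -leqn0 leqNgt -has_count => /negP b /hasP[x xC dx].
  by case: b; apply/hasP; exists x.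
have [n le] := ubnP (extremal_count B.+1 gam C); elim: n gam C le => // n IHn gam C le s h.
have [g z b] := s.
case hc : (has (fun x => spread gam x == B.+1) C); last first.
  apply: IHB h; split=> //; move: b hc; rewrite /bounded has_count lt0n => b /negbFE /eqP hc.
  apply/eqP; rewrite -leqn0 leqNgt -has_count; apply/hasPn => x xC.
  move/eqP: b; rewrite -leqn0 leqNgt -has_count => /hasPn/(_ x xC).
  move/eqP: hc; rewrite -leqn0 leqNgt -has_count => /hasPn/(_ x xC).
  by clear; lia.
case hs : (has (fun x => 0 < spread gam x < B.+1) C).
  have [C2 [gam2 [g2 e2 z2 [b2 c2 h2]]]] := reduces_exists s hs hc.
  have [||gam3 [C3 [d [e3 g3 z3 a3 p3]]]] := IHn gam2 C2 _ _ h2.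
  - by apply: leq_trans c2 _; rewrite -ltnS.
  - by split.
  exists gam3, C3, d; split; [|exact: g3|exact: z3|exact: a3|exact: p3].
  exact: lequiv_trans e2 e3.
exists gam, C, B.+1; split; [exact: lequiv_refl|exact: g|exact: z| |by split].
apply/allP=> x xC; move/negbT: hs => /hasPn/(_ x xC).
move/eqP: b; rewrite -leqn0 leqNgt -has_count => /hasPn/(_ x xC).
by clear; lia.
Qed.

(** Spreads are twice the differences, so d = 2 e and every difference is 0 or e. By connectedness
    all colors agree modulo e. Subtracting one of them and dividing by e leaves differences 0 and 1,
    that is, spreads at most 2. *)
Lemma unit_coloring gam C d : good C -> all (zcolored gam) C ->
  all (fun x => (spread gam x == 0) || (spread gam x == d)) C -> 0 < d -> has (fun x => 0 < spread gam x) C ->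
  exists gam', [/\ all (zcolored gam') C, all (fun x => spread gam' x <= 2) C & has (fun x => 0 < spread gam' x) C].
Proof.
move=> [_ lc _ _] z /allP sd d0 /hasP[s0 s0C ds0].
have [l0 l0C] : exists l, l \in labs C.
  move: s0C; clear; case: s0 => [[[a b] c] e] xC.
  by exists a; apply/lab_mem; exists (a, b, c, e); rewrite ?mem_head.
have [e Ed] : exists e, d = e.*2.
  exists (d./2); have := sd _ s0C; move/allP: z => /(_ _ s0C); case: s0 ds0 {s0C} => [[[a b] c] f].
  by rewrite /zcolored /spread; clear; lia.
have e0 : 0 < e by rewrite -double_gt0 -Ed.
pose P l := dvdz e%:Z (gam l - gam l0)%R.
have h1 (u v k : int) : (u - v = k * e%:Z)%R -> dvdz e%:Z (u - gam l0)%R = dvdz e%:Z (v - gam l0)%R.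
  move=> E; apply/dvdzP/dvdzP => -[q Eq]; [exists (q - k)%R|exists (q + k)%R];
    rewrite ?mulrBl ?mulrDl -E -Eq; clear; lia.
have cP : all (const_at P) C.
  apply/allP=> x xC; have := sd _ xC; move/allP: z => /(_ _ xC).
  case: x xC => [[[a b] c] f] _; rewrite /zcolored /spread /const_at /P Ed => /andP[/eqP bf /eqP E] h.
  have [k Ek] : exists k : int, (gam a - gam b = k * e%:Z)%R.
    have [|[]] : (gam a - gam b = 0 \/ gam a - gam b = e%:Z \/ gam a - gam b = - e%:Z)%R.
    - by move: E h; clear; lia.
    - by move=> ->; exists 0%R; rewrite mul0r.
    - by move=> ->; exists 1%R; rewrite mul1r.
    - by move=> ->; exists (-1)%R; rewrite mulN1r.
  rewrite (h1 _ _ _ Ek) (h1 (gam b) (gam c) k) ?bf ?eqxx ?andbT /=; last first.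
    by rewrite -bf -Ek; move: E; clear; lia.
  by rewrite -(h1 (gam b) (gam c) k) ?bf //; rewrite -bf -Ek; move: E; clear; lia.
have key l : l \in labs C -> (gam l = gam l0 + divz (gam l - gam l0) e%:Z * e%:Z)%R.
  move=> lC; have : P l by rewrite (lc P cP l l0 lC l0C) /P; apply/dvdzP; exists 0%R; rewrite subrr mul0r.
  by move/divzK => ->; clear; lia.
pose gam' l := divz (gam l - gam l0)%R e%:Z.
have key2 x : x \in C -> zcolored gam' x /\ spread gam x = spread gam' x * e.
  move=> xC; have := z; move/allP => /(_ _ xC).
  have kx l : l \in clabels x -> (gam l = gam l0 + gam' l * e%:Z)%R.
    by move=> lx; apply: key; apply/lab_mem; exists x.
  case: x {xC} kx => [[[a b] c] f] kx; rewrite /zcolored /spread.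
  rewrite (kx a) ?(kx b) ?(kx c) ?(kx f) ?inE ?eqxx ?orbT //.
  move: (gam' a) (gam' b) (gam' c) (gam' f) (gam l0) e0; clear=> a b c f g e0 /andP[/eqP E1 /eqP E2].
  have e0' : (e%:Z != 0)%R by lia.
  have E3 : b = f by apply: (mulIf e0'); apply: addrI E1.
  have E4 : (b + b = a + c)%R.
    apply: (mulIf e0'); rewrite !mulrDl; move: E2; clear; lia.
  by split; [rewrite E3 -E4 -E3 !eqxx|have -> : (g + a * e%:Z - (g + c * e%:Z) = (a - c) * e%:Z)%R
    by rewrite mulrBl; clear; lia]; rewrite ?abszM.
exists gam'; split.
- by apply/allP => x /key2[].
- apply/allP => x xC; have := sd _ xC; have [_ ->] := key2 _ xC; rewrite Ed.
  rewrite muln_eq0 -mul2n eqn_pmul2r //; move: e0; clear; lia.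
- by apply/hasP; exists s0 => //; have [_ E] := key2 _ s0C; move: ds0; rewrite E muln_gt0 => /andP[].
Qed.

(** * Removing the extreme color *)

Definition unit_coloring_at (m M : int) gam x :=
  [&& zcolored gam x, spread gam x <= 2 & all (fun l => (m <= gam l <= M)%R) (clabels x)].
Definition monochrome (M : int) (gam : nat -> int) x := all (fun l => gam l == M) (clabels x).
Definition touches (M : int) (gam : nat -> int) x := has (fun l => gam l == M) (clabels x).

Definition unit_coloring_in m M gam C := [/\ good C, all (unit_coloring_at m M gam) C & has (fun x => 0 < spread gam x) C].

Lemma rot_labs (Q : pred nat) x : perm_eq (clabels (rotX x)) (clabels x).
Proof. by case: x => [[[a b] c] d]; apply/seq.permP => q /=; blia. Qed.

Lemma okx_rot m M gam : rotinv (unit_coloring_at m M gam).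
Proof. by move=> x; rewrite /unit_coloring_at zc_rot df_rot (perm_all _ (rot_labs predT x)). Qed.
Lemma colX_rot M gam : rotinv (monochrome M gam).
Proof. by move=> x; rewrite /monochrome (perm_all _ (rot_labs predT x)). Qed.
Lemma hasX_rot M gam : rotinv (touches M gam).
Proof. by move=> x; rewrite /touches (perm_has _ (rot_labs predT x)). Qed.

Lemma mkX_labs u a b c d : perm_eq (clabels (mkX u a b c d)) [:: a; b; c; d].
Proof. by case: u; apply/seq.permP => q; rewrite /mkX /=; blia. Qed.

Lemma okx_mkX m M gam u a b c d : unit_coloring_at m M gam (mkX u a b c d) =
  [&& zcolored gam (mkX u a b c d), spread gam (mkX u a b c d) <= 2,
   (m <= gam a <= M)%R, (m <= gam b <= M)%R, (m <= gam c <= M)%R & (m <= gam d <= M)%R].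
Proof. by rewrite /unit_coloring_at (perm_all _ (mkX_labs u a b c d)) /= andbT. Qed.
Lemma colX_mkX M gam u a b c d : monochrome M gam (mkX u a b c d) =
  [&& gam a == M, gam b == M, gam c == M & gam d == M].
Proof. by rewrite /monochrome (perm_all _ (mkX_labs u a b c d)) /= andbT. Qed.
Lemma hasX_mkX M gam u a b c d : touches M gam (mkX u a b c d) =
  [|| gam a == M, gam b == M, gam c == M | gam d == M].
Proof. by rewrite /touches (perm_has _ (mkX_labs u a b c d)) /= orbF. Qed.

Lemma agree_all m M N gam gam' C : agree N gam gam' -> fresh N C ->
  [/\ all (unit_coloring_at m M gam') C = all (unit_coloring_at m M gam) C, count (monochrome M gam') C = count (monochrome M gam) C &
  count (touches M gam') C = count (touches M gam) C].
Proof.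
move=> ag fC; have h x l : x \in C -> l \in clabels x -> gam' l = gam l.
  by move=> xC lx; apply: ag; apply: fresh_cl fC xC lx.
split; [apply: eq_in_all|apply: eq_in_count|apply: eq_in_count] => x xC.
- have E : {in clabels x, gam' =1 gam} by move=> l lx; apply: (h x).
  rewrite /unit_coloring_at (zc_eq E) (df_eq E); congr [&& _, _ & _]; apply: eq_in_all => l lx.
  by rewrite E.
- by apply: eq_in_all => l lx; rewrite (h x).
- by apply: eq_in_has => l lx; rewrite (h x).
Qed.

Lemma inv_like m M gam C C' : unit_coloring_in m M gam C -> like C C' ->
  [/\ unit_coloring_in m M gam C', lequiv C C', count (monochrome M gam) C = count (monochrome M gam) C' &
   count (touches M gam) C = count (touches M gam) C'].
Proof.
move=> [g o h] [i v]; have [g' e] := i g; split.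
- split; [exact: g'|by rewrite -(eqv_all (@okx_rot m M gam) v)|].
  by rewrite -(eqv_has (rotinv_df gam (fun n => 0 < n)) v).
- exact: e.
- exact: v _ (@colX_rot M gam).
- exact: v _ (@hasX_rot M gam).
Qed.

(** An over-edge of color [M] with a non-zero difference would require an under-edge of color above
    [M]. *)
Lemma under_max m M gam u f x1 x2 g : unit_coloring_at m M gam (mkX u f x1 x2 g) -> gam f = M ->
  ~~ monochrome M gam (mkX u f x1 x2 g) ->
  [/\ u = true, gam x1 = (M - 1)%R, gam x2 = (M - 2)%R & gam g = (M - 1)%R].
Proof.
rewrite okx_mkX colX_mkX zc_mkX df_mkX; case: u; clear; last lia.
by move=> h E n; split; lia.
Qed.

(** By connectedness some crossing [v] that is not entirely of color [M] shares an edge with a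
    crossing [w] that is. The over-strand of [v] has color M - 1. Slid across [w], it turns all four
    edges there into M - 2, so the range has to reach down to M - 2. *)
Lemma elim_mono m M gam C : unit_coloring_in m M gam C -> (m + 2 <= M)%R -> has (monochrome M gam) C ->
  exists C' gam', [/\ unit_coloring_in m M gam' C', lequiv C C' & count (monochrome M gam') C' < count (monochrome M gam) C].
Proof.
move=> iv mM /hasP[w0 w0C cw0]; have [g o /hasP[s0 s0C ds0]] := iv.
pose P l := has (fun w => monochrome M gam w && (l \in clabels w)) C.
have cl0 (x : crossing) : exists l, l \in clabels x.
  by case: x => [[[a b] d] e]; exists a; rewrite mem_head.
have [v vC] : exists2 v, v \in C & ~~ const_at P v.
  apply/hasP/negP => nh; have cs : all (const_at P) C by rewrite -[all _ _]negbK -has_predC; exact/negP.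
  have [_ lc _ _] := g; have [l0 l0w] := cl0 w0.
  have P0 : P l0 by apply/hasP; exists w0; rewrite ?cw0.
  have allM l : l \in clabels s0 -> gam l = M.
    move=> ls; have : P l.
      by rewrite -(lc _ cs l0 l) //; apply/lab_mem; [exists w0|exists s0].
    by case/hasP => w _ /andP[/allP h lw]; apply/eqP; apply: h.
  move: ds0; case: (s0) allM => [[[a b] c] d] E; rewrite /spread !E ?inE ?eqxx ?orbT //.
  by clear; lia.
move=> ncst; have nv : ~~ monochrome M gam v.
  apply: contraNN ncst => cv; apply/cstP => l l' lv l'v.
  by rewrite /P; transitivity true; [|symmetry]; apply/hasP; exists v; rewrite ?cv.
have [f fv Pf] : exists2 f, f \in clabels v & P f.
  apply/hasP; rewrite -[has _ _]negbK; apply: contra ncst => /hasPn h; apply/cstP => l l' lv l'v.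
  by rewrite (negbTE (h l lv)) (negbTE (h l' l'v)).
case/hasP: Pf => w wC /andP[cw fw].
have vw : v != w by apply: contraTneq cw => <-.
have wC' : w \in rem v C by have := wC; rewrite (perm_mem (perm_to_rem vC)) inE eq_sym (negPf vw).
have p : perm_eq C [:: v, w & rem w (rem v C)].
  by apply: perm_trans (perm_to_rem vC) _; rewrite perm_cons perm_to_rem.
have [u1 [s1 [a' [s2 [u2 [b [c [d [lk Ex Ey]]]]]]]]] := pull2 p fv fw.
have [iv1 e1 k1 _] := inv_like iv lk.
move: (rem _ _) iv1 e1 k1 {lk p} => C1 iv1 e1 k1.
rewrite -(Ex _ (@colX_rot M gam)) in nv; rewrite -(Ey _ (@colX_rot M gam)) in cw.
have gf : gam f = M by move: cw; rewrite colX_mkX => /and4P[/eqP].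
have [g1 o1 h1] := iv1; have := o1 => /= /and3P[ov ow oC].
have [E1 E2 E3 E4] := under_max ov gf nv; rewrite E1 in iv1 e1 k1 g1 o1 nv.
have [_ /eqP gb /eqP gc /eqP gd] := and4P (eq_ind _ is_true cw _ (colX_mkX M gam u2 f b c d)).
have [N fN] := exists_fresh [:: mkX true f s1 a' s2, mkX u2 f b c d & C1].
have z1 : all (zcolored gam) [:: mkX true f s1 a' s2, mkX u2 f b c d & C1].
  by apply: sub_all o1 => x /and3P[].
have sb : s2 != b by apply: contraTneq isT => E; move: E4; rewrite E gb; clear; lia.
have [gam2 [[g3 e3 z3 f3] ag [d0 d1 d2 d3 d4]]] := col_slide sb fN g1 z1.
have := fN; rewrite fresh_mkX fresh_mkX => /and5P[lf ls1 la ls2 /and5P[_ lb lc ld fC]].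
set C2 := (_ :: _) in g3 e3 z3 f3; exists C2, gam2.
have [A1 A2 A3] := agree_all m M ag fC.
rewrite E2 gb gc gd in d0 d1 d2 d3 d4.
split; last first.
- rewrite k1 /C2 /= !colX_mkX A2 gf gb gc gd !eqxx ?d0 ?d1 ?d2 ?d3 ?d4 !ag // E2 E4 E3.
  by clear; lia.
- exact: lequiv_trans e1 e3.
split; [exact: g3| |].
  move: z3; rewrite /C2 /= => /and5P[z31 z32 z33 z34 _].
  rewrite !okx_mkX A1 z31 z32 z33 z34 oC !df_mkX ?d0 ?d1 ?d2 ?d3 ?d4 !ag // ?E2 ?E3 ?E4 ?gb ?gc ?gd.
  by move: mM; clear; case: u2 => h; rewrite /=; repeat (apply/andP; split=> //); lia.
by rewrite /C2 /= !df_mkX d4 ag // gd; clear; lia.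
Qed.

Lemma col_kink u N gam q0 b c d C : fresh N (mkX u q0 b c d :: C) -> good (mkX u q0 b c d :: C) ->
  all (zcolored gam) (mkX u q0 b c d :: C) ->
  let D' := [:: mkX true N (N + 1) (N + 1) q0, mkX u N b c d & C] in
  exists gam', [/\ [/\ good D', lequiv (mkX u q0 b c d :: C) D', all (zcolored gam') D' & fresh (N + 2) D'],
    agree N gam gam' & gam' N = gam q0 /\ gam' (N + 1) = gam q0].
Proof.
move=> fN gD zD D'.
have [gD' eD'] := iso_kink fN gD.
pose cs := [:: gam q0; gam q0].
exists (ext N gam cs).
have e0 := ext_ge0 N gam cs; have e1 := ext_ge N gam cs; have ag := @agree_ext N gam cs.
move: (ext _ _ _) e0 e1 ag => gam' e0 e1 ag.
have := fN; rewrite fresh_mkX => /and5P[lq lb lc ld fC].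
split; [|exact: ag|by rewrite e0 e1].
split; [exact: gD'|exact: eD'| |].
  move: zD; rewrite /D' /= !zc_mkX !e0 !e1 !ag //= (zc_agree ag fC) !eqxx.
  by case: u {gD gD' eD' fN D'} => /=; clear; lia.
by rewrite /D' !fresh_mkX (fresh_le _ fC) ?leq_addr //; lia.
Qed.

Lemma perm_gather (a x b c v : crossing) s : perm_eq [:: a, x, b, c, v & s] [:: x, v, a, b, c & s].
Proof. by apply/seq.permP => r /=; blia. Qed.

(** The kink is placed on the other under-edge at [v], which already has color M - 2. After the
    first slide the edge [f] of color [M] passes under a strand of color M - 2, a crossing of spread
    4; the second slide removes this crossing together with [f]. The other reflections give M - 3
    and M - 4, whence the hypothesis on [m]. *)
Lemma elim_max m M gam C : unit_coloring_in m M gam C -> (m + 4 <= M)%R -> ~~ has (monochrome M gam) C ->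
  has (touches M gam) C ->
  exists C' gam', [/\ unit_coloring_in m M gam' C', lequiv C C', ~~ has (monochrome M gam') C' &
    count (touches M gam') C' < count (touches M gam) C].
Proof.
move=> iv mM nm /hasP[v vC /hasP[f fv /eqP gf]]; have [g o _] := iv.
have nmP x : x \in C -> ~~ monochrome M gam x by move=> xC; move/hasPn: nm; apply.
(* [f] occurs once at [v], where the other edges have colors M - 1 and M - 2, so its second end is
   at another crossing. *)
have [w wC fw] : exists2 w, w \in rem v C & f \in clabels w.
  apply/lab_mem; rewrite -has_pred1 has_count; have [wC _ _ _] := g.
  have fC : f \in labs C by apply/lab_mem; exists v.
  have E : count_mem f (labs C) = count_mem f (clabels v) + count_mem f (labs (rem v C)).
    by rewrite (seq.permP (perm_labs (perm_to_rem vC))) /labs /= count_cat.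
  have : count_mem f (clabels v) <= 1; last first.
    have : 0 < count_mem f (labs C) by rewrite -has_count has_pred1.
    by have := wC f; rewrite E !inE; clear; lia.
  have [u [x1 [x2 [x3 h]]]] := orient fv.
  have : unit_coloring_at m M gam (mkX u f x1 x2 x3) /\ ~~ monochrome M gam (mkX u f x1 x2 x3).
    have ov := allP o _ vC; have nv := nmP _ vC.
    by case: h => ->; rewrite ?okx_rot ?colX_rot.
  case=> /under_max h1 /(h1 gf)[E1 E2 E3 E4].
  have p : perm_eq (clabels v) [:: f; x1; x2; x3].
    rewrite perm_sym; apply: perm_trans (_ : perm_eq (clabels (mkX u f x1 x2 x3)) _).
      by rewrite perm_sym mkX_labs.
    by case: h => ->; rewrite ?(rot_labs predT).
  have n1 k : (gam k = M - 1)%R -> (k == f) = false.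
    by move=> E5; apply: contraTF isT => /eqP kf; move: E5; rewrite kf gf; clear; lia.
  have n2 k : (gam k = M - 2)%R -> (k == f) = false.
    by move=> E5; apply: contraTF isT => /eqP kf; move: E5; rewrite kf gf; clear; lia.
  by rewrite (seq.permP p) /= eqxx (n1 x1) // (n2 x2) // (n1 x3).
have p : perm_eq C [:: v, w & rem w (rem v C)].
  by apply: perm_trans (perm_to_rem vC) _; rewrite perm_cons perm_to_rem.
have wC0 : w \in C by exact: mem_rem wC.
have [u1 [x1 [q0 [x3 [u2 [b [q [d [lk Ex Ey]]]]]]]]] := pull2 p fv fw.
have [iv1 e1 k1 k2] := inv_like iv lk.
have nm1 : ~~ has (monochrome M gam) [:: mkX u1 f x1 q0 x3, mkX u2 f b q d & rem w (rem v C)].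
  by rewrite -(eqv_has (@colX_rot M gam) lk.2).
move: (rem _ _) iv1 e1 k1 k2 nm1 {lk p} => C1 iv1 e1 k1 k2 nm1.
have := nm1; rewrite /= !negb_or => /and3P[nv nw nC].
have [g1 o1 h1] := iv1; have := o1 => /= /and3P[ov ow oC].
have [E1 X1 X2 X3] := under_max ov gf nv; rewrite E1 in iv1 e1 k1 k2 g1 o1 nm1.
have [E2 Y1 Y2 Y3] := under_max ow gf nw; rewrite E2 in iv1 e1 k1 k2 g1 o1 nm1.
set D1 := (_ :: _) in g1 e1 k1 k2 o1.
have l2 : like D1 [:: mkX true q0 x3 f x1, mkX true f b q d & C1] by exact: (like_mkX2 [::]).
have [iv2 e2 _ _] := inv_like iv1 l2; have [g2 o2 _] := iv2.
have [N fN] := exists_fresh [:: mkX true q0 x3 f x1, mkX true f b q d & C1].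
have z2 : all (zcolored gam) [:: mkX true q0 x3 f x1, mkX true f b q d & C1].
  by apply: sub_all o2 => x /and3P[].
have [gam3 [[g3 e3 z3 f3] ag3 [c30 c31]]] := col_kink fN g2 z2.
have := fN; rewrite fresh_mkX fresh_mkX => /and5P[lq0 lx3 lf lx1 /and5P[_ lb lq ld fC]].
have s3 : q0 != x3 by apply: contraTneq isT => E; move: X2; rewrite E X3; clear; lia.
have [gam4 [[g4 e4 z4 f4] ag4 [c40 c41 c42 c43 c44]]] := col_slide s3 f3 g3 z3.
set A1 := mkX _ _ _ _ _ in g4 e4 z4 f4.
set A3 := mkX true (N + 2 + 1) (N + 2 + 4) _ _ in g4 e4 z4 f4.
set A4 := mkX false (N + 2 + 2) (N + 2 + 3) _ _ in g4 e4 z4 f4.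
set D4 := (_ :: _) in g4 e4 z4 f4.
have l5 : like D4 [:: mkX true f (N + 2) (N + 2 + 1) (N + 2 + 2), mkX true f b q d, A1, A3, A4 & C1].
  by apply: like_perm; exact: perm_gather.
have [g5 e5] := l5.1 g4.
set D5 := (_ :: _) in g5 e5 l5.
have f5 : fresh (N + 2 + 5) D5 by apply/allP => l; rewrite -(labs_mem_eqv _ l5.2) => /(allP f4).
have z5 : all (zcolored gam4) D5 by rewrite -(eqv_all (zc_rot gam4) l5.2).
have ag34 := agree_trans (leq_addr 2 N) ag3 ag4.
have s5 : N + 2 + 2 != b by move: lb; clear; lia.
have [gam6 [[g6 e6 z6 f6] ag6 [c60 c61 c62 c63 c64]]] := col_slide s5 f5 g5 z5.
have ag : agree N gam gam6.
  by apply: agree_trans ag34 ag6; rewrite -addnA leq_addr.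
set D6 := (_ :: _) in g6 e6 z6 f6.
have [B1 B2 B3] := agree_all m M ag fC.
have k l : l < N -> gam6 l = gam l by apply: ag.
have k4 l : l < N -> gam4 l = gam l by apply: ag34.
have k3 l : l < N -> gam3 l = gam l by apply: ag3.
have k6 l : l < N + 2 + 5 -> gam6 l = gam4 l by apply: ag6.
have r0 : gam6 (N + 2) = (M - 2)%R by rewrite k6 ?c40 ?c31 //; clear; lia.
have r1 : gam6 (N + 2 + 1) = (M - 4)%R.
  by rewrite k6 ?c41 ?c31 ?k3 ?X2 ?gf //; clear; lia.
have r2 : gam6 (N + 2 + 2) = (M - 2)%R by rewrite k6 ?c42 ?c31 //; clear; lia.
have r3 : gam6 (N + 2 + 3) = (M - 3)%R by rewrite k6 ?c43 ?c31 ?k3 ?X1 ?X2 ?X3 //; clear; lia.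
have r4 : gam6 (N + 2 + 4) = (M - 3)%R by rewrite k6 ?c44 ?c31 ?k3 ?X1 ?X2 ?X3 //; clear; lia.
have rN : gam6 (N + 1) = (M - 2)%R.
  by rewrite k6 ?ag4 ?c31 //; clear; lia.
have E40 : gam4 (N + 2) = (M - 2)%R by rewrite c40 c31.
have t0 : gam6 (N + 2 + 5) = (M - 2)%R by rewrite c60.
have t1 : gam6 (N + 2 + 5 + 1) = (M - 2)%R by rewrite c61 E40 k4 // Y2; clear; lia.
have t2 : gam6 (N + 2 + 5 + 2) = (M - 2)%R by rewrite c62.
have t3 : gam6 (N + 2 + 5 + 3) = (M - 3)%R by rewrite c63 E40 k4 // Y1; clear; lia.
have t4 : gam6 (N + 2 + 5 + 4) = (M - 3)%R by rewrite c64 E40 k4 // Y3; clear; lia.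
have kb : gam6 b = (M - 1)%R by rewrite k.
have kd : gam6 d = (M - 1)%R by rewrite k.
have kq : gam6 q = (M - 2)%R by rewrite k.
have kq0 : gam6 q0 = (M - 2)%R by rewrite k.
have kx1 : gam6 x1 = (M - 1)%R by rewrite k.
have kx3 : gam6 x3 = (M - 1)%R by rewrite k.
have M1 : (M - 1 == M)%R = false by clear; lia.
have M2 : (M - 2 == M)%R = false by clear; lia.
have M3 : (M - 3 == M)%R = false by clear; lia.
have M4 : (M - 4 == M)%R = false by clear; lia.
exists D6, gam6; split.
- split; [exact: g6| |].
    move: z6; rewrite /D6 /A1 /A3 /A4 /= => /and5P[y1 y2 y3 y4 /and4P[y5 y6 y7 _]].
    rewrite !okx_mkX.
    rewrite y1 y2 y3 y4 y5 y6 y7 !df_mkX B1 oC ?r0 ?r1 ?r2 ?r3 ?r4 ?t0 ?t1 ?t2 ?t3 ?t4 ?kb ?kd ?kq ?kq0 ?kx1 ?kx3 ?rN.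
    by move: mM; clear => h; rewrite /=; repeat (apply/andP; split=> //); lia.
  by rewrite /D6 /= !df_mkX t4 kd; clear; lia.
- exact: lequiv_trans e1 (lequiv_trans e2 (lequiv_trans e3 (lequiv_trans e4 (lequiv_trans e5 e6)))).
- rewrite has_count /D6 /A1 /A3 /A4 /= !colX_mkX B2.
  rewrite ?r0 ?r1 ?r2 ?r3 ?r4 ?t0 ?t1 ?t2 ?t3 ?t4 ?kb ?kd ?kq ?kq0 ?kx1 ?kx3 ?rN ?M1 ?M2 ?M3 ?M4 /=.
  by rewrite !add0n -has_count.
- rewrite k2 /D1 /D6 /A1 /A3 /A4 /= !hasX_mkX B3 gf eqxx.
  rewrite ?r0 ?r1 ?r2 ?r3 ?r4 ?t0 ?t1 ?t2 ?t3 ?t4 ?kb ?kd ?kq ?kq0 ?kx1 ?kx3 ?rN ?M1 ?M2 ?M3 ?M4 /=.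
  by clear; lia.
Qed.

Lemma elim_mono_all m M gam C : unit_coloring_in m M gam C -> (m + 2 <= M)%R ->
  exists C' gam', [/\ unit_coloring_in m M gam' C', lequiv C C' & ~~ has (monochrome M gam') C'].
Proof.
move=> iv mM; have [n le] := ubnP (count (monochrome M gam) C).
elim: n gam C iv le => // n IH gam C iv le.
case h : (has (monochrome M gam) C); last by exists C, gam; split; [|exact: lequiv_refl|rewrite h].
have [C1 [gam1 [iv1 e1 lt]]] := elim_mono iv mM h.
have [|C2 [gam2 [iv2 e2 h2]]] := IH gam1 C1 iv1; first by apply: leq_trans lt _; rewrite -ltnS.
by exists C2, gam2; split; [|exact: lequiv_trans e1 e2|].
Qed.

Lemma elim_color m M gam C : unit_coloring_in m M gam C -> (m + 4 <= M)%R ->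
  exists C' gam', unit_coloring_in m (M - 1) gam' C' /\ lequiv C C'.
Proof.
move=> iv mM; have mM2 : (m + 2 <= M)%R by move: mM; clear; lia.
have [C1 [gam1 [iv1 e1 h1]]] := elim_mono_all iv mM2.
have [n le] := ubnP (count (touches M gam1) C1).
elim: n gam1 C1 iv1 e1 h1 le => // n IH gam1 C1 iv1 e1 h1 le.
case h : (has (touches M gam1) C1); last first.
  exists C1, gam1; split=> //; have [g o hp] := iv1; split=> //.
  apply/allP=> x xC; rewrite /unit_coloring_at; have := allP o _ xC => /and3P[-> -> /allP ax] /=.
  apply/allP=> l lx; have := ax _ lx; have : gam1 l != M; last by clear; lia.
  move/negbT: h => /hasPn/(_ x xC)/hasPn; exact.
have [C2 [gam2 [iv2 e2 h2 lt]]] := elim_max iv1 mM h1 h.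
apply: (IH gam2 C2 iv2 (lequiv_trans e1 e2) h2).
by apply: leq_trans lt _; rewrite -ltnS.
Qed.

Lemma four_range m M gam C : unit_coloring_in m M gam C ->
  exists C' gam', unit_coloring_in m (m + 3) gam' C' /\ lequiv C C'.
Proof.
have [n le] : exists n : nat, (M <= m + 3 + n%:Z)%R.
  by exists `|(M - m)%R|; clear; lia.
elim: n M gam C le => [|n IH] M gam C le iv.
  exists C, gam; split; last exact: lequiv_refl.
  have [g o hp] := iv; split=> //; apply: sub_all o => x /and3P[z d /allP h].
  rewrite /unit_coloring_at z d; apply/allP=> l lx; have := h l lx; move: le; clear; lia.
have [lt|] := boolP (m + 4 <= M)%R; last first.
  by move=> nlt; apply: (IH M gam C _ iv); move: nlt; clear; lia.
have [C1 [gam1 [iv1 e1]]] := elim_color iv lt.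
have [|C2 [gam2 [iv2 e2]]] := IH _ _ _ _ iv1; first by move: le; clear; lia.
by exists C2, gam2; split; [|exact: lequiv_trans e1 e2].
Qed.

Lemma color_reduction gam C : good C -> all (zcolored gam) C -> has (fun x => 0 < spread gam x) C ->
  exists C' gam' m, [/\ good C', lequiv C C', all (zcolored gam') C', has (fun x => 0 < spread gam' x) C' &
    forall l, l \in labs C' -> (m <= gam' l <= m + 3)%R].
Proof.
move=> g z h.
have [B bB] : exists B, bounded B gam C.
  exists (\max_(x <- C) spread gam x); apply/eqP; rewrite -leqn0 leqNgt -has_count.
  by apply/hasPn => x xC; rewrite -leqNgt leq_bigmax_seq.
have sB : bounded_coloring B gam C by split.
have [gam1 [C1 [d [e1 g1 z1 a1 [d0 h1]]]]] := simple_coloring sB h.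
have [gam2 [z2 a2 h2]] := unit_coloring g1 z1 a1 d0 h1.
pose n := (\max_(l <- labs C1) `|gam2 l|).
have iv : unit_coloring_in (- n%:Z)%R n%:Z gam2 C1.
  split; [exact: g1| |exact: h2]; apply/allP=> x xC.
  rewrite /unit_coloring_at (allP z2 _ xC) (allP a2 _ xC) /=; apply/allP=> l lx.
  have lC : l \in labs C1 by apply/lab_mem; exists x.
  have : `|gam2 l| <= n by apply: (@leq_bigmax_seq _ _ xpredT (fun l => `|gam2 l|%N)).
  by clear; lia.
have [C3 [gam3 [[g3 o3 h3] e3]]] := four_range iv.
exists C3, gam3, (- n%:Z)%R; split; [exact: g3|exact: lequiv_trans e1 e3| |exact: h3|].
  by apply: sub_all o3 => x /and3P[].
by move=> l /lab_mem[x xC lx]; have /and3P[_ _ /allP] := allP o3 _ xC; apply.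
Qed.

(** * Diagrams with an upper and a lower part *)

(* Edges of type [true] form the upper part of the diagram. *)
Definition typed_at (ty : nat -> bool) (x : crossing) : bool :=
  let: (a, b, c, d) := x in [&& ty a == ty c, ty b == ty d & ty a ==> ty b].
Definition pure s (ty : nat -> bool) (x : crossing) : bool := all (fun l => ty l == s) (clabels x).
(** Tests connectedness of one part by itself: only edges of type [s] are compared, so a mixed
    crossing merely joins the two edges of its strand of that type. *)
Definition const_on_type s (ty : nat -> bool) (P : nat -> bool) (x : crossing) : bool :=
  all (fun l => (ty l == s) ==> P l) (clabels x) || all (fun l => (ty l == s) ==> ~~ P l) (clabels x).
Definition type_connected s ty C := forall P, all (const_on_type s ty P) C ->
  forall l l', l \in labs C -> l' \in labs C -> ty l = s -> ty l' = s -> P l = P l'.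
Definition typing ty C := [/\ good C, all (typed_at ty) C, forall s, type_connected s ty C &
  forall s, exists2 l, l \in labs C & ty l = s].

Lemma tyok_rot ty : rotinv (typed_at ty).
Proof. by move=> [[[a b] c] d] /=; case: (ty a) (ty b) (ty c) (ty d) => -[] [] []. Qed.
Lemma pureX_rot s ty : rotinv (pure s ty).
Proof. by move=> x; rewrite /pure (perm_all _ (rot_labs predT x)). Qed.
Lemma tcst_rot s ty P : rotinv (const_on_type s ty P).
Proof. by move=> x; rewrite /const_on_type !(perm_all _ (rot_labs predT x)). Qed.

Lemma tyok_mkX ty u a b c d : typed_at ty (mkX u a b c d) =
  [&& ty a == ty c, ty b == ty d & if u then ty a ==> ty b else ty b ==> ty a].
Proof. by case: u; rewrite /mkX /= //; case: (ty a) (ty b) (ty c) (ty d) => -[] [] []. Qed.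
Lemma pureX_mkX s ty u a b c d : pure s ty (mkX u a b c d) =
  [&& ty a == s, ty b == s, ty c == s & ty d == s].
Proof. by rewrite /pure (perm_all _ (mkX_labs u a b c d)) /= andbT. Qed.
Lemma tcst_mixed s ty P u a b c d : ty c = ty a -> ty b = ~~ ty a -> ty d = ~~ ty a ->
  const_on_type s ty P (mkX u a b c d) = if s == ty a then P a == P c else P b == P d.
Proof.
move=> h1 h2 h3; rewrite /const_on_type !(perm_all _ (mkX_labs u a b c d)) /= h1 h2 h3.
by case: (ty a) s (P a) (P b) (P c) (P d) => -[] [] [] [] [].
Qed.
Lemma tcst_pure s ty P u a b c d : pure (ty a) ty (mkX u a b c d) ->
  const_on_type s ty P (mkX u a b c d) = (s == ty a) ==> [&& P a == P b, P b == P c & P c == P d].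
Proof.
rewrite pureX_mkX /const_on_type !(perm_all _ (mkX_labs u a b c d)) /= => /and4P[_ /eqP -> /eqP -> /eqP ->].
by case: (ty a) s (P a) (P b) (P c) (P d) => -[] [] [] [] [].
Qed.

Lemma tcstP s ty P x : reflect (forall l l', l \in clabels x -> l' \in clabels x ->
  ty l = s -> ty l' = s -> P l = P l') (const_on_type s ty P x).
Proof.
apply: (iffP idP) => [/orP[]/allP h l l' lx l'x tl tl'|h].
- by move: (h l lx) (h l' l'x); rewrite tl tl' eqxx /= => -> ->.
- by move: (h l lx) (h l' l'x); rewrite tl tl' eqxx /= => /negbTE -> /negbTE ->.
apply/orP; case E : (has (fun l => (ty l == s) && ~~ P l) (clabels x)).
  right; case/hasP: E => l0 lx0 /andP[/eqP t0 /negbTE P0]; apply/allP => l lx.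
  by apply/implyP => /eqP tl; rewrite (h l l0) ?P0.
left; apply/allP => l lx; apply/implyP => tl; apply: contraFT E => nP.
by apply/hasP; exists l; rewrite ?tl.
Qed.

Lemma tconn_eqv s ty C C' : same_up_to_rot C C' -> type_connected s ty C -> type_connected s ty C'.
Proof.
move=> v h P aP l l'; rewrite -!(labs_mem_eqv _ v); apply: h.
by rewrite (eqv_all (@tcst_rot s ty P) v).
Qed.

Lemma tst_like ty C C' : like C C' -> typing ty C -> typing ty C' /\ lequiv C C'.
Proof.
move=> [i v] [g o t h]; have [g' e] := i g; split=> //; split; [exact: g'| | |].
- by rewrite -(eqv_all (tyok_rot ty) v).
- by move=> s; apply: tconn_eqv v (t s).
- by move=> s; have [l lC tl] := h s; exists l; rewrite -?(labs_mem_eqv _ v).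
Qed.

Lemma tconn_transfer s ty ty' C C' : type_connected s ty C ->
  (forall P', all (const_on_type s ty' P') C' -> exists2 P, all (const_on_type s ty P) C &
    forall l, l \in labs C' -> ty' l = s -> exists l1, [/\ l1 \in labs C, ty l1 = s & P' l = P l1]) ->
  type_connected s ty' C'.
Proof.
move=> t h P /h[P' aP' hP'] l l' lC l'C tl tl'.
have [l1 [? ? ->]] := hP' l lC tl; have [l2 [? ? ->]] := hP' l' l'C tl'; exact: t.
Qed.

Definition mixed (ty : nat -> bool) x := ~~ pure true ty x && ~~ pure false ty x.

(* If the part of one type is disconnected, one of its components can change
   type, which decreases the number of mixed crossings. *)
Lemma make_type_connected ty C : good C -> all (typed_at ty) C -> (forall s, exists2 l, l \in labs C & ty l = s) ->
  exists ty', typing ty' C.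
Proof.
move=> g; have [_ lc _ _] := g; have [n le] := ubnP (count (mixed ty) C).
elim: n ty le => // n IH ty le o h.
case: (excluded_middle_informative (forall s, type_connected s ty C)) => [t|nt]; first by exists ty.
have [s /not_all_ex_not[P]] := not_all_ex_not _ _ nt.
move=> nP; have [aP nP'] := imply_to_and _ _ nP.
have [l [l' [lC l'C tl tl' Pl]]] : exists l l', [/\ l \in labs C, l' \in labs C, ty l = s, ty l' = s & P l != P l'].
  apply: NNPP => ne; apply: nP' => l l' lC l'C tl tl'; apply/eqP; apply/negPn/negP => nE.
  by apply: ne; exists l, l'.
(* The edges of type [s] on one side of [P] change type. They meet no edge of type [s] from the
   other side, so no pure crossing becomes mixed. *)
pose ty2 k := if s then ty k && P k else ty k || P k.
have h2 s' : exists2 l, l \in labs C & ty2 l = s'.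
  have [l0 l0C tl0] := h (~~ s); rewrite /ty2; move: tl tl' tl0 Pl.
  case: (s) => tl tl' tl0 Pl; case: s'.
  - by case E : (P l) Pl => Pl; [exists l|exists l' => //; rewrite tl' /=; case: (P l') Pl]; rewrite ?tl ?E.
  - by exists l0; rewrite // tl0.
  - by exists l0; rewrite // tl0.
  - by case E : (P l) Pl => Pl; [exists l' => //; rewrite tl' /=; case: (P l') Pl|exists l]; rewrite ?tl ?E.
have ok x : x \in C -> typed_at ty2 x /\ (mixed ty2 x -> mixed ty x).
  move=> xC; have := allP o _ xC; have := allP aP _ xC.
  case: x {xC} => [[[a b] c] d]; rewrite /const_on_type /mixed /pure /typed_at /= /ty2.
  by case: (s) (ty a) (ty b) (ty c) (ty d) (P a) (P b) (P c) (P d) => -[] [] [] [] [] [] [] [].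
apply: (IH ty2) => //; last by apply/allP => x /ok[].
(* By connectedness some crossing contains both edges that change type and edges that do not. It was
   mixed and becomes pure, so the count drops. *)
have : ~~ all (const_at (fun k => (ty k == s) && (P k == ~~ s))) C.
  apply/negP => /lc k; have := k l l' lC l'C; rewrite tl tl' eqxx /=.
  by case: (P l) (P l') (s) Pl => [] [] [].
rewrite -has_predC => /hasP[x xC nx].
apply: leq_trans (_ : count (mixed ty) C <= n); last by rewrite -ltnS.
rewrite -!size_filter; set F := filter _ _; set G := filter _ _.
have FG : F = filter (mixed ty2) G.
  rewrite -filter_predI; apply: eq_in_filter => y yC /=.
  by have [_ k] := ok _ yC; case: (mixed ty2 y) k => //= ->.
rewrite FG size_filter -(count_predC (mixed ty2) G) -addn1 leq_add2l -has_count.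
apply/hasP; exists x; rewrite ?mem_filter ?xC ?andbT.
all: have := allP o _ xC; have := allP aP _ xC; move: nx; clear.
all: case: x => [[[a b] c] d]; rewrite /const_on_type /mixed /pure /typed_at /=; try rewrite /ty2.
all: by case: (s) (ty a) (ty b) (ty c) (ty d) (P a) (P b) (P c) (P d) => -[] [] [] [] [] [] [] [].
Qed.

Definition extb N (ty : nat -> bool) (cs : seq bool) (l : nat) : bool :=
  if l < N then ty l else nth false cs (l - N).

Definition agreeb N (ty ty' : nat -> bool) := forall l, l < N -> ty' l = ty l.

Lemma extb_agree N ty cs : agreeb N ty (extb N ty cs).
Proof. by move=> l; rewrite /extb => ->. Qed.
Lemma extb_ge N ty cs k : extb N ty cs (N + k) = nth false cs k.
Proof. by rewrite /extb ltnNge leq_addr /= addKn. Qed.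
Lemma extb_ge0 N ty cs : extb N ty cs N = nth false cs 0.
Proof. by have := extb_ge N ty cs 0; rewrite addn0. Qed.

Lemma agreeb_all N ty ty' C : agreeb N ty ty' -> fresh N C ->
  all (typed_at ty') C = all (typed_at ty) C /\
  (forall s, {in C, pure s ty' =1 pure s ty}).
Proof.
move=> ag fC; have h x l : x \in C -> l \in clabels x -> ty' l = ty l.
  by move=> xC lx; apply: ag; apply: fresh_cl fC xC lx.
split.
  apply: eq_in_all => x /h; case: x => [[[a b] c] d] E.
  by rewrite /typed_at !E ?inE ?eqxx ?orbT.
by move=> s x xC; apply: eq_in_all => l lx; rewrite (h x).
Qed.

Lemma tcst_agree s N ty ty' P P' C : agreeb N ty ty' -> fresh N C -> {in labs C, P =1 P'} ->
  all (const_on_type s ty' P') C = all (const_on_type s ty P) C.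
Proof.
move=> ag fC E; apply: eq_in_all => x xC.
have h l : l \in clabels x -> ((ty' l == s) ==> P' l = ((ty l == s) ==> P l)) /\
    ((ty' l == s) ==> ~~ P' l = ((ty l == s) ==> ~~ P l)).
  move=> lx; rewrite ag; last exact: fresh_cl fC xC lx.
  by rewrite E //; apply/lab_mem; exists x.
by rewrite /const_on_type; congr orb; apply: eq_in_all => l /h[].
Qed.

Lemma mem_labs_mkX l u a b c d C :
  (l \in labs (mkX u a b c d :: C)) = (l \in [:: a; b; c; d]) || (l \in labs C).
Proof. by rewrite (perm_mem (labs_mkX u a b c d C)) mem_cat. Qed.

(** Sliding a strand of the other type across a pure crossing trades one mixed crossing for three.
    The pure crossing stays pure and now ends on the edge [a'], beyond the strand. *)
Lemma slide_typed u N ty a s1 a' s2 b c d C :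
  let t := ~~ ty a in let D := [:: mkX t a s1 a' s2, mkX u a b c d & C] in
  let D' := [:: mkX (ty a) N d s1 (N + 4), mkX (ty a) (N + 2) c N (N + 1),
        mkX u (N + 1) (N + 4) a' (N + 3), mkX (ty a) (N + 2) (N + 3) s2 b & C] in
  fresh N D -> typing ty D -> ty s1 = ~~ ty a -> pure (ty a) ty (mkX u a b c d) ->
  exists ty', [/\ typing ty' D', lequiv D D', fresh (N + 5) D', agreeb N ty ty' &
   [/\ ty' N = ~~ ty a, ty' (N + 1) = ty a, ty' (N + 2) = ~~ ty a, ty' (N + 3) = ty a & ty' (N + 4) = ty a]].
Proof.
move=> t D D' fN [gD oD tD hD] ts1 pw.
have := oD; rewrite /D /= !tyok_mkX => /and3P[ox ow oC].
have [pa pb pc pd] : [/\ ty a' = ty a, ty b = ty a, ty c = ty a & ty d = ty a].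
  by move: pw; rewrite pureX_mkX => /and4P[_ /eqP -> /eqP -> /eqP ->]; case/and3P: ox => /eqP ->.
have ts2 : ty s2 = ~~ ty a by case/and3P: ox => _ /eqP <-.
have sb : s2 != b by apply: contraTneq isT => E; move: pb; rewrite -E ts2; case: (ty a).
have [gD' eD'] := iso_slide sb fN gD; rewrite negbK in gD' eD'.
pose cs := [:: ~~ ty a; ty a; ~~ ty a; ty a; ty a].
exists (extb N ty cs).
have e0 := extb_ge0 N ty cs; have e1 := extb_ge N ty cs; have ag := @extb_agree N ty cs.
have e11 := e1 1; have e12 := e1 2; have e13 := e1 3; have e14 := e1 4.
move: (extb _ _ _) e0 e11 e12 e13 e14 ag {e1} => ty' /= e0 e1 e2 e3 e4 ag.
have := fN; rewrite /D fresh_mkX fresh_mkX => /and5P[la ls1 la' ls2 /and5P[_ lb lc ld fC]].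
have k l : l < N -> ty' l = ty l by apply: ag.
have [A1 A2] := agreeb_all ag fC.
have n1 : a \notin [:: s1; a'; s2; b; c; d] ++ labs C.
  have [w _ _ _] := gD; have /wls_cons2[n _] : wls [:: a, a & [:: s1; a'; s2; b; c; d] ++ labs C].
    apply: wls_perm w; rewrite (perm_trans (labs_mkX _ _ _ _ _ _)) //.
    rewrite perm_sym; apply: perm_trans (_ : perm_eq _ ([:: a; s1; a'; s2] ++ [:: a; b; c; d] ++ labs C)) _.
      by clear; apply/seq.permP => q /=; blia.
    by rewrite perm_cat2l perm_sym labs_mkX.
  exact: n.
split; last 1 first.
- by split.
- split; [exact: gD'| | |].
  + rewrite /D' /= !tyok_mkX A1 oC e0 e1 e2 e3 e4 !k // ts1 ts2 pa pb pc pd !eqxx /=.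
    by case: (ty a) (u) => [] [].
  + move=> s; apply: tconn_transfer (tD s) _ => P aP.
    move: n1; rewrite mem_cat negb_or !inE !negb_or => /andP[/and5P[/negPf q1 /negPf q2 /negPf q3 /negPf q4 /andP[/negPf q5 /negPf q6]] q7].
    rewrite !(eq_sym a) in q1 q2 q3 q4 q5 q6.
    have m1 : const_on_type s ty' P (mkX (ty a) N d s1 (N + 4)) = if s == ty a then P d == P (N + 4) else P N == P s1.
      by rewrite tcst_mixed ?e0 ?e4 ?k ?negbK // ?ts1 //; case: (s) (ty a) => [] [].
    have m2 : const_on_type s ty' P (mkX (ty a) (N + 2) c N (N + 1)) = if s == ty a then P c == P (N + 1) else P (N + 2) == P N.
      by rewrite tcst_mixed ?e0 ?e1 ?e2 ?k ?negbK //; case: (s) (ty a) => [] [].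
    have m4 : const_on_type s ty' P (mkX (ty a) (N + 2) (N + 3) s2 b) = if s == ty a then P (N + 3) == P b else P (N + 2) == P s2.
      by rewrite tcst_mixed ?e2 ?e3 ?k ?negbK // ?ts2 //; case: (s) (ty a) => [] [].
    have m3 : const_on_type s ty' P (mkX u (N + 1) (N + 4) a' (N + 3)) =
        (s == ty a) ==> [&& P (N + 1) == P (N + 4), P (N + 4) == P a' & P a' == P (N + 3)].
      by rewrite tcst_pure ?pureX_mkX ?e1 ?e3 ?e4 ?k // ?pa ?eqxx.
    (* The edge [a] vanishes in the slide. It continues [a'] on the same strand and takes its
       value. *)
    pose P' l := if l == a then P a' else P l.
    have m5 : const_on_type s ty P' (mkX t a s1 a' s2) = if s == ty a then P a' == P a' else P s1 == P s2.
      by rewrite tcst_mixed // /P' q1 q2 q3 !eqxx.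
    have m6 : const_on_type s ty P' (mkX u a b c d) = (s == ty a) ==> [&& P a' == P b, P b == P c & P c == P d].
      by rewrite tcst_pure // /P' q4 q5 q6 !eqxx.
    move: aP; rewrite /D' /= (@tcst_agree s N ty ty' P' P C ag fC); last first.
      by move=> l lC; rewrite /P'; case: eqP => // E; rewrite -E lC in q7.
    rewrite m1 m2 m3 m4 => /and5P[h1 h2 h3 h4 h5].
    exists P'.
      rewrite /D /= m5 m6 h5; move: h1 h2 h3 h4; case: (s == ty a) => /= /eqP h1 /eqP h2 h3 /eqP h4.
        by case/and3P: h3 => /eqP h6 /eqP h7 /eqP h8; rewrite h1 h2 -h4 -h8 -h7 -h6 !eqxx.
      by rewrite -h1 -h2 h4 eqxx.
    have fD l : l \in labs D -> ty l = s -> P' l = P l -> exists l1, [/\ l1 \in labs D, ty l1 = s & P l = P' l1].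
      by move=> lD tl pl; exists l; split.
    have inD l : l \in [:: s1; s2; a'; b; c; d] -> l \in labs D /\ P' l = P l.
      move=> lD; split.
        by rewrite /D !mem_labs_mkX; move: lD; rewrite !inE; clear; do ![case/orP => [->|]]; rewrite ?orbT // => ->; rewrite ?orbT.
      by rewrite /P'; move: lD; rewrite !inE; do ![case/orP => [/eqP ->|]]; rewrite ?q1 ?q2 ?q3 ?q4 ?q5 ?q6 // => /eqP ->; rewrite q6.
    have via l l0 : l0 \in [:: s1; s2; a'; b; c; d] -> (ty' l = s -> ty l0 = s /\ P l = P l0) -> ty' l = s ->
        exists l1, [/\ l1 \in labs D, ty l1 = s & P l = P' l1].
      by move=> /inD[i1 i2] h /h[j1 j2]; exists l0; split=> //; rewrite j2.
    have ss : (~~ ty a = s) -> (s == ty a) = false by move=> <-; case: (ty a).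
    move=> l; rewrite /D' !mem_labs_mkX => h.
    have {h} : l \in [:: s1; s2; a'; b; c; d] \/ l \in [:: N; N + 1; N + 2; N + 3; N + 4] \/ l \in labs C.
      by move: h; rewrite !inE; clear; do !case: eqP => _ //=; auto.
    case=> [lo|[ln|lC]].
    * apply: (via l l) => // tl; split=> //; rewrite -tl k //.
      by move: lo; rewrite !inE; do ![case/orP => [/eqP -> //|]]; move=> /eqP ->.
    * move: ln; rewrite !inE => /or4P[/eqP -> |/eqP ->|/eqP ->|/orP[]/eqP ->].
      + apply: (via _ s1); rewrite ?inE ?eqxx // e0 => E; move: (E) h1 => /ss -> /eqP ->.
        by rewrite ts1.
      + apply: (via _ c); rewrite ?inE ?eqxx ?orbT // e1 => E; move: h2; rewrite E eqxx => /eqP ->.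
        by rewrite pc.
      + apply: (via _ s2); rewrite ?inE ?eqxx ?orbT // e2 => E; move: (E) h4 => /ss -> /eqP ->.
        by rewrite ts2.
      + apply: (via _ b); rewrite ?inE ?eqxx ?orbT // e3 => E; move: h4; rewrite E eqxx => /eqP ->.
        by rewrite pb.
      + apply: (via _ d); rewrite ?inE ?eqxx ?orbT // e4 => E; move: h1; rewrite E eqxx => /eqP ->.
        by rewrite pd.
    * move=> tl; apply: fD; first by rewrite /D !mem_labs_mkX lC !orbT.
        by rewrite -tl k //; apply: (allP fC).
      by rewrite /P'; case: eqP => // E; rewrite -E lC in q7.
  + move=> s; case: (eqVneq s (ty a)) => [->|ns].
      by exists a'; rewrite ?k // /D' !mem_labs_mkX !inE eqxx !orbT.
    exists s1; first by rewrite /D' !mem_labs_mkX !inE eqxx !orbT.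
    by rewrite k // ts1; case: (s) (ty a) ns => [] [].
- exact: eD'.
- rewrite /D' !fresh_mkX (fresh_le _ fC) ?leq_addr //.
  by move: la ls1 la' ls2 lb lc ld; clear; lia.
- exact: ag.
Qed.

Lemma kink_typed u N ty q0 b c d C :
  let D := mkX u q0 b c d :: C in
  let D' := [:: mkX true N (N + 1) (N + 1) q0, mkX u N b c d & C] in
  fresh N D -> typing ty D ->
  exists ty', [/\ typing ty' D', lequiv D D', agreeb N ty ty', ty' N = ty q0 & ty' (N + 1) = ty q0].
Proof.
move=> D D' fN [gD oD tD hD].
have [gD' eD'] := iso_kink fN gD.
pose cs := [:: ty q0; ty q0].
exists (extb N ty cs).
have e0 := extb_ge0 N ty cs; have e1 := extb_ge N ty cs 1; have ag := @extb_agree N ty cs.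
move: (extb _ _ _) e0 e1 ag => ty' /= e0 e1 ag.
have := fN; rewrite /D fresh_mkX => /and5P[lq lb lc ld fC].
have k l : l < N -> ty' l = ty l by apply: ag.
have [A1 A2] := agreeb_all ag fC.
split; [| exact: eD' | exact: ag | exact: e0 | exact: e1].
split; [exact: gD'| | |].
- move: oD; rewrite /D /D' /= !tyok_mkX A1 e0 e1 !k // => /andP[-> ->].
  by case: (ty q0).
- move=> s; apply: tconn_transfer (tD s) _ => P aP; exists P.
    move: aP; rewrite /D /D' /= (@tcst_agree s N ty ty' P P C ag fC) // => /and3P[/tcstP h1 /tcstP h2 ->].
    rewrite andbT; apply/tcstP => l l'.
    have h l0 : l0 \in clabels (mkX u q0 b c d) -> ty l0 = s ->
        exists l1, [/\ l1 \in clabels (mkX u N b c d), ty' l1 = s & P l0 = P l1].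
      rewrite mem_mkX !inE => /orP[/eqP ->|lx] t0.
        exists N; rewrite mem_mkX mem_head e0 t0; split=> //.
        by apply: h1; rewrite ?mem_mkX ?inE ?eqxx ?orbT // ?e0 ?k.
      exists l0; rewrite mem_mkX !inE lx orbT; split=> //; rewrite k //.
      by case/or3P: lx => /eqP ->.
    by move=> /h hl /h hl' /hl[l1 [i1 j1 ->]] /hl'[l2 [i2 j2 ->]]; apply: h2.
  have inD l : (l \in [:: q0; b; c; d]) || (l \in labs C) -> ty' l = s ->
      exists l1, [/\ l1 \in labs D, ty l1 = s & P l = P l1].
    move=> lD tl; exists l; split=> //; first by rewrite mem_labs_mkX.
    rewrite -tl k //; case/orP: lD => [|/(allP fC) //].
    by rewrite !inE => /or4P[]/eqP ->.
  have h1 : forall l l', l \in [:: N; N + 1; q0] -> l' \in [:: N; N + 1; q0] -> ty q0 = s -> P l = P l'.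
    move: aP => /andP[/tcstP h1 _] l l' hl hl' tq.
    have i1 l0 : l0 \in [:: N; N + 1; q0] -> l0 \in clabels (mkX true N (N + 1) (N + 1) q0) /\ ty' l0 = s.
      rewrite mem_mkX !inE => /or3P[]/eqP ->; rewrite ?e0 ?e1 ?k //; by rewrite !eqxx ?orbT.
    have [j1 j2] := i1 _ hl; have [j3 j4] := i1 _ hl'; exact: h1.
  have new l : l \in [:: N; N + 1] -> ty' l = s -> exists l1, [/\ l1 \in labs D, ty l1 = s & P l = P l1].
    move=> ln tl; have tq : ty q0 = s by move: ln tl; rewrite !inE => /orP[]/eqP ->; rewrite ?e0 ?e1.
    exists q0; split=> //; first by rewrite mem_labs_mkX mem_head.
    by apply: h1; rewrite // !inE ?eqxx ?orbT //; move: ln; rewrite !inE => /orP[] ->; rewrite ?orbT.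
  move=> l; rewrite /D' !mem_labs_mkX => h.
  have [ln|ln] := boolP (l \in [:: N; N + 1]); first exact: new.
  apply: inD; move: h ln; rewrite !inE; clear; do !case: eqP => _ //=.
- move=> s; have [l lD tl] := hD s; exists l.
    by move: lD; rewrite /D /D' !mem_labs_mkX !inE; clear; do !case: eqP => _ //=; rewrite ?orbT.
  by rewrite k //; apply: (allP fN).
Qed.

(** * Gathering the pure crossings *)

Definition share_typed_label (ty : nat -> bool) s (x y : crossing) :=
  has (fun l => (ty l == s) && (l \in clabels y)) (clabels x).

Lemma shsP ty s x y : reflect (exists l, [/\ l \in clabels x, l \in clabels y & ty l = s]) (share_typed_label ty s x y).
Proof.
apply: (iffP hasP) => [[l lx /andP[/eqP tl ly]]|[l [lx ly tl]]]; first by exists l.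
by exists l; rewrite ?tl ?eqxx.
Qed.

Lemma mixed_rot ty : rotinv (mixed ty).
Proof. by move=> x; rewrite /mixed !pureX_rot. Qed.

Lemma mixed_mkX ty t a s1 a' s2 : typed_at ty (mkX t a s1 a' s2) -> mixed ty (mkX t a s1 a' s2) ->
  [/\ t = ~~ ty a, ty s1 = ~~ ty a, ty a' = ty a & ty s2 = ~~ ty a].
Proof.
rewrite tyok_mkX /mixed !pureX_mkX.
by case: t (ty a) (ty s1) (ty a') (ty s2) => -[] [] [] [].
Qed.

Lemma mixed_intro ty t a s1 a' s2 : ty s1 = ~~ ty a -> mixed ty (mkX t a s1 a' s2).
Proof. by rewrite /mixed !pureX_mkX => ->; case: (ty a) (ty a') (ty s2) => [] [] []. Qed.

Lemma mixed_pure s ty x : mixed ty x -> pure s ty x = false.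
Proof. by case/andP => /negbTE h /negbTE h'; case: s. Qed.

Lemma filter_agree s N ty ty' C : agreeb N ty ty' -> fresh N C ->
  filter (pure s ty') C = filter (pure s ty) C.
Proof. by move=> ag fC; apply: eq_in_filter; have [_] := agreeb_all ag fC; apply. Qed.

Lemma fresh_cat N C C' : fresh N (C ++ C') = fresh N C && fresh N C'.
Proof. by rewrite /fresh /labs map_cat flatten_cat all_cat. Qed.

(** Induction from the far end of the path: the crossing strand at the last mixed crossing is slid
    across [w], which brings [w] one place nearer to [S]. The types on [S] do not change, and the
    remaining pure crossings of each type are kept up to order. *)
Lemma grow s p : forall ty C S w x0, typing ty (w :: C ++ S) -> x0 \in S ->
  path (share_typed_label ty s) x0 (rcons p w) -> uniq p -> {subset p <= C} -> all (mixed ty) p -> pure s ty w ->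
  exists ty' C' w', [/\ typing ty' (w' :: C' ++ S), lequiv (w :: C ++ S) (w' :: C' ++ S), pure s ty' w' &
   [/\ {in labs S, ty' =1 ty}, exists2 x, x \in S & share_label x w' &
    forall s', perm_eq (filter (pure s' ty') C') (filter (pure s' ty) C)]].
Proof.
elim/last_ind: p => [|q y IH] ty C S w x0 T x0S.
  rewrite /= andbT => /shsP[l [lx lw tl]] _ _ _ pw; exists ty, C, w; split=> //.
    exact: lequiv_refl.
  by split=> //; exists x0 => //; apply/shP; exists l.
rewrite rcons_path last_rcons rcons_uniq all_rcons => /andP[pth /shsP[a [ay aw ta]]] /andP[yq uq] sub /andP[my mq] pw.
have yC : y \in C by apply: sub; rewrite mem_rcons mem_head.
have [C1 pC] : exists C1 : seq crossing, perm_eq C (y :: C1) by exists (rem y C); apply: perm_to_rem.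
have subq : {subset q <= C1}.
  move=> z zq; have : z \in C by apply: sub; rewrite mem_rcons inE zq orbT.
  by rewrite (perm_mem pC) inE => /orP[/eqP zy|//]; rewrite -zy zq in yq.
move: pth; rewrite rcons_path => /andP[pth /shsP[a2 [a2z a2y ta2]]].
have [a2w|a2w] := boolP (a2 \in clabels w).
  apply: (IH ty C S w x0) => //; last by move=> z /subq zC; rewrite (perm_mem pC) inE zC orbT.
  by rewrite rcons_path pth; apply/shsP; exists a2.
have p : perm_eq (w :: C ++ S) [:: y, w & C1 ++ S].
  apply: perm_trans (_ : perm_eq _ (w :: y :: C1 ++ S)) _.
    by rewrite perm_cons -cat_cons perm_cat2r pC.
  by apply/seq.permP => r /=; clear; blia.
have [t [s1 [a' [s2 [u [b [c [d [lk Ex Ey]]]]]]]]] := pull2 p ay aw.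
have [T1 e1] := tst_like lk T.
rewrite -(Ex _ (mixed_rot ty)) in my; rewrite -(Ey _ (@pureX_rot s ty)) in pw.
have [g1 o1 t1 h1] := T1; have /andP[ox _] := o1.
have [Et q1 q2 q3] := mixed_mkX ox my; rewrite {}Et -ta in T1 e1 pw *.
have [N fN] := exists_fresh [:: mkX (~~ ty a) a s1 a' s2, mkX u a b c d & C1 ++ S].
have [ty1 [T2 e2 f2 ag [r0 r1 r2 r3 r4]]] := slide_typed fN T1 q1 pw.
have := fN; rewrite !fresh_mkX fresh_cat => /and5P[la ls1 la' ls2 /and5P[_ lb lc ld /andP[fC fS]]].
set A1 := mkX _ N d _ _ in T2 e2; set A2 := mkX _ (N + 2) c _ _ in T2 e2.
set w1 := mkX u _ _ _ _ in T2 e2; set A4 := mkX _ (N + 2) (N + 3) _ _ in T2 e2.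
have l2 : like [:: A1, A2, w1, A4 & C1 ++ S] (w1 :: [:: A1, A2, A4 & C1] ++ S).
  by apply: like_perm; apply/seq.permP => r /=; clear; blia.
have [T3 e3] := tst_like l2 T2.
have a2s1 : a2 = a'.
  have := a2y; rewrite -(Ex (fun x => a2 \in clabels x)); last first.
    by case=> [[[? ?] ?] ?]; rewrite /= !inE; clear; do !case: eqP => _ //=.
  rewrite mem_mkX !inE => /or4P[]/eqP E //.
  - by rewrite E aw in a2w.
  - by move: ta2; rewrite E q1 ta; case: (s).
  - by move: ta2; rewrite E q3 ta; case: (s).
have fCl x l : x \in C1 ++ S -> l \in clabels x -> l < N.
  by apply: fresh_cl; rewrite fresh_cat fC.
have X1 : path (share_typed_label ty1 s) x0 (rcons q w1).
  rewrite rcons_path; apply/andP; split.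
    apply: (sub_in_path (P := fun v => v \in C1 ++ S)) pth; last first.
      by apply/allP => z; rewrite inE => /orP[/eqP ->|/subq zC]; rewrite /= mem_cat ?x0S ?zC ?orbT.
    move=> v v' vC _ /shsP[l [lu lv tl]]; apply/shsP; exists l; split=> //.
    by rewrite -tl ag //; apply: fCl vC lu.
  apply/shsP; exists a2; split=> //; first by rewrite a2s1 mem_mkX !inE eqxx !orbT.
  by rewrite ag ?a2s1 // -a2s1.
have X2 : {subset q <= [:: A1, A2, A4 & C1]}.
  by move=> z /subq zC; rewrite !inE zC !orbT.
have X3 : all (mixed ty1) q.
  apply/allP=> z zq; have := allP mq _ zq; rewrite /mixed.
  have [_ E] := agreeb_all ag fC.
  by rewrite !E ?(subq _ zq).
have X4 : pure s ty1 w1.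
  by rewrite pureX_mkX r1 r4 r3 ag // q2 ta eqxx.
have [ty' [C' [w' [T4 e4 pw' [g3 g4 g5]]]]] := IH _ _ _ _ _ T3 x0S X1 uq X2 X3 X4.
exists ty', C', w'; split; [exact: T4| | by rewrite ta |].
  exact: lequiv_trans e1 (lequiv_trans e2 (lequiv_trans e3 e4)).
split; [|exact: g4|].
  by move=> l lS; rewrite g3 // ag //; apply: (allP fS).
move=> s'; apply: perm_trans (g5 s') _.
have [pb pc pd] : [/\ ty b = ty a, ty c = ty a & ty d = ty a].
  by move: pw; rewrite pureX_mkX => /and4P[_ /eqP -> /eqP -> /eqP ->].
have m1 : mixed ty1 A1 by apply: mixed_intro; rewrite ag // r0 pd negbK.
have m2 : mixed ty1 A2 by apply: mixed_intro; rewrite ag // r2 pc negbK.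
have m4 : mixed ty1 A4 by apply: mixed_intro; rewrite r3 r2 negbK.
rewrite /= !(mixed_pure _ m1) (mixed_pure _ m2) (mixed_pure _ m4) (filter_agree _ ag fC).
rewrite perm_sym; apply: perm_trans (perm_filter _ pC) _.
by rewrite /= -(Ex _ (@pureX_rot s' ty)) (mixed_pure _ my).
Qed.

Lemma tyok_cases ty x : typed_at ty x -> [\/ mixed ty x, pure true ty x | pure false ty x].
Proof. by rewrite /mixed; case: (pure true ty x) (pure false ty x) => [] [] _; [constructor 2|constructor 2|constructor 3|constructor 1]. Qed.

Lemma lconn_cons C x y : connected_labels C -> y \in C -> share_label y x -> connected_labels (x :: C).
Proof.
move=> lc yC /shP[l0 l0y l0x] P /= /andP[/cstP cx aC].
have h l : l \in labs (x :: C) -> P l = P l0.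
  move/lab_mem => [z]; rewrite inE => /orP[/eqP ->|zC] lz; first exact: cx.
  by apply: lc => //; apply/lab_mem; [exists z|exists y].
by move=> l l' /h -> /h ->.
Qed.

Lemma lconn_perm2 C C' : perm_eq C C' -> connected_labels C -> connected_labels C'.
Proof.
move=> p lc P; rewrite -(perm_all _ p) => /lc h l l'.
by rewrite -!(perm_mem (perm_labs p)); apply: h.
Qed.

(** If no pure crossing of [R] could be reached from [S] along edges of type [s] through mixed
    crossings, the edges so reached would split the part of type [s], which is connected. *)
Lemma reach_pure s ty R S : (forall x, x \in R ++ S -> typed_at ty x) -> type_connected s ty (R ++ S) ->
  all (pure s ty) S -> S <> [::] -> has (pure s ty) R ->
  exists x p w, [/\ x \in S, w \in R, pure s ty w &
    [/\ path (share_typed_label ty s) x (rcons p w), uniq p, {subset p <= R} & all (mixed ty) p]].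
Proof.
move=> ok tc pS S0 /hasP[w0 w0R pw0].
pose T l := exists x p, [/\ x \in S, path (share_typed_label ty s) x p, {subset p <= R}, all (mixed ty) p &
  l \in clabels (last x p) /\ ty l = s].
case: (excluded_middle_informative (exists x p w, [/\ x \in S, w \in R, pure s ty w &
    [/\ path (share_typed_label ty s) x (rcons p w), uniq p, {subset p <= R} & all (mixed ty) p]])) => // nf.
have found y l : y \in R -> pure s ty y -> l \in clabels y -> T l -> False.
  move=> yR py ly [x [p [xS pth sub mixed_dart [lp tl]]]]; apply: nf.
  have sy : share_typed_label ty s (last x p) y by apply/shsP; exists l.
  case/shortenP: pth sy => q pq uq sq sy; exists x, q, y; split=> //; split.
  - by rewrite rcons_path pq.
  - by case/andP: uq.
  - by move=> z /sq /sub.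
  - by apply/allP => z /sq /(allP mixed_dart).
have cl0 (x : crossing) : exists l, l \in clabels x.
  by case: x => [[[a b] d] e]; exists a; rewrite mem_head.
have cs : all (const_on_type s ty (fun l => pbool (T l))) (R ++ S).
  apply/allP => y yC.
  have key l l' : l \in clabels y -> l' \in clabels y -> ty l = s -> ty l' = s -> T l -> T l'.
    move=> ly l'y tl tl' Tl; have := yC; rewrite mem_cat => /orP[yR|yS]; last first.
      by exists y, [::]; split.
    have my : mixed ty y.
      case: (tyok_cases (ok _ yC)) => // py; exfalso.
        by case: (s) tl found => tl f; [apply: (f y l)|move: (allP py _ ly); rewrite tl].
      by case: (s) tl found => tl f; [move: (allP py _ ly); rewrite tl|apply: (f y l)].
    have [x [p [xS pth sub mixed_dart [lp _]]]] := Tl; exists x, (rcons p y); split=> //.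
    - by rewrite rcons_path pth; apply/shsP; exists l.
    - by move=> z; rewrite mem_rcons inE => /orP[/eqP ->|/sub].
    - by rewrite all_rcons my.
    - by rewrite last_rcons.
  apply/tcstP => l l' ly l'y tl tl'; apply/pboolP/pboolP; exact: key.
case: S S0 @T found cs ok tc pS nf => // s0 S _ T found cs ok tc pS nf.
have [l0 l0s] := cl0 s0; have [l1 l1w] := cl0 w0.
have t0 : ty l0 = s by case/andP: pS => /allP/(_ _ l0s)/eqP.
have t1 : ty l1 = s by have := allP pw0 _ l1w => /eqP.
have T0 : T l0 by exists s0, [::]; split; rewrite ?mem_head.
exfalso; apply: (found w0 l1) => //; apply/pboolP; rewrite -(tc _ cs l0 l1) //.
- exact/pboolP.
- by apply/lab_mem; exists s0; rewrite // mem_cat mem_head orbT.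
- by apply/lab_mem; exists w0; rewrite // mem_cat w0R.
Qed.

Lemma cluster_grow s ty R S : typing ty (R ++ S) -> all (pure s ty) S -> connected_labels S -> S <> [::] ->
  exists ty' R' S', [/\ typing ty' (R' ++ S'), lequiv (R ++ S) (R' ++ S'), all (pure s ty') S' &
    [/\ connected_labels S', S' <> [::], ~~ has (pure s ty') R' &
      perm_eq (filter (pure (~~ s) ty') R') (filter (pure (~~ s) ty) R)]].
Proof.
have [n le] := ubnP (count (pure s ty) R).
elim: n ty R S le => // n IH ty R S le T pS lS S0.
case hR : (has (pure s ty) R); last first.
  exists ty, R, S; split=> //; first exact: lequiv_refl.
  by split=> //; rewrite hR.
have [g o t h] := T.
have [x [p [w [xS wR pw [pth up sub mixed_dart]]]]] := reach_pure (fun x xC => allP o x xC) (t s) pS S0 hR.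
have pR := perm_to_rem wR.
have lk : like (R ++ S) (w :: rem w R ++ S).
  by apply: like_perm; rewrite -cat_cons perm_cat2r.
have [T1 e1] := tst_like lk T.
have sub' : {subset p <= rem w R}.
  move=> z zp; have := sub z zp; rewrite (perm_mem pR) inE => /orP[/eqP E|//].
  by move: (allP mixed_dart z zp); rewrite E => /mixed_pure h1; rewrite h1 in pw.
have [ty' [C' [w' [T2 e2 pw' [g3 [y yS shy] g5]]]]] := grow T1 xS pth up sub' mixed_dart pw.
have pur s' z : z \in S -> pure s' ty' z = pure s' ty z.
  by move=> zS; apply: eq_in_all => l lz; rewrite g3 //; apply/lab_mem; exists z.
have l3 : like (w' :: C' ++ S) (C' ++ (w' :: S)).
  by apply: like_perm; rewrite -cat_cons -[X in perm_eq _ X]cat_rcons perm_cat2r perm_sym perm_rcons.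
have [T3 e3] := tst_like l3 T2.
have cnt s' : count (pure s' ty') C' = count (pure s' ty) (rem w R).
  by rewrite -!size_filter; apply: perm_size.
have lt : count (pure s ty') C' < n.
  move: le; rewrite (seq.permP pR) /= pw add1n ltnS cnt; exact: leq_ltn_trans.
have p3 : all (pure s ty') (w' :: S).
  by rewrite /= pw'; apply/allP => z zS; rewrite pur // (allP pS).
have w0 : w' :: S <> [::] by [].
have [ty2 [R2 [S2 [T4 e4 p4 [q1 q2 q3 q4]]]]] := IH ty' C' (w' :: S) lt T3 p3 (lconn_cons lS yS shy) w0.
exists ty2, R2, S2; split=> //.
  exact: lequiv_trans e1 (lequiv_trans e2 (lequiv_trans e3 e4)).
split=> //; apply: perm_trans q4 (perm_trans (g5 _) _).
rewrite perm_sym; apply: perm_trans (perm_filter _ pR) _ => /=.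
have -> : pure (~~ s) ty w = false; last exact: perm_refl.
move: pw; case: (w) => [[[a b] c] d]; rewrite /pure /=.
by case: (s) (ty a) => [] [].
Qed.

(** The last conclusion leaves the pure crossings of the other type unchanged up to order, so a
    cluster gathered for one type survives the gathering for the other. *)
Lemma pure_cluster s ty C : typing ty C -> has (pure s ty) C ->
  exists ty' C', [/\ typing ty' C', lequiv C C', connected_labels (filter (pure s ty') C'),
   has (pure s ty') C' & perm_eq (filter (pure (~~ s) ty') C') (filter (pure (~~ s) ty) C)].
Proof.
move=> T /hasP[x xC px]; have pC := perm_to_rem xC.
have lk : like C (rem x C ++ [:: x]) by apply: like_perm; rewrite cats1 perm_sym perm_rcons perm_sym.
have [T1 e1] := tst_like lk T.
have np s1 ty1 (z : crossing) : pure s1 ty1 z -> pure (~~ s1) ty1 z = false.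
  by case: z => [[[a b] c] d]; rewrite /pure /=; case: s1 (ty1 a) => [] [].
have px1 : all (pure s ty) [:: x] by rewrite /= px.
have l1 : connected_labels [:: x].
  move=> P; rewrite /= andbT => /cstP h l l'; rewrite /labs /= cats0; exact: h.
have [ty' [R' [S' [T2 e2 p2 [l2 S0 nR pm]]]]] := cluster_grow T1 px1 l1 (fun E => match E with end).
exists ty', (R' ++ S'); split=> //.
- exact: lequiv_trans e1 e2.
- rewrite filter_cat (_ : filter _ R' = [::]) ?cat0s; last first.
    by apply/eqP; rewrite -[_ == _]negbK -has_filter.
  by rewrite (all_filterP p2).
- by rewrite has_cat; case: (S') S0 p2 => //= z S2 _ /andP[-> _]; rewrite orbT.
rewrite filter_cat (_ : filter (pure (~~ s) ty') S' = [::]) ?cats0; last first.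
  apply/eqP; rewrite -[_ == _]negbK -has_filter; apply/hasPn => z /(allP p2)/np ->; by [].
apply: perm_trans pm _; rewrite perm_sym; apply: perm_trans (perm_filter _ pC) _.
by rewrite /= (np _ _ _ px) perm_refl.
Qed.

(** * Bigons *)

Section Bigon.
Variables (C : seq crossing) (ty : nat -> bool).
Let D := Diagram C 0.
Local Notation turn := (@turn C).
Hypotheses (gC : good C) (okC : all (typed_at ty) C).

Let wlC : wellformed C. Proof. by case: gC. Qed.

Definition vertex (d : dart D) : crossing := nth (0, 0, 0, 0) C d.1.
Definition mixed_dart (d : dart D) : bool := mixed ty (vertex d).
Definition dart_type (d : dart D) : bool := ty (lab d).
(** An edge between a pure and a mixed crossing, seen from its pure end; [entry_dart] is the same
    edge seen from its mixed end. *)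
Definition exit_dart (d : dart D) : bool := ~~ mixed_dart d && mixed_dart (other d).
Definition entry_dart (d : dart D) : bool := mixed_dart d && ~~ mixed_dart (other d).

Lemma vx_mem d : vertex d \in C. Proof. exact: mem_nth. Qed.
Lemma lab_vx d : lab d \in clabels (vertex d). Proof. exact: lab_in. Qed.

Lemma td_other d : dart_type (other d) = dart_type d.
Proof. by rewrite /dart_type; have [_ ->] := other_spec wlC d. Qed.

Lemma mx_turn d : mixed_dart (turn d) = mixed_dart d. Proof. by []. Qed.

Lemma ord4_case (P : 'I_4 -> Prop) : P ord0 -> P (@Ordinal 4 1 isT) -> P (@Ordinal 4 2 isT) ->
  P (@Ordinal 4 3 isT) -> forall s, P s.
Proof.
move=> h0 h1 h2 h3 [[|[|[|[|m]]]] lt] //; [move: h0|move: h1|move: h2|move: h3];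
  by congr P; apply: val_inj.
Qed.

(** Neighboring slots have different types at a mixed crossing and equal types at a pure one. Along
    a face the type thus flips at the mixed crossings and nowhere else. *)
Lemma td_turn d : dart_type (turn d) = dart_type d (+) mixed_dart d.
Proof.
have := allP okC _ (vx_mem d); rewrite /dart_type /mixed_dart /lab /turn /vertex /=.
case: (nth _ C d.1) => [[[a b] c] e]; case: d => i s /=; rewrite /mixed /pure /=.
by elim/ord4_case: s => /=; case: (ty a) (ty b) (ty c) (ty e) => -[] [] [].
Qed.

Lemma same_vertex d d' : d'.1 = d.1 -> [\/ d' = d, d' = turn d, d' = turn (turn d) | turn d' = d].
Proof.
case: d d' => i s [j t] /= ->; rewrite /turn /=.
by elim/ord4_case: s; elim/ord4_case: t;
  ((constructor 1; congr (_, _); apply: val_inj; done) || (constructor 2; congr (_, _); apply: val_inj; done) ||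
   (constructor 3; congr (_, _); apply: val_inj; done) || (constructor 4; congr (_, _); apply: val_inj; done)).
Qed.

Local Notation f := (@facestep D).
Lemma fE d : f d = turn (other d). Proof. by []. Qed.
Lemma mx_f d : mixed_dart (f d) = mixed_dart (other d). Proof. by []. Qed.
Lemma td_f d : dart_type (f d) = dart_type d (+) mixed_dart (other d). Proof. by rewrite fE td_turn td_other. Qed.

Definition bigon d := [&& mixed_dart d, mixed_dart (f d) & f (f d) == d].

(** Along pure crossings the type cannot change, and the face has to come back to the mixed dart
    [d], so it leaves the cluster again with the type it entered with. *)
Lemma exit_of b d : entry_dart d -> dart_type d = b -> exists x, [/\ fconnect f d x, exit_dart x & dart_type x = b].
Proof.
move=> /andP[md nod] tb; apply: NNPP => none.
have Z k : ~~ mixed_dart (iter k.+1 f d) && (dart_type (iter k.+1 f d) == b).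
  elim: k => [|k /andP[IH1 /eqP IH2]]; first by rewrite /= mx_f nod td_f (negbTE nod) addbF tb eqxx.
  rewrite iterS mx_f td_f; case E : (mixed_dart (other (iter k.+1 f d))); last by rewrite addbF IH2 eqxx.
  by case: none; exists (iter k.+1 f d); rewrite fconnect_iter /exit_dart IH1 E.
have : fconnect f (f d) d by rewrite (facestep_sym wlC) fconnect1.
by move/iter_findex => E; have := Z (findex f (f d) d); rewrite iterSr E md.
Qed.

Lemma entry_of b d : exit_dart d -> dart_type d = b -> exists x, [/\ fconnect f d x, entry_dart x & dart_type x = b].
Proof.
move=> /andP[md mod] tb; apply: NNPP => none.
have cn k : fconnect f d (iter k.+1 f d) by exact: fconnect_iter.
have Z k : mixed_dart (iter k.+1 f d) || (dart_type (iter k.+1 f d) != b).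
  elim: k => [|k]; first by rewrite /= mx_f mod.
  rewrite [iter k.+2 f d]iterS; move: (iter k.+1 f d) (cn k) => x cx; rewrite mx_f td_f.
  case E : (mixed_dart (other x)) => //; rewrite addbF orFb.
  case mxx : (mixed_dart x); last by rewrite orFb.
  move=> _; apply/negP => /eqP tx.
  by case: none; exists x; rewrite cx /entry_dart mxx E.
have : fconnect f (f d) d by rewrite (facestep_sym wlC) fconnect1.
by move/iter_findex => E; have := Z (findex f (f d) d); rewrite iterSr E tb eqxx (negbTE md).
Qed.

Definition face_of (d : dart D) : {set dart D} := [set x | fconnect f d x].
(** With n mixed crossings and k exits the weights of all faces add up to 4 n + 2 k. The Euler count
    in [faces_ge] shows that this is at most 4 for each face that meets a mixed crossing. *)
Definition face_weight (O : {set dart D}) := #|[set x in O | mixed_dart x]| + #|[set x in O | exit_dart x]| + #|[set x in O | entry_dart x]|.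

Lemma card_ge (T : finType) (A : {set T}) (s : seq T) : uniq s -> {subset s <= A} -> size s <= #|A|.
Proof. by move=> /card_uniqP <- h; apply: subset_leq_card; apply/subsetP. Qed.

Lemma wt_entry d y : fconnect f d y -> entry_dart y -> exists x,
  [/\ fconnect f d x, exit_dart x, dart_type x = dart_type y & f x != y] /\
  [/\ 2 <= #|[set x in face_of d | mixed_dart x]|, 1 <= #|[set x in face_of d | exit_dart x]| & 1 <= #|[set x in face_of d | entry_dart x]|].
Proof.
move=> cy ey; have [x [cx px tx]] := exit_of ey erefl.
have dx := connect_trans cy cx; have ey' := ey; move/andP: ey' => [my noy].
have px' := px; move/andP: px' => [nx ox].
have ne : f x != y.
  by apply: contraTneq isT => E; move: (td_f x); rewrite E tx ox; case: (dart_type y).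
exists x; split; first by split.
split.
- apply: (@card_ge _ _ [:: f x; y]); first by rewrite /= inE ne.
  move=> z; rewrite !inE => /orP[]/eqP ->.
    by rewrite mx_f ox andbT; apply: connect_trans dx (fconnect1 _ _).
  by rewrite cy my.
- by apply: (@card_ge _ _ [:: x]) => // z; rewrite !inE => /eqP ->; rewrite dx px.
- by apply: (@card_ge _ _ [:: y]) => // z; rewrite !inE => /eqP ->; rewrite cy ey.
Qed.

(** A face that enters a cluster has two mixed darts, an exit and an entry. Any other face through a
    mixed dart is mixed throughout; types alternate along it, so its length is even, and it is not
    2. *)
Lemma wt_ge4 d : (forall d, ~~ bigon d) -> mixed_dart d -> 4 <= face_weight (face_of d).
Proof.
move=> nb md; case: (pickP [pred y | fconnect f d y && entry_dart y]) => [y /andP[cy ey]|none].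
  have [x [_ [h1 h2 h3]]] := wt_entry cy ey.
  by rewrite /face_weight (leq_add (leq_add h1 h2) h3).
have stays x : fconnect f d x -> mixed_dart x -> [/\ fconnect f d (f x), mixed_dart (f x) & dart_type (f x) = ~~ dart_type x].
  move=> cx mxx; have := none x; rewrite /= cx /entry_dart mxx /= => /negbFE ox.
  by rewrite mx_f td_f ox addbT; split=> //; apply: connect_trans cx (fconnect1 _ _).
have [c1 m1 t1] := stays d (connect0 _ _) md; have [c2 m2 t2] := stays _ c1 m1; have [c3 m3 t3] := stays _ c2 m2.
rewrite /face_weight -addnA; apply: leq_trans (leq_addr _ _).
have n2 : f (f d) != d by have := nb d; rewrite /bigon md m1.
apply: (@card_ge _ _ [:: d; f d; f (f d); f (f (f d))]).
  have tne x y : dart_type x = ~~ dart_type y -> (x == y) = false by move=> E; apply/eqP => xy; move: E; rewrite xy; case: (dart_type y).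
  rewrite /= !inE (eq_sym d) (tne (f d) d) // (eq_sym d) (negbTE n2) (eq_sym d) (tne (f (f (f d))) d) ?t3 ?t2 ?negbK //.
  rewrite (eq_sym (f d)) (tne (f (f d)) (f d)) // (inj_eq (facestep_inj wlC)) (eq_sym d) (negbTE n2).
  by rewrite (eq_sym (f (f d))) (tne (f (f (f d)))) //.
move=> z; rewrite !inE => /or4P[]/eqP ->; by rewrite ?connect0 ?c1 ?c2 ?c3 ?md ?m1 ?m2 ?m3.
Qed.

Let p2 := (otherP wlC * turnP C)%g.

Lemma p2E d : p2 d = f d. Proof. exact: facestepP. Qed.

Lemma orbE d : porbit p2 d = face_of d.
Proof.
apply/setP => x; rewrite inE -fconnect_porbit.
by apply: eq_connect => y z /=; rewrite p2E.
Qed.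

(** [pure_turn] and [clear_other] describe the map formed by the clusters alone: every mixed dart
    becomes an isolated vertex, and an edge is kept when both its ends are pure, while the ends of a
    cut edge become fixed points. *)
Definition pure_turn (d : dart D) : dart D := if mixed_dart d then d else turn d.
Definition clear_other (d : dart D) : dart D := if mixed_dart d || mixed_dart (other d) then d else other d.

Lemma pure_turn_inj : injective pure_turn.
Proof.
move=> d e; rewrite /pure_turn; case md : (mixed_dart d); case me : (mixed_dart e) => //.
- by move=> E; rewrite E mx_turn me in md.
- by move=> E; rewrite -E mx_turn md in me.
- exact: turn_inj.
Qed.

Lemma clear_otherK : involutive clear_other.
Proof.
move=> d; rewrite /clear_other; case h : (mixed_dart d || mixed_dart (other d)); first by rewrite h.
by rewrite (otherK wlC) orbC h.
Qed.

Definition pure_turnP := perm pure_turn_inj.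
Definition clear_otherP := perm (inv_inj clear_otherK).

Lemma sum_orbits (X : {set dart D}) : \sum_(O in porbits p2) #|O :&: X| = #|X|.
Proof.
rewrite -[X in RHS](setTI X).
have tr : trivIset (porbits p2).
  apply/trivIsetP => A B /imsetP[x _ ->] /imsetP[y _ ->]; rewrite -setI_eq0 eq_porbit_mem => ne.
  apply/eqP/setP => z; rewrite !inE; apply/negP => /andP[zx zy]; case/negP: ne.
  by rewrite -eq_porbit_mem; rewrite -!eq_porbit_mem in zx zy; rewrite -(eqP zx) (eqP zy).
have cov : cover (porbits p2) = setT.
  apply/setP=> x; rewrite inE; apply/bigcupP; exists (porbit p2 x); last exact: porbit_id.
  exact: imset_f.
rewrite -cov -sum1_card.
rewrite (eq_bigl (fun x => (x \in cover (porbits p2)) && (x \in X))); last by move=> x; rewrite inE.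
rewrite (big_trivIset_cond _ tr); apply: eq_bigr => O _.
by rewrite -sum1_card; apply: eq_bigl => x; rewrite inE.
Qed.

Lemma card_vertices (Q : pred crossing) : #|[set d : dart D | Q (vertex d)]| = 4 * count Q C.
Proof.
have -> : [set d : dart D | Q (vertex d)] = setX [set i : 'I_(ncross D) | Q (nth (0,0,0,0) C i)] [set: 'I_4].
  by apply/setP => -[i s]; rewrite !inE andbT.
rewrite cardsX cardsT card_ord mulnC; congr (_ * _).
rewrite -sum1dep_card -sum1_count (big_nth (0,0,0,0)) big_mkord /=.
by apply: eq_bigl.
Qed.

Let n := count (mixed ty) C.
Let p := count (predC (mixed ty)) C.

Lemma card_mx : #|[set d | mixed_dart d]| = 4 * n. Proof. exact: card_vertices. Qed.
Lemma card_pure : #|[set d | ~~ mixed_dart d]| = 4 * p. Proof. exact: card_vertices. Qed.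

Lemma card_en : #|[set d | entry_dart d]| = #|[set d | exit_dart d]|.
Proof.
rewrite -(card_imset _ (inv_inj (otherK wlC))); apply: eq_card => d.
apply/imsetP/idP => [[x + ->]|].
  by rewrite !inE /entry_dart /exit_dart (otherK wlC) andbC.
rewrite inE /exit_dart => h; exists (other d); last by rewrite (otherK wlC).
by rewrite inE /entry_dart (otherK wlC) andbC.
Qed.

Let clr (d : dart D) := ~~ mixed_dart d && ~~ mixed_dart (other d).

Lemma card_clr : #|[set d | clr d]| + #|[set d | exit_dart d]| = 4 * p.
Proof.
rewrite -card_pure -[RHS](cardsID [set d | mixed_dart (other d)]) addnC; congr addn; apply: eq_card => d.
  by rewrite !inE.
by rewrite !inE andbC.
Qed.

Lemma porbits_pure_turn : 4 * n + p <= #|porbits pure_turnP|.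
Proof.
rewrite -n_comp_porbits.
pose c (d : dart D) : dart D + 'I_(ncross D) := if mixed_dart d then inl d else inr d.1.
apply: leq_trans (n_comp_ge_fun (c := c) (fconnect_sym (@perm_inj _ pure_turnP)) _); last first.
  move=> x y /eqP <-; rewrite permE /pure_turn /c; case mxx : (mixed_dart x); first by rewrite mxx.
  by rewrite mx_turn mxx.
pose A : {set dart D + 'I_(ncross D)} := [set inl d | d in [set d | mixed_dart d]].
pose B : {set dart D + 'I_(ncross D)} := [set inr i | i in [set i : 'I_(ncross D) | ~~ mixed ty (nth (0,0,0,0) C i)]].
have cA : #|A| = 4 * n by rewrite card_imset ?card_mx // => x y [].
have cB : #|B| = p.
  rewrite card_imset; last by move=> x y [].
  rewrite -sum1dep_card /p -sum1_count (big_nth (0,0,0,0)) big_mkord /=.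
  by apply: eq_bigl.
rewrite -cA -cB -cardsUI (_ : A :&: B = set0) ?cards0 ?addn0; last first.
  by apply/setP => z; rewrite !inE; apply/negP => /andP[/imsetP[x _ ->] /imsetP[y _]].
apply: subset_leq_card; apply/subsetP => z; rewrite inE => /orP[]/imsetP[x]; rewrite inE => hx ->.
  by apply/imsetP; exists x => //; rewrite /c hx.
apply/imsetP; exists (x, ord0) => //; by rewrite /c /mixed_dart /vertex (negbTE hx).
Qed.

Lemma porbits_clear_other : 2 * #|{: dart D}| <= 2 * #|porbits clear_otherP| + #|[set d | clr d]|.
Proof.
have ia : involutive clear_otherP by move=> d; rewrite !permE clear_otherK.
have := porbits_involutive ia; have : #|{: dart D}| <= #|[set x | clear_otherP x == x]| + #|[set d | clr d]|.
  rewrite -cardsT -cardsUI; apply: leq_trans (leq_addr _ _); apply: subset_leq_card.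
  apply/subsetP => x _; rewrite !inE permE /clear_other /clr -negb_or.
  by case: ifP => _; rewrite ?eqxx ?orbT.
move=> h1 h2; rewrite mul2n -addnn; apply: leq_trans (leq_add (leqnn _) h1) _.
by rewrite addnA leq_add2r.
Qed.

Hypothesis tcC : forall s, type_connected s ty C.
Hypothesis bothC : forall s, has (pure s ty) C.
Hypothesis lcC : forall s, connected_labels (filter (pure s ty) C).

Lemma pure_td d : ~~ mixed_dart d -> pure (dart_type d) ty (vertex d).
Proof.
move=> md; have := lab_vx d; have ok := allP okC _ (vx_mem d).
rewrite /dart_type => ld; case: (tyok_cases ok) => [m|h|h]; first by rewrite /mixed_dart m in md.
  by rewrite (eqP (allP h _ ld)).
by rewrite (eqP (allP h _ ld)).
Qed.

Lemma dart_of x l : x \in C -> l \in clabels x -> exists d, vertex d = x /\ lab d = l.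
Proof.
move=> xC lx; have ix : index x C < ncross D by rewrite index_mem.
have il : index l (clabels x) < 4 by rewrite -(size_clabels x) index_mem.
exists (Ordinal ix, Ordinal il); have E : vertex (Ordinal ix, Ordinal il) = x by rewrite /vertex /= nth_index.
by split=> //; rewrite /lab -/(vertex _) E /= nth_index.
Qed.

Lemma pure_dart s : exists d, ~~ mixed_dart d /\ dart_type d = s.
Proof.
have /hasP[x xC px] := bothC s; have [l lx] : exists l, l \in clabels x.
  by case: (x) => [[[a b] c] e]; exists a; rewrite mem_head.
have [d [vd ld]] := dart_of xC lx; exists d; split; last by rewrite /dart_type ld; exact/eqP/(allP px).
rewrite /mixed_dart vd; apply/negP => /(mixed_pure s); by rewrite px.
Qed.

(** A cluster without exits would be closed under adjacency, against the connectedness of the whole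
    diagram. *)
Lemma exit_exists b : exists d, exit_dart d /\ dart_type d = b.
Proof.
apply: NNPP => none.
pose Q l := has (fun x => pure b ty x && (l \in clabels x)) C.
have cs : all (const_at Q) C.
  apply/allP => x xC; apply/cstP => l l' lx l'x.
  have key k k' : k \in clabels x -> k' \in clabels x -> Q k -> Q k'.
    move=> kx k'x /hasP[y yC /andP[py ky]]; have [d [vd ld]] := dart_of yC ky.
    have [d' [vd' ld']] := dart_of xC kx.
    have md : ~~ mixed_dart d by rewrite /mixed_dart vd; apply/negP => /(mixed_pure b); rewrite py.
    have tb : dart_type d = b by rewrite /dart_type ld; exact/eqP/(allP py).
    have mo : ~~ mixed_dart (other d) by apply/negP => mo; apply: none; exists d; rewrite /exit_dart md mo.
    have [E|E] := other_lab wlC (etrans ld' (esym ld)).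
      by apply/hasP; exists x => //; rewrite k'x andbT -vd' E vd.
    apply/hasP; exists x => //; rewrite k'x andbT -vd' E -tb -td_other; exact: pure_td.
  by apply/idP/idP; apply: key.
have [_ lc _ _] := gC; have [d [md tb]] := pure_dart b; have [d' [md' tb']] := pure_dart (~~ b).
have : Q (lab d').
  rewrite -(lc _ cs (lab d)) ?lab_labs //; apply/hasP; exists (vertex d); first exact: vx_mem.
  by rewrite lab_vx -tb pure_td.
case/hasP => x xC /andP[px lx]; move: tb'; rewrite /dart_type (eqP (allP px _ lx)).
by case: (b).
Qed.

Let F0 := [set O in porbits p2 | [forall x in O, ~~ mixed_dart x]].
Let F1 := [set O in porbits p2 | ~~ [forall x in O, ~~ mixed_dart x]].

Lemma faces_split : #|F0| + #|F1| = n + p + 2.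
Proof.
have -> : n + p + 2 = #|porbits p2|.
  by rewrite -nfaces_porbits; have [_ _ _ ->] := gC; rewrite /n /p count_predC.
rewrite -[RHS](cardsID [set O : {set dart D} | [forall x in O, ~~ mixed_dart x]]); congr addn; apply: eq_card => O.
  by rewrite !inE.
by rewrite !inE andbC.
Qed.

(** Faces without mixed darts are kept, and each mixed dart is a cycle by itself. The cut faces
    around a cluster join into boundary cycles that remember only the type; an exit of each type
    shows that both types occur, which gives the 2. *)
Lemma porbits_clear_faces : #|F0| + 4 * n + 2 <= #|porbits (clear_otherP * pure_turnP)%g|.
Proof.
rewrite -n_comp_porbits.
pose c (d : dart D) : {set dart D} + dart D + bool :=
  if mixed_dart d then inl (inr d) else if [forall x in porbit p2 d, ~~ mixed_dart x] then inl (inl (porbit p2 d)) else inr (dart_type d).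
apply: leq_trans (n_comp_ge_fun (c := c) (fconnect_sym (@perm_inj _ _)) _); last first.
  move=> x y /eqP <-; rewrite permM !permE /clear_other /pure_turn /c.
  case mxx : (mixed_dart x); first by rewrite /= mxx mxx.
  case mox : (mixed_dart (other x)) => /=.
    rewrite mxx mx_turn mxx.
    have h1 : [forall z in porbit p2 x, ~~ mixed_dart z] = false.
      apply/negbTE/negP => /forall_inP/(_ (f x)); rewrite mx_f mox => h; apply: (negP (h _)) => //.
      by rewrite -p2E -[p2 x]/((p2 ^+ 1)%g x) mem_porbit.
    have h2 : [forall z in porbit p2 (turn x), ~~ mixed_dart z] = false.
      apply/negbTE/negP => /forall_inP/(_ (other x)); rewrite mox => h; apply: (negP (h _)) => //.
      rewrite porbit_sym; have -> : turn x = p2 (other x) by rewrite p2E fE (otherK wlC).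
      by rewrite -[p2 _]/((p2 ^+ 1)%g _) mem_porbit.
    by rewrite h1 h2 td_turn mxx addbF.
  rewrite mox mx_turn mox; have -> : turn (other x) = p2 x by rewrite p2E.
  have -> : porbit p2 (p2 x) = porbit p2 x.
    by apply/eqP; rewrite eq_porbit_mem -[p2 x]/((p2 ^+ 1)%g x) mem_porbit.
  by rewrite p2E td_f mox addbF.
pose A : {set {set dart D} + dart D + bool} := [set inl (inl O) | O in F0].
pose B : {set {set dart D} + dart D + bool} := [set inl (inr d) | d in [set d | mixed_dart d]].
pose E : {set {set dart D} + dart D + bool} := [set inr b | b in [set: bool]].
have cA : #|A| = #|F0| by rewrite card_imset // => x y [].
have cB : #|B| = 4 * n by rewrite card_imset ?card_mx // => x y [].
have cE : #|E| = 2 by rewrite card_imset ?cardsT ?card_bool // => x y [].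
have dAB : A :&: B = set0.
  by apply/setP => z; rewrite !inE; apply/negP => /andP[/imsetP[x _ ->] /imsetP[y _]].
have dE : (A :|: B) :&: E = set0.
  by apply/setP => z; rewrite !inE; apply/negP => /andP[/orP[]/imsetP[x _ ->] /imsetP[y _]].
have -> : #|F0| + 4 * n + 2 = #|A :|: B :|: E|.
  by rewrite cardsU dE cards0 subn0 cardsU dAB cards0 subn0 cA cB cE.
apply: subset_leq_card; apply/subsetP => z; rewrite !inE -orbA => /or3P[]/imsetP[x]; rewrite ?inE.
- move=> /andP[/imsetP[d _ ->] h] ->; apply/imsetP; exists d => //; rewrite /c h.
  by rewrite (negbTE (forall_inP h d (porbit_id p2 d))).
- by move=> mxx ->; apply/imsetP; exists x => //; rewrite /c mxx.
- move=> _ ->; have [d [/andP[md mo] tb]] := exit_exists x; apply/imsetP; exists d => //.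
  rewrite /c (negbTE md) tb; case: ifP => // /forall_inP/(_ (f d)); rewrite mx_f mo => h.
  by case: (negP (h _)) => //; rewrite -p2E -[p2 d]/((p2 ^+ 1)%g d) mem_porbit.
Qed.

(** One component for each mixed dart and one for each cluster; connectedness of the clusters enters
    here. *)
Lemma comps_le : n_comp (gen_rel pure_turnP clear_otherP) predT <= 4 * n + 2.
Proof.
have [d1 [md1 td1]] := pure_dart true; have [d2 [md2 td2]] := pure_dart false.
pose db b := if b then d1 else d2.
have mdb b : ~~ mixed_dart (db b) by case: b.
have tdb b : dart_type (db b) = b by case: b.
have sym : connect_sym (gen_rel pure_turnP clear_otherP) by exact: gen_rel_sym.
have cturn d : ~~ mixed_dart d -> connect (gen_rel pure_turnP clear_otherP) d (turn d).
  by move=> md; apply: connect1; rewrite /gen_rel !permE /pure_turn (negbTE md) eqxx.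
have cvert d d' : ~~ mixed_dart d -> d'.1 = d.1 -> connect (gen_rel pure_turnP clear_otherP) d d'.
  move=> md E; case: (same_vertex E) => [->|->|->|E2]; first exact: connect0.
  - exact: cturn.
  - by apply: connect_trans (cturn _ md) (cturn _ _); rewrite mx_turn.
  - by rewrite sym -E2; apply: cturn; rewrite -mx_turn E2.
have cother d d' : ~~ mixed_dart d -> ~~ mixed_dart d' -> lab d' = lab d -> connect (gen_rel pure_turnP clear_otherP) d d'.
  move=> md md' /(other_lab wlC)[->|E]; first exact: connect0.
  apply: connect1; rewrite /gen_rel !permE /clear_other (negbTE md) -E (negbTE md') /= eqxx orbT //.
apply: leq_trans (_ : #|[set d | mixed_dart d] :|: [set d1; d2]| <= _); last first.
  apply: leq_trans (leq_card_setU _ _) _; rewrite card_mx leq_add2l.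
  by rewrite cards2; case: (_ != _).
apply: n_comp_le_set => // x; case mxx : (mixed_dart x); first by exists x; rewrite ?inE ?mxx ?connect0.
exists (db (dart_type x)); first by rewrite !inE /db; case: (dart_type x); rewrite eqxx ?orbT.
rewrite sym; set b := dart_type x.
pose P l := [exists d, [&& ~~ mixed_dart d, lab d == l & connect (gen_rel pure_turnP clear_otherP) (db b) d]].
have cs : all (const_at P) (filter (pure b ty) C).
  apply/allP => y; rewrite mem_filter => /andP[py yC]; apply/cstP => l l' ly l'y.
  have key k k' : k \in clabels y -> k' \in clabels y -> P k -> P k'.
    move=> ky k'y /existsP[d /and3P[md /eqP ld cd]]; apply/existsP.
    have [e [ve le]] := dart_of yC ky; have [e' [ve' le']] := dart_of yC k'y.
    have me : ~~ mixed_dart e by rewrite /mixed_dart ve; apply/negP => /(mixed_pure b); rewrite py.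
    have me' : ~~ mixed_dart e' by rewrite /mixed_dart ve'; apply/negP => /(mixed_pure b); rewrite py.
    have [i ei] : exists i : 'I_(ncross D), y = nth (0,0,0,0) C i by exists e.1.
    pose e2 : dart D := (e.1, e'.2).
    have ve2 : vertex e2 = y by rewrite /vertex /= -/(vertex e).
    have le2 : lab e2 = k' by rewrite /lab -/(vertex e2) ve2 /= -le' /lab -/(vertex e') ve'.
    exists e2; rewrite le2 eqxx /=; apply/andP; split; first by rewrite /mixed_dart ve2 -ve.
    apply: connect_trans cd _; apply: connect_trans (cother d e md me _) (cvert e e2 me _) => //.
    by rewrite le ld.
  by apply/idP/idP; apply: key.
have inF d : ~~ mixed_dart d -> dart_type d = b -> lab d \in labs (filter (pure b ty) C).
  move=> md tb; apply/lab_mem; exists (vertex d); last exact: lab_vx.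
  by rewrite mem_filter vx_mem andbT -tb pure_td.
have := lcC cs (inF _ (mdb b) (tdb b)) (inF x (negbT mxx) erefl).
have -> : P (lab (db b)) by apply/existsP; exists (db b); rewrite mdb eqxx connect0.
move/esym/existsP => [d /and3P[md /eqP ld cd]].
by apply: connect_trans cd (cother _ _ md (negbT mxx) _).
Qed.

(** With k exits, Euler's inequality for the clusters reads 2 F0 + k <= 2 p + 4, while the whole
    diagram has F0 + F1 = n + p + 2. *)
Lemma faces_ge : 4 * n + 2 * #|[set d | exit_dart d]| <= 4 * #|F1|.
Proof.
have ia : involutive clear_otherP by move=> d; rewrite !permE clear_otherK.
have h1 := genus_le pure_turnP ia; have h2 := porbits_pure_turn; have h3 := porbits_clear_other; have h4 := porbits_clear_faces.
have h5 := comps_le; have h6 := card_clr; have h7 := faces_split.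
rewrite -/(#|{: dart D}|) in h1.
move: h1 h2 h3 h4 h5 h6 h7.
move: (#|porbits pure_turnP|) (#|porbits clear_otherP|) (#|porbits (clear_otherP * pure_turnP)|) (n_comp _ _) (#|[set d | clr d]|)
  (#|[set d | exit_dart d]|) (#|F0|) (#|F1|) => a b c k x y z w.
by clear; lia.
Qed.

Hypothesis nobigon : forall d, ~~ bigon d.

Lemma F1_orb O : O \in F1 -> exists2 d, mixed_dart d & O = face_of d.
Proof.
rewrite inE => /andP[/imsetP[d0 _ ->] /forall_inPn[d dO /negPn md]]; exists d => //.
by rewrite -orbE; apply/eqP; rewrite eq_porbit_mem porbit_sym.
Qed.

(** Every weight is at least 4 and the average is at most 4. *)
Lemma F1_wt O : O \in F1 -> face_weight O = 4.
Proof.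
have ge4 Q : Q \in F1 -> 4 <= face_weight Q by move=> /F1_orb[d md ->]; apply: wt_ge4.
have tot : \sum_(Q in F1) face_weight Q <= 4 * #|F1|.
  apply: leq_trans faces_ge.
  have -> : 4 * n + 2 * #|[set d | exit_dart d]| = \sum_(Q in porbits p2) face_weight Q.
    rewrite mul2n -addnn -{2}card_en -card_mx addnA -!sum_orbits -!big_split /=.
    by apply: eq_bigr => Q _; rewrite /face_weight !setIdE.
  rewrite [X in _ <= X](bigID (mem F1)) /=; apply: leq_trans (leq_addr _ _).
  rewrite leq_eqVlt; apply/orP; left; apply/eqP; apply: eq_bigl => Q.
  by rewrite inE; case: (Q \in porbits p2).
move=> OF; apply/eqP; rewrite eqn_leq ge4 // andbT leqNgt; apply/negP => lt.
have : \sum_(Q in F1 | Q != O) 4 <= \sum_(Q in F1 | Q != O) face_weight Q.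
  by apply: leq_sum => Q /andP[QF _]; apply: ge4.
have E : \sum_(Q in F1) 4 = 4 + \sum_(Q in F1 | Q != O) 4 by rewrite (bigD1 O).
move=> leS; move: tot; rewrite (bigD1 O) //= mulnC -sum_nat_const E => tot.
have := leq_trans (leq_add lt leS) tot; by rewrite addSn ltnn.
Qed.

(** Weight 4 leaves room for two mixed darts, one exit and one entry. So after the exit [e] the face
    meets exactly two mixed crossings and goes straight back to a pure crossing of the type it
    left. *)
Lemma exit_next b e : exit_dart e -> dart_type e = b ->
  [/\ mixed_dart (f e), dart_type (f e) = ~~ b, mixed_dart (f (f e)), exit_dart (other (f (f e))) & dart_type (other (f (f e))) = b].
Proof.
move=> pee tb; have [y [cy ey ty_]] := entry_of pee tb.
have pe' := pee; move/andP: pe' => [me moe].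
have mf : mixed_dart (f e) by rewrite mx_f.
have tf : dart_type (f e) = ~~ b by rewrite td_f moe addbT tb.
have OF : face_of e \in F1.
  rewrite inE -orbE imset_f //=; apply/forall_inPn; exists (f e); last by rewrite negbK.
  by rewrite orbE inE fconnect1.
have w4 := F1_wt OF.
have [x [_ [h1 h2 h3]]] := wt_entry cy ey.
have my : mixed_dart y by case/andP: ey.
have fy : f e != y by apply: contraTneq isT => E; move: tf; rewrite E ty_; case: (b).
have [c1 c2] : #|[set x in face_of e | mixed_dart x]| = 2 /\ #|[set x in face_of e | entry_dart x]| = 1.
  by move: w4 h1 h2 h3; rewrite /face_weight; clear; lia.
have only2 z : fconnect f e z -> mixed_dart z -> z = f e \/ z = y.
  move=> cz mz; case: (eqVneq z (f e)) => [->|n1]; first by left.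
  case: (eqVneq z y) => [->|n2]; first by right.
  have : 3 <= #|[set x in face_of e | mixed_dart x]|; last by rewrite c1.
  apply: (@card_ge _ _ [:: z; f e; y]); first by rewrite /= !inE negb_or n1 n2 fy.
  by move=> v; rewrite !inE => /or3P[]/eqP ->; rewrite ?cz ?mz ?cy ?my ?fconnect1 ?mf.
have nen : ~~ entry_dart (f e).
  apply/negP => en1; have : 2 <= #|[set x in face_of e | entry_dart x]|; last by rewrite c2.
  apply: (@card_ge _ _ [:: f e; y]); first by rewrite /= !inE fy.
  by move=> v; rewrite !inE => /orP[]/eqP ->; rewrite ?cy ?ey ?fconnect1 ?en1.
have mff : mixed_dart (f (f e)) by move: nen; rewrite /entry_dart mf /= negbK mx_f.
have cff : fconnect f e (f (f e)) by apply: connect_trans (fconnect1 _ _) (fconnect1 _ _).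
have [E|E] := only2 _ cff mff.
  by move: (td_f (f e)); rewrite E -mx_f mff addbT; case: (dart_type (f e)).
rewrite E td_other ty_; split=> //.
by move: ey; rewrite /entry_dart /exit_dart (otherK wlC) andbC.
Qed.

(** By [exit_next] the edges crossed right after the exits of the upper cluster follow one another
    and close up around it. They are of lower type and meet only mixed crossings, so they would form
    a part of the lower layer cut off from its pure crossings, although that layer is connected. *)
Lemma no_bigon_absurd : False.
Proof.
pose E : {set dart D} := [set e | exit_dart e && dart_type e].
pose next_exit e := other (f (f e)).
have nE e : e \in E -> next_exit e \in E.
  by rewrite !inE => /andP[pee tde]; have [_ _ _ -> ->] := exit_next pee tde.
have ninj : injective next_exit.
  by move=> x y /(inv_inj (otherK wlC))/(facestep_inj wlC)/(facestep_inj wlC).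
have nsurj e : e \in E -> exists2 e0, e0 \in E & next_exit e0 = e.
  suff Eim : next_exit @: E = E by rewrite -{1}Eim => /imsetP[x xE ->]; exists x.
  apply/eqP; rewrite eqEcard card_imset // leqnn andbT.
  by apply/subsetP => z /imsetP[x xE ->]; exact: nE.
pose P l := [exists e in E, lab (f e) == l].
have vert e d : e \in E -> d.1 = (other e).1 -> ~~ dart_type d -> P (lab d).
  move=> eE; have := eE; rewrite inE => /andP[/andP[me mo] te] E1 ntd.
  have to : dart_type (other e) by rewrite td_other.
  case: (same_vertex E1) => E2.
  - by rewrite E2 to in ntd.
  - by apply/existsP; exists e; rewrite eE E2 fE eqxx.
  - by move: ntd; rewrite E2 !td_turn mx_turn mo to.
  have [e0 e0E ne0] := nsurj e eE; apply/existsP; exists e0; rewrite e0E /=.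
  have : turn d = turn (other (f e0)) by rewrite E2 -ne0 /next_exit (otherK wlC).
  by move/turn_inj => ->; have [_ ->] := other_spec wlC (f e0).
have Pv d : P (lab d) -> exists2 e, e \in E & d.1 = (other e).1.
  case/existsP => e /andP[eE /eqP]; case/(other_lab wlC) => [Ed|Ed].
    by exists e; rewrite // -Ed.
  exists (next_exit e); first exact: nE.
  by rewrite /next_exit (otherK wlC) -[d](otherK wlC) -Ed.
have cs : all (const_on_type false ty P) C.
  apply/allP => x xC; apply/tcstP => l l' lx l'x tl tl'.
  have key k k' : k \in clabels x -> k' \in clabels x -> ty k' = false -> P k -> P k'.
    move=> kx k'x tk' Pk; have [d [vd ld]] := dart_of xC kx; have [d' [vd' ld']] := dart_of xC k'x.
    have [e eE Ed] : exists2 e, e \in E & d.1 = (other e).1 by apply: Pv; rewrite ld.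
    pose d2 : dart D := (d.1, d'.2).
    have vd2 : vertex d2 = x by rewrite /vertex /= -/(vertex d).
    have ld2 : lab d2 = k' by rewrite /lab -/(vertex d2) vd2 /= -ld' /lab -/(vertex d') vd'.
    by rewrite -ld2; apply: (vert e) => //; rewrite /dart_type ld2 tk'.
  by apply/idP/idP; apply: key.
have [e [pee te]] := exit_exists true; have eE : e \in E by rewrite inE pee te.
have [mf tf _ _ _] := exit_next pee te.
have Pf : P (lab (f e)) by apply/existsP; exists e; rewrite eE eqxx.
have [d [md tdd]] := pure_dart false.
have : P (lab d) by rewrite -(tcC cs (lab_labs (f e)) (lab_labs d)).
case/Pv => e1; rewrite inE => /andP[/andP[_ mo] _] Ed; move: md; rewrite /mixed_dart /vertex Ed -/(vertex (other e1)).
by rewrite -/(mixed_dart _) mo.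
Qed.

End Bigon.

Lemma bigon_exists C ty : typing ty C -> (forall s, has (pure s ty) C) ->
  (forall s, connected_labels (filter (pure s ty) C)) -> exists d : dart (Diagram C 0), bigon ty d.
Proof.
case=> g o t _ h l; apply: NNPP => nb; apply: (no_bigon_absurd g o t h l).
by move=> d; apply/negP => bd; apply: nb; exists d.
Qed.

Lemma perm_nth2 (C : seq crossing) i j : i < size C -> j < size C -> i != j ->
  exists C0, perm_eq C [:: nth (0,0,0,0) C i, nth (0,0,0,0) C j & C0].
Proof.
set x0 := (0,0,0,0).
have p k : k < size C -> perm_eq C (nth x0 C k :: (take k C ++ drop k.+1 C)).
  move=> lk; rewrite -{1}(cat_take_drop k C) (drop_nth x0 lk).
  by rewrite -cat_rcons -cat_cons perm_cat2r perm_rcons.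
move=> li lj ij; have jm : nth x0 C j \in take i C ++ drop i.+1 C.
  rewrite mem_cat; move: ij; rewrite neq_ltn => /orP[ij|ji].
    apply/orP; right; rewrite -(subnKC ij) -nth_drop mem_nth // size_drop.
    by rewrite ltn_sub2r // (leq_ltn_trans ij).
  by apply/orP; left; rewrite -(nth_take x0 ji) mem_nth // size_take li.
exists (rem (nth x0 C j) (take i C ++ drop i.+1 C)).
by apply: perm_trans (p i li) _; rewrite perm_cons; exact: perm_to_rem.
Qed.

Definition bigonD a1 a2 b1 b2 e1 e2 C0 : seq crossing := [:: (a2, e1, e2, a1), (e2, e1, b2, b1) & C0].

Lemma shape_under ty C (d : dart (Diagram C 0)) : typed_at ty (vertex d) -> ty (lab d) = false ->
  ty (lab (turn d)) -> exists b1 b2, ((vertex d = (lab d, lab (turn d), b2, b1)) \/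
    rotX (vertex d) = (lab d, lab (turn d), b2, b1)) /\ ty b1 /\ ty b2 = false.
Proof.
rewrite /lab /turn /vertex /=; case: (nth _ C d.1) => [[[p q] r] v]; case: d => i s /=.
elim/ord4_case: s => /=; case tp : (ty p); case tq : (ty q); case tr : (ty r); case tv : (ty v) => //= _ _ _.
  by exists v, r; split; [left|].
by exists q, p; split; [right|].
Qed.

Lemma shape_over ty C (d : dart (Diagram C 0)) : typed_at ty (vertex d) -> ty (lab d) ->
  ty (lab (turn d)) = false -> exists a1 a2, ((vertex d = (a2, lab d, lab (turn d), a1)) \/
    rotX (vertex d) = (a2, lab d, lab (turn d), a1)) /\ ty a1 /\ ty a2 = false.
Proof.
rewrite /lab /turn /vertex /=; case: (nth _ C d.1) => [[[p q] r] v]; case: d => i s /=.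
elim/ord4_case: s => /=; case tp : (ty p); case tq : (ty q); case tr : (ty r); case tv : (ty v) => //= _ _ _.
  by exists v, p; split; [left|].
by exists q, r; split; [right|].
Qed.

Lemma bigon_shape ty C (d : dart (Diagram C 0)) : typing ty C -> bigon ty d ->
  exists a1 a2 b1 b2 e1 e2 C0, [/\ like C (bigonD a1 a2 b1 b2 e1 e2 C0),
    [/\ ty e1, ty a1 & ty b1] & [/\ ty e2 = false, ty a2 = false & ty b2 = false]].
Proof.
move=> T; have [g o _ _] := T; have [wC _ _ _] := g.
have main (e : dart (Diagram C 0)) : bigon ty e -> ty (lab e) -> exists a1 a2 b1 b2 e1 e2 C0, [/\ like C (bigonD a1 a2 b1 b2 e1 e2 C0),
    [/\ ty e1, ty a1 & ty b1] & [/\ ty e2 = false, ty a2 = false & ty b2 = false]]; last first.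
  move=> bd; case td0 : (ty (lab d)); first exact: main bd td0.
  have := bd; rewrite /bigon => /and3P[m1 m2 /eqP E]; apply: (main (facestep d)).
    by rewrite /bigon E m2 m1 eqxx.
  by have := @td_f C ty g o d; rewrite /dart_type td0 -mx_f m2 => ->.
case/and3P=> m1 m2 /eqP ffe te; set e' := facestep e in m2 ffe.
have te' : ty (lab e') = false by have := @td_f C ty g o e; rewrite /dart_type te -mx_f m2 => ->.
have tu : turn (other e') = e by [].
(* The two corners lie at different crossings: a slot next to that of [e] has the other type, and
   the opposite slot would make [e'] its own second end. *)
have v12 : e.1 != (other e).1.
  apply/eqP => E; have E' : (other e).1 = e.1 by [].
  have [ne le] := other_spec wC e; have to : dart_type ty (other e) by rewrite /dart_type le.
  case: (same_vertex E') => E2.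
  - by rewrite E2 eqxx in ne.
  - by move: to; rewrite E2 td_turn // m1 /dart_type te.
  - have : turn e' = e by rewrite /e' fE E2; case: (e) => i s; rewrite /turn /=; congr (_, _); elim/ord4_case: s; apply: val_inj.
    move=> E3; have /turn_inj E4 := etrans E3 (esym tu).
    by have [] := other_spec wC e'; rewrite -E4 eqxx.
  - by have := td_turn o (other e); rewrite E2 /dart_type te le te -mx_f m2.
have [C0 p] := perm_nth2 (ltn_ord (other e).1) (ltn_ord e.1) (contra_neq (@esym _ _ _) (contra_neq (@val_inj _ _ _ _ _) v12)).
have le : lab (other e) = lab e by have [] := other_spec wC e.
have le' : lab (other e') = lab e' by have [] := other_spec wC e'.
have o1 := allP o _ (vx_mem e); have o2 := allP o _ (vx_mem (other e)).
have [b1 [b2 [h1 [tb1 tb2]]]] : exists b1 b2, ((vertex e = (lab e', lab e, b2, b1)) \/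
    rotX (vertex e) = (lab e', lab e, b2, b1)) /\ ty b1 /\ ty b2 = false.
  have := @shape_under ty C (other e').
  by rewrite -[vertex (other e')]/(vertex (turn (other e'))) tu le' => /(_ o1 te' te).
have [a1 [a2 [h2 [ta1 ta2]]]] : exists a1 a2, ((vertex (other e) = (a2, lab e, lab e', a1)) \/
    rotX (vertex (other e)) = (a2, lab e, lab e', a1)) /\ ty a1 /\ ty a2 = false.
  have := @shape_over ty C (other e).
  by rewrite -/(facestep e) -/e' le => /(_ o2 te te').
exists a1, a2, b1, b2, (lab e), (lab e'), C0; split; [|by split|by split].
rewrite /bigonD; apply: like_trans (like_perm p) _.
rewrite -/(vertex e) -/(vertex (other e)).
apply: (@like_trans _ ((a2, lab e, lab e', a1) :: vertex e :: C0)).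
  by case: h2 => <-; [apply: like_perm|exact: (like_rot [::])].
by case: h1 => <-; [apply: like_perm|exact: (like_rot [:: _])].
Qed.

(* If the two outer ends of a bigon strand were the same edge, that strand would
   be a component of its part without pure crossings, contradicting that the
   part is connected. *)
Lemma bigon_uniq ty a1 a2 b1 b2 e1 e2 C0 : typing ty (bigonD a1 a2 b1 b2 e1 e2 C0) ->
  [/\ ty e1, ty a1 & ty b1] -> [/\ ty e2 = false, ty a2 = false & ty b2 = false] ->
  (forall s, has (pure s ty) (bigonD a1 a2 b1 b2 e1 e2 C0)) -> uniq [:: a1; a2; b1; b2].
Proof.
set C := bigonD _ _ _ _ _ _ _ => [[[w _ _ _] o t _]] [te1 ta1 tb1] [te2 ta2 tb2] hp.
have ne x y : ty x -> ty y = false -> (x == y) = false by move=> tx ty_; apply/eqP => E; rewrite E ty_ in tx.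
have pw : perm_eq (labs C) [:: e1, e1, e2, e2, a1, b1, a2, b2 & labs C0].
  by rewrite /C /bigonD /labs /=; apply/seq.permP => q /=; clear; blia.
have /wls_cons2[n1 /wls_cons2[n2 w']] := wls_perm pw w.
have m1 : mixed ty (a2, e1, e2, a1) by rewrite /mixed /pure /= te1 te2 ta1 ta2.
have m2 : mixed ty (e2, e1, b2, b1) by rewrite /mixed /pure /= te1 te2 tb1 tb2.
have contr s (P : nat -> bool) x : x \in labs C -> ty x = s -> P x -> all (const_on_type s ty P) C ->
    (forall l, l \in labs C0 -> ~~ P l) -> False.
  move=> xC tx Px aP nP; have := hp s; rewrite /C /= !(mixed_pure _ m1) (mixed_pure _ m2) /=.
  case/hasP => y yC py; have [l ly] : exists l, l \in clabels y.
    by case: (y) => [[[a b] c] d]; exists a; rewrite mem_head.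
  have lC0 : l \in labs C0 by apply/lab_mem; exists y.
  have lC : l \in labs C by rewrite (perm_mem pw) !inE lC0 !orbT.
  have tl : ty l = s by exact/eqP/(allP py).
  by have := t s P aP x l xC lC tx tl; rewrite Px (negbTE (nP l lC0)).
have tail s P : (forall l, l \in labs C0 -> ~~ P l) -> all (const_on_type s ty P) C0.
  move=> nP; apply/allP => x xC; apply/tcstP => l l' lx l'x _ _.
  by rewrite (negbTE (nP l _)) ?(negbTE (nP l' _)) //; apply/lab_mem; exists x.
have ab : a1 != b1.
  apply/negP => /eqP E; have /wls_cons2[n3 _] : wls [:: a1, a1, a2, b2 & labs C0].
    by rewrite {2}E.
  have nP l : l \in labs C0 -> ~~ ((l == a1) || (l == e1)).
    move=> lC; apply/negP => /orP[]/eqP El; rewrite El in lC.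
      by move: n3; rewrite !inE lC !orbT.
    by move: n1; rewrite !inE lC !orbT.
  apply: (@contr true (fun l => (l == a1) || (l == e1)) a1) => //.
  - by rewrite (perm_mem pw) !inE eqxx !orbT.
  - by rewrite eqxx.
  - rewrite /C /= (tail _ _ nP) andbT /const_on_type /= te1 ta1 tb1 te2 ta2 tb2 -E !eqxx /= ?orbT //.
have ab2 : a2 != b2.
  apply/negP => /eqP E; have /wls_cons2[n3 _] : wls [:: a2, a2, a1, b1 & labs C0].
    by apply: wls_perm w'; rewrite {2}E; apply/seq.permP => q /=; clear; blia.
  have nP l : l \in labs C0 -> ~~ ((l == a2) || (l == e2)).
    move=> lC; apply/negP => /orP[]/eqP El; rewrite El in lC.
      by move: n3; rewrite !inE lC !orbT.
    by move: n2; rewrite !inE lC !orbT.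
  apply: (@contr false (fun l => (l == a2) || (l == e2)) a2) => //.
  - by rewrite (perm_mem pw) !inE eqxx !orbT.
  - by rewrite eqxx.
  - rewrite /C /= (tail _ _ nP) andbT /const_on_type /= te1 ta1 tb1 te2 ta2 tb2 -E !eqxx /= ?orbT //.
by rewrite /= !inE !negb_or (ne a1 a2) // (ne a1 b2) // ab (eq_sym a2 b1) (ne b1 a2) // ab2 (ne b1 b2).
Qed.

Definition ready ty C := [/\ typing ty C, forall s, has (pure s ty) C &
  forall s, connected_labels (filter (pure s ty) C)].

Lemma ready_like ty C C' : ready ty C -> like C C' -> ready ty C' /\ lequiv C C'.
Proof.
move=> [T h l] lk; have [T' e'] := tst_like lk T; split=> //; split=> // s.
  by rewrite -(eqv_has (@pureX_rot s ty) lk.2).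
have v : same_up_to_rot (filter (pure s ty) C) (filter (pure s ty) C').
  move=> Q r; rewrite !count_filter; apply: lk.2.
  by move=> x /=; rewrite r pureX_rot.
move=> P aP k k'; rewrite -!(labs_mem_eqv _ v); apply: (l s).
rewrite (eqv_all _ v) //; case=> [[[a b] c] d] /=.
by case: (P a) (P b) (P c) (P d) => [] [] [] [].
Qed.

Lemma splittable_equiv C C' : lequiv C C' -> splittable (Dg C') -> splittable (Dg C).
Proof. by move=> e [D' [e' n]]; exists D'; split=> //; apply: rst_trans e e'. Qed.

Lemma bigon_delete ty a1 a2 b1 b2 e1 e2 C0 : let C := bigonD a1 a2 b1 b2 e1 e2 C0 in
  ready ty C -> [/\ ty e1, ty a1 & ty b1] -> [/\ ty e2 = false, ty a2 = false & ty b2 = false] ->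
  splittable (Dg C) \/ exists C', [/\ ready ty C', lequiv C C' & count (mixed ty) C' < count (mixed ty) C].
Proof.
move=> C [T hp lc] t1 t2; have u := bigon_uniq T t1 t2 hp.
have [g o t ht] := T; have [w _ _ _] := g.
move: t1 t2 => [te1 ta1 tb1] [te2 ta2 tb2].
have [r1 r2 r3 r4] := R2sub_ab u; have [p1 p2 _ _] := R2_ports w u.
have in0 l : l \in [:: a1; a2; b1; b2] -> l \in labs C0.
  by move=> /(count0_ab w u) E; rewrite -has_pred1 has_count E.
have [A1 hA1] := R2_dart a1 a2 b1 b2 e1 e2 (in0 a1 (mem_head _ _)).
have [A2 hA2] := @R2_dart a1 a2 b1 b2 e1 e2 _ _ (in0 a2 (ltac:(by rewrite !inE eqxx orbT))).
have [B1 hB1] := @R2_dart a1 a2 b1 b2 e1 e2 _ _ (in0 b1 (ltac:(by rewrite !inE eqxx !orbT))).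
have [B2 hB2] := @R2_dart a1 a2 b1 b2 e1 e2 _ _ (in0 b2 (ltac:(by rewrite !inE eqxx !orbT))).
pose s := R2sub a1 a2 b1 b2; pose C2 := map (mapX s) C0.
have ts l : ty (s l) = ty l.
  by rewrite /s /R2sub; case: eqP => [->|_]; [rewrite ta1 tb1|case: eqP => [->|//]; rewrite ta2 tb2].
have m1 : mixed ty (a2, e1, e2, a1) by rewrite /mixed /pure /= te1 te2 ta1 ta2.
have m2 : mixed ty (e2, e1, b2, b1) by rewrite /mixed /pure /= te1 te2 tb1 tb2.
have ps b x : pure b ty (mapX s x) = pure b ty x.
  by case: x => [[[p q] r] v]; rewrite /pure /= !ts.
have [g2|split2] := good_R2_del w u hA1 hA2 hB1 hB2 g; last first.
  (* The deletion has disconnected the diagram, so the result has two pieces and exhibits the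
     splitting. *)
  left; have [v2 n2] := split2 0; exists (Diagram C2 0); split; last by rewrite /npieces n2.
  apply: rst_step; split; first exact: good_valid.
  split; first exact: v2.
  have := st_R2 a1 a2 b1 b2 e1 e2 C0 0.
  have [[h1 h2 h3 h4 h5] h6] := uabE u.
  have s1 : sub1 a1 b1 a2 = a2 by rewrite /sub1 (negbTE h2) (negbTE h4).
  have s2 : sub1 a1 b1 b2 = b2 by rewrite /sub1 (negbTE h2) eq_sym (negbTE h6).
  rewrite s1 s2 /Defs.merge (negbTE h2) (negbTE h5) /= /subst -map_comp.
  rewrite (@eq_map _ _ _ (mapX s)) // => -[[[a b] c] d] /=.
  have E l : (if (if l == b1 then a1 else l) == b2 then a2 else if l == b1 then a1 else l) = s l.
    by rewrite /s /R2sub; case: (eqVneq l b1) => _ //; rewrite (negbTE h3).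
  by rewrite !E.
have fE b : filter (pure b ty) C2 = map (mapX s) (filter (pure b ty) C0).
  by rewrite filter_map; congr map; apply: eq_filter => x; apply: ps.
have hC0 b : has (pure b ty) C0.
  by have := hp b; rewrite /C /= !(mixed_pure _ m1) (mixed_pure _ m2).
have hC2 b : has (pure b ty) C2.
  by rewrite has_map; apply: sub_has (hC0 b) => x /=; rewrite ps.
right; exists C2; split; last first.
- rewrite /C /= m1 m2 count_map (eq_count (a2 := mixed ty)); first by clear; lia.
  by move=> x; rewrite /mixed /= !ps.
- exact: lequiv_sym (R2_lequiv u g g2).
split; [|exact: hC2|]; last first.
  move=> b; rewrite fE => P aP l l'.
  have := lc b; rewrite /C /= !(mixed_pure _ m1) (mixed_pure _ m2) => lc0.
  have aP0 : all (const_at (P \o s)) (filter (pure b ty) C0).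
    by move: aP; rewrite all_map; apply: sub_all => -[[[p q] r] v].
  rewrite !labs_mapX => /mapP[k kC ->] /mapP[k' k'C ->]; exact: lc0 aP0 _ _ kC k'C.
split; [exact: g2| | |].
- move: o; rewrite /C /= => /and3P[_ _ /allP o0]; apply/allP => y /mapP[x xC ->].
  by have := o0 x xC; case: (x) => [[[p q] r] v]; rewrite /= !ts.
- move=> b; apply: tconn_transfer (t b) _ => P aP.
  (* Each side of the bigon takes the value of the strand to which it belongs. *)
  pose P' l := if l == e1 then P a1 else if l == e2 then P a2 else P (s l).
  have n1 l : l \in [:: a1; a2; b1; b2] ++ labs C0 -> (l == e1) = false /\ (l == e2) = false.
    move=> lC; split; apply/eqP => E; rewrite E in lC; by rewrite lC in p1 p2.
  have Pn l : l \in [:: a1; a2; b1; b2] ++ labs C0 -> P' l = P (s l).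
    by move=> /n1[E1 E2]; rewrite /P' E1 E2.
  have e21 : (e2 == e1) = false by apply/eqP => E; rewrite E te1 in te2.
  exists P'.
    have q1 : P' a1 = P a1 by rewrite Pn ?mem_cat ?inE ?eqxx ?orbT // /s r1.
    have q2 : P' a2 = P a2 by rewrite Pn ?mem_cat ?inE ?eqxx ?orbT // /s r2.
    have q3 : P' b1 = P a1 by rewrite Pn ?mem_cat ?inE ?eqxx ?orbT // /s r3.
    have q4 : P' b2 = P a2 by rewrite Pn ?mem_cat ?inE ?eqxx ?orbT // /s r4.
    have q5 : P' e1 = P a1 by rewrite /P' eqxx.
    have q6 : P' e2 = P a2 by rewrite /P' e21 eqxx.
    rewrite /C /=; apply/and3P; split; rewrite ?/const_on_type /= ?te1 ?ta1 ?tb1 ?te2 ?ta2 ?tb2 ?q1 ?q2 ?q3 ?q4 ?q5 ?q6.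
    + by case: (b) (P a1) (P a2) => [] [] [].
    + by case: (b) (P a1) (P a2) => [] [] [].
    apply/allP => x xC; have : const_on_type b ty P (mapX s x) by apply: (allP aP); apply: map_f.
    move/tcstP => h; apply/tcstP => l l' lx l'x tl tl'.
    have lC : l \in labs C0 by apply/lab_mem; exists x.
    have l'C : l' \in labs C0 by apply/lab_mem; exists x.
    rewrite !Pn ?mem_cat ?lC ?l'C ?orbT //.
    by apply: h; rewrite ?ts // clabels_mapX map_f.
  move=> l; rewrite labs_mapX => /mapP[k kC ->] tk; exists k; split.
  + by rewrite /C /bigonD /labs /= !inE -/(labs C0) kC !orbT.
  + by rewrite -tk ts.
  + by rewrite Pn // mem_cat kC orbT.
- move=> b; have /hasP[x xC px] := hC2 b; have [l lx] : exists l, l \in clabels x.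
    by case: (x) => [[[p q] r] v]; exists p; rewrite mem_head.
  by exists l; [apply/lab_mem; exists x|exact/eqP/(allP px)].
Qed.

(** The descent cannot run out of mixed crossings: a ready diagram always has a bigon between its
    parts, so it ends in the disconnecting case of [bigon_delete]. *)
Lemma ready_split ty C : ready ty C -> splittable (Dg C).
Proof.
have [n le] := ubnP (count (mixed ty) C); elim: n C le => // n IH C le r.
have [T h l] := r; have [d bd] := bigon_exists T h l.
have [a1 [a2 [b1 [b2 [e1 [e2 [C0 [lk t1 t2]]]]]]]] := bigon_shape T bd.
have [r1 q1] := ready_like r lk; apply: (splittable_equiv q1).
case: (bigon_delete r1 t1 t2) => // -[C' [r2 q2 lt]].
apply: (splittable_equiv q2); apply: IH r2.
apply: leq_trans lt _; rewrite -(lk.2 _ (mixed_rot ty)) -ltnS; exact: le.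
Qed.

(** * Splitting a layered diagram *)

(** A part may have no self-crossing from which a cluster could grow; a kink on one of its edges
    supplies one. *)
Lemma add_pure s ty C : typing ty C -> exists ty' C', [/\ typing ty' C', lequiv C C', has (pure s ty') C' &
  forall s', has (pure s' ty) C -> has (pure s' ty') C'].
Proof.
move=> T; have [_ _ _ /(_ s)[l /lab_mem[x xC lx] tl]] := T.
have [u [o1 [o2 [o3 [lk _]]]]] := pull1 (perm_to_rem xC) lx.
have [T1 e1] := tst_like lk T; have [N fN] := exists_fresh (mkX u l o1 o2 o3 :: rem x C).
have [ty' [T2 e2 ag r0 r1]] := kink_typed fN T1.
have := fN; rewrite fresh_mkX => /and5P[ll l1 l2 l3 fC].
eexists ty', _; split; [exact: T2|exact: lequiv_trans e1 e2| |].
  by rewrite /= pureX_mkX r0 r1 ag // tl eqxx.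
move=> s'; rewrite (eqv_has (@pureX_rot s' ty) lk.2) /= !pureX_mkX => /orP[/and4P[h1 h2 h3 h4]|h].
  by rewrite r0 r1 !ag // h1.
have [_ E] := agreeb_all ag fC; apply/orP; right; apply/orP; right.
by case/hasP: h => y yC py; apply/hasP; exists y; rewrite ?E.
Qed.

Lemma make_ready ty C : typing ty C -> exists ty' C', ready ty' C' /\ lequiv C C'.
Proof.
move=> T0; have [ty1 [C1 [T1 e1 h1 _]]] := add_pure true T0.
have [ty2 [C2 [T2 e2 h2 k2]]] := add_pure false T1.
have [ty3 [C3 [T3 e3 l3 h3 p3]]] := pure_cluster T2 (k2 _ h1).
have h3' : has (pure false ty3) C3 by rewrite has_filter -size_eq0 (perm_size p3) size_eq0 -has_filter.
have [ty4 [C4 [T4 e4 l4 h4 p4]]] := pure_cluster T3 h3'.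
exists ty4, C4; split; last exact: lequiv_trans e1 (lequiv_trans e2 (lequiv_trans e3 e4)).
split; [exact: T4| |]; case.
- by rewrite has_filter -size_eq0 (perm_size p4) size_eq0 -has_filter.
- exact: h4.
- by apply: lconn_perm2 l3; rewrite perm_sym.
- exact: l4.
Qed.

Theorem separation ty C : good C -> all (typed_at ty) C ->
  (forall s, exists2 l, l \in labs C & ty l = s) -> splittable (Dg C).
Proof.
move=> g o h; have [ty1 T] := make_type_connected g o h; have [ty2 [C2 [r e]]] := make_ready T.
exact: splittable_equiv e (ready_split r).
Qed.

(** * From layers and reductions to numbers of colors *)

Lemma zc_mono gam x : zcolored gam x -> spread gam x = 0 -> {in clabels x &, forall l l', gam l = gam l'}.
Proof.
case: x => [[[a b] c] d] /andP[/eqP h1 /eqP h2] h3.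
have [hb hc hd] : [/\ gam b = gam a, gam c = gam a & gam d = gam a].
  by move: h1 h2 h3; rewrite /spread; clear; split; lia.
by move=> l l'; rewrite !inE => /or4P[]/eqP -> /or4P[]/eqP ->; rewrite ?hb ?hc ?hd.
Qed.

Lemma nontrivial_df gam g C : good C -> all (zcolored gam) C -> nontrivial (Dg C) gam g ->
  has (fun x => 0 < spread gam x) C.
Proof.
move=> gC z; apply: contraLR => nh; rewrite -leqNgt /ncolors /colors /= cats0.
have [wC lc _ _] := gC; case E : (labs C) => [|l0 s]; first by rewrite /labels /= -/(labs C) E.
have l0C : l0 \in labs C by rewrite E mem_head.
have cs : all (const_at (fun l => gam l == gam l0)) C.
  apply/allP => x xC; apply/cstP => l l' lx l'x.
  rewrite (zc_mono (allP z x xC) _ lx l'x) //; apply/eqP; rewrite -leqn0 leqNgt.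
  by move/hasPn: nh; apply.
apply: (@uniq_leq_size _ _ [:: gam l0]); first exact: undup_uniq.
move=> c; rewrite mem_undup => /mapP[l lC ->]; rewrite inE.
by rewrite (lc _ cs l l0 lC l0C) eqxx.
Qed.

Lemma df_nontrivial gam g C : all (zcolored gam) C -> has (fun x => 0 < spread gam x) C -> nontrivial (Dg C) gam g.
Proof.
move=> z /hasP[x xC dx]; rewrite /nontrivial /ncolors /colors /= cats0.
have inl l : l \in clabels x -> gam l \in undup [seq gam l | l <- labs C].
  by move=> lx; rewrite mem_undup map_f //; apply/lab_mem; exists x.
case: x xC dx inl => [[[a b] c] d] xC dx inl.
apply: (@uniq_leq_size _ [:: gam a; gam c]).
  by rewrite /= inE andbT; apply: contraTneq dx => E; rewrite /spread E subrr.
by move=> k; rewrite !inE => /orP[]/eqP ->; apply: inl; rewrite !inE eqxx ?orbT.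
Qed.

(** A crossing that is not one-colored shows three colors in arithmetic progression, so there are no
    others. An under-edge of the middle color beneath an extreme color would need a partner beyond
    the progression; the edges of the middle color form the upper part. *)
Lemma three_colors_split gam g C : good C -> all (zcolored gam) C -> has (fun x => 0 < spread gam x) C ->
  ncolors (Dg C) gam g <= 3 -> splittable (Dg C).
Proof.
move=> gC z /hasP[[[[a0 b0] c0] d0] x0C dx0]; rewrite /ncolors /colors /= cats0 => le3.
have := allP z _ x0C => /andP[/eqP h1 /eqP h2].
have inS x l : x \in C -> l \in clabels x -> gam l \in undup [seq gam l | l <- labs C].
  by move=> xC lx; rewrite mem_undup map_f //; apply/lab_mem; exists x.
have only l : l \in labs C -> gam l \in [:: gam a0; gam b0; gam c0].
  move=> lC; apply/negPn/negP => nin; move: le3; rewrite leqNgt => /negP; apply.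
  apply: (@uniq_leq_size _ [:: gam l; gam a0; gam b0; gam c0]).
    rewrite cons_uniq nin /= !inE negb_or andbT.
    by move: h1 h2 dx0; rewrite /spread; clear; lia.
  move=> k; rewrite inE => /orP[/eqP ->|]; first by rewrite mem_undup map_f.
  by rewrite !inE => /or3P[]/eqP ->; apply: (inS _ _ x0C); rewrite !inE eqxx ?orbT.
apply: (@separation (fun l => gam l == gam b0) C gC).
  apply/allP => -[[[a b] c] d] xC; have := allP z _ xC => /andP[/eqP h3 /eqP h4].
  have lC l : l \in [:: a; b; c; d] -> gam l \in [:: gam a0; gam b0; gam c0].
    by move=> lx; apply: only; apply/lab_mem; exists (a, b, c, d).
  have := lC a; have := lC b; have := lC c; rewrite !inE !eqxx !orbT /= => /(_ isT) ic /(_ isT) ib /(_ isT) ia.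
  by move: h1 h2 h3 h4 ic ib ia dx0; rewrite /typed_at /spread; clear; lia.
case.
  by exists b0; rewrite ?eqxx //; apply/lab_mem; exists (a0, b0, c0, d0); rewrite // !inE eqxx orbT.
exists a0; first by apply/lab_mem; exists (a0, b0, c0, d0); rewrite // !inE eqxx.
by move: h1 h2 dx0; rewrite /spread; clear; lia.
Qed.

(** With at most one piece, a diagram without crossings has at most one circle and hence at most one
    color. *)
Lemma nonsplit_good D gam g : valid D -> npieces D <= 1 -> nontrivial D gam g ->
  circ D = 0 /\ good (xs D).
Proof.
case: D => C k v n1 nt; have C0 : C <> [::].
  move=> E; move: nt n1; rewrite E /nontrivial /ncolors /colors /labels /npieces /= => nt n1.
  have : size (undup [seq g i | i <- iota 0 k]) <= k.
    by apply: leq_trans (size_undup _) _; rewrite size_map size_iota.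
  by move=> h; have := leq_trans (leq_trans nt h) (leq_trans (leq_addl _ _) n1).
have gt0 := ngcomp_gt0 C0; have E : ngcomp (Diagram C k) = ngcomp (Diagram C 0) by [].
move: n1; rewrite /npieces /= E => n1; split; first by move: n1 gt0; clear; lia.
by apply: (valid_good v C0); rewrite E; move: n1; clear; lia.
Qed.

Theorem theorem5p4 (D0 : diagram) :
  valid D0 -> non_splittable D0 ->
  (exists D gam g, link_equiv D0 D /\ valid D /\ Zcoloring D gam /\
                   ncolors D gam g = 5) ->
  mincolZ_is D0 4.
Proof.
move=> _ ns [D [gam [g [e [v [z n5]]]]]].
have pieces D' : link_equiv D0 D' -> npieces D' <= 1.
  by move=> e'; rewrite leqNgt; apply/negP => n2; apply: ns; exists D'.
have lower D' gam' g' : link_equiv D0 D' -> valid D' -> Zcoloring D' gam' ->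
    nontrivial D' gam' g' -> 4 <= ncolors D' gam' g'.
  move=> e' v' z' nt; have [k0 gC] := nonsplit_good v' (pieces _ e') nt.
  case: D' e' v' z' nt k0 gC => C k e' v' z' nt /= k0 gC; subst k.
  rewrite ltnNge; apply/negP => le3; apply: ns.
  have za := (ZcoloringP C 0 gam').1 z'.
  have [D2 [e2 n2]] := three_colors_split gC za (nontrivial_df gC za nt) le3.
  by exists D2; split=> //; apply: rst_trans e' e2.
split=> //.
have nt : nontrivial D gam g by rewrite /nontrivial n5.
have [k0 gC] := nonsplit_good v (pieces _ e) nt.
case: D e v z n5 nt k0 gC => C k e v z n5 nt /= k0 gC; subst k.
have za := (ZcoloringP C 0 gam).1 z.
have [C1 [gam1 [m [g1 e1 z1 h1 rng]]]] := color_reduction gC za (nontrivial_df gC za nt).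
have eD : link_equiv D0 (Dg C1) by apply: rst_trans e e1.
have v1 : valid (Dg C1) by exact: good_valid.
have zD : Zcoloring (Dg C1) gam1 by apply/ZcoloringP.
have ntD : nontrivial (Dg C1) gam1 g by exact: df_nontrivial.
exists (Dg C1), gam1, g; do 4!split=> //.
apply/eqP; rewrite eqn_leq lower // andbT /ncolors /colors /= cats0.
apply: (@uniq_leq_size _ _ [:: m; (m + 1)%R; (m + 2)%R; (m + 3)%R]); first exact: undup_uniq.
move=> c; rewrite mem_undup => /mapP[l lC ->]; have := rng l lC; rewrite !inE.
by clear; lia.
Qed.
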